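(* Let $p$ be a prime. A Cayley digraph $\Gamma$ of a group $G$ of order $p^2$ is nonnormal if and only if $\Gamma$ is isomorphic to one of the following graphs. (1) $\Gamma=K_{p^2}$, where $p\ge 3$, or $p=2$ and $G=\mathbb{Z}_4$. (2) $\Gamma=\Gamma_1\wr\Gamma_2$, where $\Gamma_1$ and $\Gamma_2$ are Cayley digraphs of the cyclic group of order $p$, $p\ge 3$. (3) $\Gamma$ is a Cayley digraph of $\mathbb{Z}_p^2$ but not of $\mathbb{Z}_{p^2}$, $p\ge 5$, with connection set $S=\{(i,0),(0,j):i,j\in\mathbb{Z}_p\}\setminus\{(0,0)\}$, or the complement of this graph. (4) $\Gamma$ is a Cayley digraph of $\mathbb{Z}_p^2$ but not of $\mathbb{Z}_{p^2}$, $p\ge 5$, whose connection set $S$ satisfies the following properties, where $H=\{(0,i):i\in\mathbb{Z}_p\}$: (a) $H\cap S=\emptyset$ or $H\cap S=H\setminus\{(0,0)\}$; (b) for every coset $(a,0)+H\neq H$ of $H$, $\bigl((a,0)+H\bigr)\cap S$ is one of $(a,0)+H$, $\emptyset$, $\{(a,0)\}$, or $\bigl((a,0)+H\bigr)\setminus\{(a,0)\}$.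
   Context: For a group $G$ and a set $S\subseteq G\setminus\{1\}$ (the connection set), the Cayley digraph of $G$ with connection set $S$ has vertex set $G$ and arcs $(g,gs)$ for $g\in G$, $s\in S$; the left regular representation $G_L=\{h\mapsto gh: g\in G\}$ is contained in its automorphism group. A Cayley digraph $\Gamma$ of $G$ is normal if $G_L$ is a normal subgroup of $\mathrm{Aut}(\Gamma)$, and nonnormal otherwise. $K_{p^2}$ is the complete graph on $p^2$ vertices. ''But not of $\mathbb{Z}_{p^2}$'' means that $\Gamma$ is not isomorphic to any Cayley digraph of $\mathbb{Z}_{p^2}$. The wreath product $\Gamma_1\wr\Gamma_2$ of digraphs has vertex set $V(\Gamma_1)\times V(\Gamma_2)$, with an arc from $(x,y)$ to $(x',y')$ if and only if $(x,x')$ is an arc of $\Gamma_1$, or $x=x'$ and $(y,y')$ is an arc of $\Gamma_2$.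
   Formalization: The formal theorem excludes the single case p=2, G≅Z_4, S=∅ (edgeless digraph): its automorphism group is S_4, so it is nonnormal, yet it is not K_4 and (2)–(4) need p≥3, so the statement as written fails there. *)

(* Defs.v *)
From mathcomp Require Import all_boot all_fingroup all_algebra.

Set Implicit Arguments.
Unset Strict Implicit.
Unset Printing Implicit Defensive.

Local Open Scope group_scope.

(* A digraph on the finite vertex set T is its arc relation e : rel T. *)

Definition digraph_iso (T1 T2 : finType) (e1 : rel T1) (e2 : rel T2) : Prop :=
  exists2 f : T1 -> T2, bijective f & forall x y, e2 (f x) (f y) = e1 x y.

Definition digraph_aut (T : finType) (e : rel T) : {set {perm T}} :=
  [set f : {perm T} | [forall x, forall y, e (f x) (f y) == e x y]].

Lemma digraph_aut_group_set (T : finType) (e : rel T) :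
  group_set (digraph_aut e).
Proof.
apply/group_setP; split=> [|f g].
  by rewrite inE; apply/forallP=> x; apply/forallP=> y; rewrite !perm1.
rewrite !inE => /forallP fP /forallP gP.
apply/forallP=> x; apply/forallP=> y; rewrite !permM.
by rewrite (eqP (forallP (gP _) _)) (eqP (forallP (fP _) _)).
Qed.

Canonical digraph_aut_group (T : finType) (e : rel T) : {group {perm T}} :=
  group (digraph_aut_group_set e).

Definition complete_digraph (T : finType) : rel T := fun x y => x != y.

Definition digraph_compl (T : finType) (e : rel T) : rel T :=
  fun x y => (x != y) && ~~ e x y.

Definition wreath (T1 T2 : finType) (e1 : rel T1) (e2 : rel T2) :
    rel (T1 * T2)%type :=
  fun u v => e1 u.1 v.1 || ((u.1 == v.1) && e2 u.2 v.2).

(* The connection sets S are those with 1 \notin S; for such S the arcs of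
   cayley S are exactly the pairs (g, g * s) with s in S. *)
Definition cayley (gT : finGroupType) (S : {set gT}) : rel gT :=
  fun g h => g^-1 * h \in S.

Definition cayley_digraph_of (gT : finGroupType) (T : finType) (e : rel T) :
    Prop :=
  exists2 S : {set gT}, 1 \notin S & digraph_iso e (cayley S).

Definition left_regular (gT : finGroupType) : {set {perm gT}} :=
  [set perm (@mulgI gT g) | g : gT].

(* The product of {perm gT} is composition from left to right, so
   g |-> (h |-> g * h) is an anti-morphism; its image is still a subgroup. *)
Lemma left_regular_group_set (gT : finGroupType) :
  group_set (left_regular gT).
Proof.
apply/group_setP; split=> [|f g].
  by apply/imsetP; exists 1 => //; apply/permP=> h; rewrite perm1 permE mul1g.
case/imsetP=> a _ -> /imsetP[b _ ->]; apply/imsetP; exists (b * a) => //.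
by apply/permP=> h; rewrite permM !permE mulgA.
Qed.

Canonical left_regular_group (gT : finGroupType) : {group {perm gT}} :=
  group (left_regular_group_set gT).

Definition normal_cayley (gT : finGroupType) (S : {set gT}) : bool :=
  left_regular gT <| digraph_aut (cayley S).

(* 'Z_p * 'Z_p carries the (additively defined) direct product group law. *)
Definition axes (p : nat) : {set 'Z_p * 'Z_p} :=
  ([set (i, 0%R) | i : 'Z_p] :|: [set (0%R, j) | j : 'Z_p]) :\ (0%R, 0%R).

Definition vertical_axis (p : nat) : {set 'Z_p * 'Z_p} := [set (0%R, i) | i : 'Z_p].

(* Main.v *)
(* Let P be the left regular representation and A the automorphism group.  If
   some subgroup H of order p is such that every coset of H other than H lies in
   S or misses S, the digraph is a wreath product.  Otherwise P is a Sylow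
   p-subgroup of A.  By Schur, S is then invariant enough under coprime powers
   for automorphisms to act on coordinates through functions over F_p with few
   slopes, and such functions are affine by Redei.  Hence an automorphism which
   centralizes a nontrivial translation normalizes P, unless S is of type (4).
   In the former case two conjugates of P meet trivially, and one shows that an
   element of A normalizing two of them fixes exactly one point; a count of
   fixed points against conjugates of P, through second moments of the
   displacements v^-1 * g v, then gives P <| A.
   Conversely each listed digraph has a nontrivial automorphism fixing more than
   half of the vertices, which an affine map of the group cannot do (apart from
   K_4, where a transposition is visibly not affine). *)

Require Import Defs.
From mathcomp Require Import all_boot all_order all_fingroup all_algebra.
From mathcomp Require Import cyclic pgroup sylow hall finfield.
From mathcomp Require Import zify ring.

Set Implicit Arguments.
Unset Strict Implicit.
Unset Printing Implicit Defensive.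

Import Order.TTheory GRing.Theory Num.Theory.

Local Open Scope group_scope.

(** * Translations and displacement moments *)

(** The delicate elements of A are those normalizing no conjugate of P: nothing is known in advance
    about their fixed points. Weight each element by 1 minus the number of conjugates of P that it
    normalizes. A function of sum 0 built from S has displacement 0 on all elements normalizing two
    conjugates, so its weighted sum of squared displacements is nonnegative; a variance over the
    point stabilizer forces the opposite sign. Equality becomes invariance of a convolution with S.
    As a non-integral rational is no eigenvalue of an integer matrix, S can then be replaced by the
    identity element, whose displacements count fixed points.

    The bound of (p + 1) / 2 slopes fits because a predicate on residues or its negation holds for
    at most that many, and automorphisms preserve both. When slopes exceed it, the multipliers
    preserving S up to a shear exceed half of the multiplicative group, hence fill it: this is type
    (4). The bound p >= 5 has two sources: more than (p + 1) / 2 nonzero residues exist only for p >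
    3, and a transposition fixes more than half of p points only for p > 4. *)

Definition translation (gT : finGroupType) (a : gT) : {perm gT} :=
  perm (@mulgI gT a).

Lemma translationE (gT : finGroupType) (a x : gT) : translation a x = a * x.
Proof. by rewrite permE. Qed.

Lemma translationM (gT : finGroupType) (a b : gT) :
  translation a * translation b = translation (b * a).
Proof. by apply/permP => x; rewrite permM !translationE mulgA. Qed.

Lemma translation1 (gT : finGroupType) : translation (1 : gT) = 1.
Proof. by apply/permP => x; rewrite translationE perm1 mul1g. Qed.

Lemma translationV (gT : finGroupType) (a : gT) :
  (translation a)^-1 = translation a^-1.
Proof.
by apply: (mulgI (translation a)); rewrite mulgV translationM mulVg translation1.
Qed.

Lemma translationX (gT : finGroupType) (a : gT) n :
  translation a ^+ n = translation (a ^+ n).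
Proof.
elim: n => [|n IHn]; first by rewrite translation1.
by rewrite expgS IHn translationM -expgSr.
Qed.

Lemma translation_inj (gT : finGroupType) : injective (@translation gT).
Proof.
by move=> a b /permP/(_ 1); rewrite !translationE !mulg1.
Qed.

Lemma mem_translation (gT : finGroupType) (a : gT) :
  translation a \in left_regular gT.
Proof. exact: imset_f. Qed.

Lemma card_left_regular (gT : finGroupType) : #|left_regular gT| = #|gT|.
Proof. by rewrite card_imset ?cardsT //; apply: translation_inj. Qed.

Lemma left_regularP (gT : finGroupType) (g : {perm gT}) :
  reflect (exists a, g = translation a) (g \in left_regular gT).
Proof.
apply: (iffP imsetP) => [[a _ ->]|[a ->]]; first by exists a.
by exists a.
Qed.

(** The normalizer is the holomorph: the conjugate of [translation x] by [g] can only be the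
    translation by [g x * (g 1)^-1], and this is the affine law. *)
Lemma norm_left_regularP (gT : finGroupType) (g : {perm gT}) :
  reflect (forall x y, g (x * y) = g x * (g 1)^-1 * g y)
          (g \in 'N(left_regular gT)).
Proof.
apply: (iffP idP) => [Ng x y | aff].
  have /left_regularP[b Eb]: translation x ^ g \in left_regular gT.
    by rewrite memJ_norm ?mem_translation.
  have E z : g (x * z) = b * g z.
    by rewrite -[in RHS]translationE -Eb conjgE !permM permK translationE.
  by rewrite E -[x]mulg1 E mulgK.
rewrite inE; apply/subsetP=> _ /imsetP[f /left_regularP[a ->] ->].
apply/left_regularP; exists (g a * (g 1)^-1); apply/permP => x.
by rewrite conjgE !permM !translationE aff permKV.
Qed.

Section SecondMoment.

Variable gT : finGroupType.
Hypothesis abG : forall x y : gT, x * y = y * x.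

Implicit Types (Y : {group {perm gT}}) (g h : {perm gT}) (a : gT -> int).

Definition stab1 (Y : {set {perm gT}}) : {set {perm gT}} :=
  [set g in Y | g 1 == 1].

Lemma stab1P (Y : {set {perm gT}}) g :
  reflect (g \in Y /\ g 1 = 1) (g \in stab1 Y).
Proof. by rewrite inE; apply: (iffP andP) => -[-> /eqP]. Qed.

(** Each [g] in [Y] is [translation v^-1 * h * translation (v * d)] for exactly one [d] and one [h]
    fixing 1, namely with [d = v^-1 * g v]. The base point [v] is free, so a moment can be expanded
    where one displacement is just [d]. *)
Lemma sum_regular (R : nmodType) Y (v : gT) (F : {perm gT} -> R) :
  left_regular gT \subset Y ->
  (\sum_(g in Y) F g =
   \sum_d \sum_(h in stab1 Y) F (translation v^-1 * h * translation (v * d))%g)%R.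
Proof.
move=> /subsetP sPY; have tY b : translation b \in Y by exact/sPY/mem_translation.
rewrite (partition_big (fun g : {perm gT} => v^-1 * g v) xpredT) //=.
apply: eq_bigr => d _.
rewrite (reindex_onto (fun h => translation v^-1 * h * translation (v * d))
           (fun g => translation v * g * translation (v * d)^-1)) /=; last first.
  move=> g _; rewrite !mulgA translationM mulgV translation1 mul1g -mulgA.
  by rewrite translationM mulgV translation1 mulg1.
apply: eq_bigl => h; rewrite inE !mulgA translationM mulVg translation1 mul1g.
rewrite -!mulgA translationM mulVg translation1 mulg1 eqxx andbT.
rewrite !permM !translationE mulVg -!mulgA mulKg.
by rewrite groupMl // groupMr // -{2}[d]mulg1 (inj_eq (mulgI _)).
Qed.

Definition displacement a g : int := (\sum_v a (v^-1 * g v)%g)%R.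

Lemma card_stab1 Y : left_regular gT \subset Y -> (#|gT| * #|stab1 Y|)%N = #|Y|.
Proof.
move=> sPY; apply/eqP; rewrite -(eqr_nat int) natrM; apply/eqP.
have := sum_regular 1 (fun=> 1%R : int) sPY; rewrite sumr_const => ->.
under [RHS]eq_bigr do rewrite sumr_const.
by rewrite sumr_const mulr_natl.
Qed.

Lemma first_moment a Y : left_regular gT \subset Y ->
  (\sum_(g in Y) displacement a g = #|Y|%:R * \sum_d a d)%R.
Proof.
move=> sPY; rewrite exchange_big /= -(card_stab1 sPY).
rewrite (eq_bigr (fun=> #|stab1 Y|%:R * \sum_d a d)%R) => [|v _].
  by rewrite sumr_const natrM -mulr_natl; ring.
rewrite (sum_regular v) // mulr_sumr; apply: eq_bigr => d _.
rewrite (eq_bigr (fun=> a d)) ?sumr_const ?mulr_natl // => h /stab1P[_ h1].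
by rewrite !permM !translationE mulVg h1 mulg1 mulKg.
Qed.

Definition autocorrelation a Y : int :=
  (\sum_(h in stab1 Y) \sum_x \sum_s a (x * s)%g * a (x * h s)%g)%R.

(** The square is expanded over base points [v] and [w = v * s]. The displacement at [w] is
    [s^-1 * d * h s]; commutativity and the substitution [d = x * s] give the two factors of
    [autocorrelation]. *)
Lemma second_moment a Y : left_regular gT \subset Y ->
  (\sum_(g in Y) displacement a g ^+ 2 = #|gT|%:R * autocorrelation a Y)%R.
Proof.
move=> sPY.
rewrite (eq_bigr (fun g : {perm gT} => \sum_v \sum_w a (v^-1 * g v)%g * a (w^-1 * g w)%g)%R);
  last first.
  by move=> g _; rewrite expr2 mulr_suml; apply: eq_bigr => v _; rewrite mulr_sumr.
rewrite exchange_big /=.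
rewrite (eq_bigr (fun=> autocorrelation a Y)) ?sumr_const ?mulr_natl // => v _.
rewrite (sum_regular v) // exchange_big /=; apply: eq_bigr => h /stab1P[_ h1].
rewrite (eq_bigr (fun d => \sum_s a d * a (d * s^-1 * h s)%g)%R); last first.
  move=> d _; rewrite (reindex_inj (mulgI v)) /=; apply: eq_bigr => s _.
  rewrite !permM !translationE mulVg h1 mulg1 !mulKg invMg -!mulgA mulKg.
  by rewrite [(s^-1 * _)%g]abG -!mulgA (abG (h s)).
rewrite exchange_big [RHS]exchange_big /=; apply: eq_bigr => s _.
rewrite (reindex_inj (mulIg s)) /=; apply: eq_bigr => x _.
by rewrite mulgK.
Qed.

Lemma stab1_group_set Y : group_set (stab1 Y).
Proof.
apply/group_setP; split=> [|g h /stab1P[Yg g1] /stab1P[Yh h1]].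
  by apply/stab1P; rewrite group1 perm1.
by apply/stab1P; rewrite groupM // permM g1.
Qed.
Canonical stab1_group Y := group (stab1_group_set Y).

Definition stab1_sum a Y (x s : gT) : int := (\sum_(n in stab1 Y) a (x * n s)%g)%R.

Lemma sum_sqr_diff (I J : finType) (F G : I -> J -> int) :
  (\sum_i \sum_j (F i j - G i j) ^+ 2 = \sum_i \sum_j F i j ^+ 2 +
   \sum_i \sum_j G i j ^+ 2 - 2 * \sum_i \sum_j F i j * G i j)%R.
Proof.
rewrite -big_split mulr_sumr -sumrB; apply: eq_bigr => i _ /=.
rewrite -big_split mulr_sumr -sumrB; apply: eq_bigr => j _ /=; ring.
Qed.

Lemma stab1_sum_corr a Y h :
  (\sum_x \sum_s stab1_sum a Y x (h s) * stab1_sum a Y x s =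
   \sum_(n in stab1 Y) \sum_(m in stab1 Y)
     \sum_x \sum_s a (x * s)%g * a (x * (m^-1 * h * n)%g s)%g)%R.
Proof.
transitivity (\sum_x \sum_s \sum_(n in stab1 Y) \sum_(m in stab1 Y)
  a (x * n (h s))%g * a (x * m s)%g)%R.
  apply: eq_bigr => x _; apply: eq_bigr => s _; rewrite mulr_suml.
  by apply: eq_bigr => n _; rewrite mulr_sumr.
under eq_bigr do rewrite exchange_big /=.
rewrite exchange_big /=; apply: eq_bigr => n _.
under eq_bigr do rewrite exchange_big /=.
rewrite exchange_big /=; apply: eq_bigr => m _.
apply: eq_bigr => x _; rewrite (reindex_inj (@perm_inj _ m^-1)) /=.
by apply: eq_bigr => s _; rewrite permKV !permM mulrC.
Qed.

(** Its left side is a variance, along the orbits of [stab1 X], of the sums over [stab1 N]. Hence it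
    compares second moments over [N] and [X], with equality exactly when these sums are invariant
    under [stab1 X]. The inequality and both directions of the equality case are used. *)
Lemma variance_identity a (X N : {group {perm gT}}) : N \subset X ->
  (\sum_(h in stab1 X) \sum_x \sum_s
     (stab1_sum a N x (h s) - stab1_sum a N x s) ^+ 2 =
   2 * #|stab1 N|%:R * (#|stab1 X|%:R * autocorrelation a N
                        - #|stab1 N|%:R * autocorrelation a X))%R.
Proof.
move=> sNX.
have sN1X1 : {subset stab1 N <= stab1 X}.
  by move=> g /stab1P[Ng g1]; apply/stab1P; rewrite (subsetP sNX).
have E1 : (\sum_x \sum_s stab1_sum a N x s ^+ 2 =
           #|stab1 N|%:R * autocorrelation a N)%R.
  have := stab1_sum_corr a N 1.
  under eq_bigr do under eq_bigr do rewrite perm1 -expr2.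
  move=> ->; rewrite exchange_big /= mulr_natl -sumr_const.
  apply: eq_bigr => m N1m; rewrite (reindex_inj (mulgI m)) /=.
  apply: eq_big => [n|n _]; first by rewrite groupMl.
  by rewrite mulg1 mulKg.
have E2 h : (\sum_x \sum_s stab1_sum a N x (h s) ^+ 2 =
             #|stab1 N|%:R * autocorrelation a N)%R.
  by rewrite -E1; apply: eq_bigr => x _; rewrite [RHS](reindex_inj (@perm_inj _ h)).
have E3 : (\sum_(h in stab1 X) \sum_x \sum_s
      stab1_sum a N x (h s) * stab1_sum a N x s =
      #|stab1 N|%:R * #|stab1 N|%:R * autocorrelation a X)%R.
  under eq_bigr do rewrite stab1_sum_corr.
  rewrite exchange_big /= -mulrA mulr_natl -sumr_const; apply: eq_bigr => n N1n.
  rewrite exchange_big /= mulr_natl -sumr_const; apply: eq_bigr => m N1m.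
  rewrite (reindex_inj (mulgI m)) (reindex_inj (mulIg n^-1)) /=.
  apply: eq_big => [h|h _].
    by rewrite (groupMl _ (sN1X1 _ N1m)) (groupMr _ (groupVr (sN1X1 _ N1n))).
  by rewrite !mulgA mulVg mul1g mulgKV.
under eq_bigr do rewrite sum_sqr_diff E1 E2.
rewrite sumrB sumr_const -mulr_sumr E3 -mulr_natl; ring.
Qed.

End SecondMoment.

(** * A normality criterion for regular subgroups *)

(** Double counting of pairs formed by an element and a conjugate of [P] that it normalizes; as [F]
    is a class function, all conjugates contribute equally. *)
Lemma sum_conjugates_norm (gT : finGroupType) (P X : {group gT}) (F : gT -> int) :
  {in X &, forall g x, F (g ^ x) = F g} ->
  (\sum_(g in X) #|[set Q in P :^: X | g \in 'N(Q)]|%:R * F g =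
   #|P :^: X|%:R * \sum_(g in 'N_X(P)) F g)%R.
Proof.
move=> Finv.
transitivity (\sum_(g in X) \sum_(Q in P :^: X) (g \in 'N(Q))%:R * F g)%R.
  apply: eq_bigr => g _; rewrite -mulr_suml; congr (_ * _)%R.
  rewrite -sum1_card natr_sum [LHS](eq_bigl (fun Q => (Q \in P :^: X) && (g \in 'N(Q)))).
    by rewrite big_mkcondr /=; apply: eq_bigr => Q _; case: (_ \in _).
  by move=> Q; rewrite inE.
rewrite exchange_big /= mulr_natl -sumr_const; apply: eq_bigr => _ /imsetP[x Xx ->].
rewrite [RHS](reindex_inj (conjg_inj x^-1)) /= [RHS]big_mkcond [LHS]big_mkcond /=.
apply: eq_bigr => g _; rewrite in_setI groupJr ?groupV //.
rewrite normJ mem_conjg; case Xg: (g \in X) => //=.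
by case: ifP => _; rewrite ?mul1r ?mul0r // Finv ?groupV.
Qed.

(** A rational eigenvalue of an integer matrix is an integer, so [- s / q] is none. The proof is a
    descent: the image of [f] under [B] is again an integral eigenvector and is strictly smaller in
    absolute value wherever [f] is nonzero. *)
Lemma integral_eigen0 (T : finType) (B : T -> T -> int) (s q : nat) (f : T -> int) :
  0 < s < q -> (forall x, q%:R * \sum_y B x y * f y = - s%:R * f x)%R ->
  forall x, f x = 0%R.
Proof.
case/andP=> s0 sq; have [m] := ubnP (\sum_x `|f x|)%N.
elim: m f => // m IHm f ltm Bf.
pose f1 x := (\sum_y B x y * f y)%R.
have Ef1 x : (q%:R * f1 x = - s%:R * f x)%R := Bf x.
have Bf1 x : (q%:R * \sum_y B x y * f1 y = - s%:R * f1 x)%R.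
  rewrite {2}/f1 !mulr_sumr; apply: eq_bigr => y _.
  by rewrite mulrCA Ef1; ring.
have le1 x : `|f1 x| <= `|f x| by have := Ef1 x; nia.
have eq1 x : `|f1 x| = `|f x| -> f x = 0%R by have := Ef1 x; nia.
have [//|] := boolP [forall x, f x == 0%R]; first by move=> /forallP f0 x; apply/eqP.
rewrite negb_forall => /existsP[x0 fx0].
have f10 : forall x, f1 x = 0%R.
  apply: IHm => //; rewrite ltnS in ltm; apply: leq_trans ltm.
  rewrite (bigD1 x0) // [X in _ < X](bigD1 x0) //= -addSn leq_add //.
    by rewrite ltn_neqAle le1 andbT; apply: contra fx0 => /eqP/eq1->.
  by apply: leq_sum.
by move=> x; have := Ef1 x; rewrite f10; nia.
Qed.

Section UniqueFixedPoint.

Variables (gT : finGroupType) (X : {group {perm gT}}) (S : {set gT}).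
Hypothesis abG : forall x y : gT, x * y = y * x.
Hypothesis PX : left_regular gT \subset X.
Hypothesis invS : {in X, forall (g : {perm gT}) x y, ((g x)^-1 * g y \in S) = (x^-1 * y \in S)}.
Hypotheses (S0 : S != set0) (S1 : 1 \notin S) (S2 : #|S| < #|gT|.-1).

Local Notation P := (left_regular_group gT).
Local Notation N := ('N_X(P))%G.
Local Notation q := #|gT|.

Definition nb_fix (g : {perm gT}) := #|[set v | g v == v]|.

Let delta (y : gT) : int := ((y == 1%g)%:R)%R.
Let ind (y : gT) : int := ((y \in S)%:R)%R.
(** The coefficients make [a] vanish at 1 and have total sum 0. Thus its displacement vanishes at
    the identity and at every element along which [v^-1 * g v] runs once through the group. *)
Let a (y : gT) : int := ((q%:R - 1) * ind y - #|S|%:R * (1 - delta y))%R.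

Lemma displacement_delta g : (displacement delta g = (nb_fix g)%:R)%R.
Proof.
rewrite /nb_fix -sum1_card natr_sum big_mkcond /=; apply: eq_bigr => v _.
rewrite inE /delta -eq_mulVg1 eq_sym; by case: (_ == _).
Qed.

Lemma displacementJ b :
  {in X, forall (g : {perm gT}) v w, b ((g v)^-1 * g w) = b (v^-1 * w)} ->
  {in X &, forall g x, displacement b (g ^ x) = displacement b g}.
Proof.
move=> binv g x _ Xx; rewrite /displacement (reindex_inj (@perm_inj _ x)) /=.
by apply: eq_bigr => v _; rewrite conjgE !permM permK binv.
Qed.

Lemma nb_fixJ g x : nb_fix (g ^ x) = nb_fix g.
Proof.
rewrite /nb_fix -[RHS](card_imset _ (@perm_inj _ x)); apply: eq_card => v.
rewrite inE; apply/eqP/imsetP => [gv|[w]].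
  exists (x^-1 v); last by rewrite permKV.
  by rewrite inE; apply/eqP/(@perm_inj _ x); rewrite -[in RHS]gv conjgE !permM permKV.
by rewrite inE => /eqP gw ->; rewrite conjgE !permM permK gw.
Qed.

(** The map sending [v] to [v^-1 * g v] is injective: if [v] and [w] have the same image, affinity
    makes [w * v^-1 * x0] a fixed point, hence equal to [x0]. *)
Lemma displacement_unique_fix b g : g \in 'N(P) -> nb_fix g = 1%N ->
  displacement b g = (\sum_y b y)%R.
Proof.
move=> /norm_left_regularP aff /eqP/cards1P[x0 fixg].
have fixE v : g v = v -> v = x0.
  by move=> gv; have : v \in [set w | g w == w]; [rewrite inE gv | rewrite fixg => /set1P].
have gx0 : g x0 = x0 by have := set11 x0; rewrite -fixg inE => /eqP.
rewrite /displacement [RHS](reindex_inj (h := fun v => v^-1 * g v)) //=.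
move=> v w /= E.
have gvw : g (w * v^-1 * x0) = w * v^-1 * x0.
  rewrite aff gx0.
  have -> : g (w * v^-1) = g w * (g v)^-1 * g 1.
    have := aff (w * v^-1) v; rewrite mulgKV => ->.
    by rewrite mulgK mulgKV.
  rewrite mulgK; congr (_ * x0).
  have -> : g w = w * (v^-1 * g v) by rewrite E mulKVg.
  by rewrite mulgA mulgK.
by have := fixE _ gvw => /(canRL (mulgK _)); rewrite mulgV => /(canRL (mulgKV _)); rewrite mul1g.
Qed.

Hypothesis fix1 : {in X &, forall g x, g \in 'N(P) -> g \in 'N(P :^ x) ->
  P :^ x != P -> g != 1 -> nb_fix g = 1%N}.

Let nu (g : {perm gT}) : nat := #|[set Q in P :^: X | g \in 'N(Q)]|.
Let n : nat := #|P :^: X|.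
Let k : nat := #|stab1 X|.
Let l : nat := #|stab1 N|.

Let PN : left_regular gT \subset N.
Proof. by rewrite subsetI PX normG. Qed.

Let NX : N \subset X. Proof. exact: subsetIl. Qed.

Let n_index : (n * #|N|)%N = #|X|.
Proof. by rewrite /n card_conjugates mulnC Lagrange. Qed.

Let q_gt1 : 1 < q. Proof. by have := S2; lia. Qed.

Let nl_k : (n * l)%N = k.
Proof.
have := n_index; rewrite -(card_stab1 PN) -(card_stab1 PX) /k /l; nia.
Qed.

Let l_gt0 : 0 < l. Proof. exact: (cardG_gt0 (stab1_group N)). Qed.

Let sum_nu (F : {perm gT} -> int) : {in X &, forall g x, F (g ^ x) = F g} ->
  (\sum_(g in X) (1 - (nu g)%:R) * F g =
   \sum_(g in X) F g - n%:R * \sum_(g in N) F g)%R.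
Proof.
move=> Finv; rewrite -(sum_conjugates_norm P Finv) -sumrB.
by apply: eq_bigr => g _; rewrite mulrBl mul1r.
Qed.

Let nu_ge2 g : g \in X -> 1 < nu g -> g != 1 ->
  exists y, [/\ y \in X, g ^ y \in 'N(P) & nb_fix (g ^ y) = 1%N].
Proof.
move=> Xg /card_gt1P[Q [Q' []]] /setIdP[/imsetP[x Xx ->] gx].
move=> /setIdP[/imsetP[x' Xx' ->] gx'] neq g1.
have Ng : g ^ x^-1 \in 'N(P) by rewrite -mem_conjg -normJ.
have Xx'x : x' * x^-1 \in X by rewrite groupM ?groupV.
have Ng' : g ^ x^-1 \in 'N(P :^ (x' * x^-1)).
  by rewrite conjsgM [in 'N(_)]normJ memJ_conjg.
exists x^-1; rewrite groupV; split=> //; apply: (fix1 _ Xx'x Ng Ng') => //.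
- by rewrite groupJ ?groupV.
- by apply: contra neq => /eqP E; rewrite -{1}E -conjsgM mulgKV.
by rewrite conjg_eq1.
Qed.

Let delta_inv : {in X, forall (g : {perm gT}) v w, delta ((g v)^-1 * g w) = delta (v^-1 * w)}.
Proof.
by move=> g _ v w; rewrite /delta -!eq_mulVg1 (inj_eq perm_inj).
Qed.

Let a_inv : {in X, forall (g : {perm gT}) v w, a ((g v)^-1 * g w) = a (v^-1 * w)}.
Proof. by move=> g Xg v w; rewrite /a /ind invS // delta_inv. Qed.

Let sum_ind : (\sum_y ind y = #|S|%:R)%R.
Proof. by rewrite -sum1_card natr_sum [RHS]big_mkcond; apply: eq_bigr => y _; rewrite /ind; case: (_ \in _). Qed.

Let sum_delta : (\sum_y delta y = 1)%R.
Proof. by rewrite (bigD1 1) //= big1 ?addr0 /delta ?eqxx // => y /negPf->. Qed.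

Let displacement_a g :
  displacement a g = ((q%:R - 1) * displacement ind g - #|S|%:R * (q%:R - (nb_fix g)%:R))%R.
Proof.
rewrite -displacement_delta /displacement sumrB -!mulr_sumr sumrB.
by rewrite sumr_const.
Qed.

Let nu_ge2_a g : g \in X -> 1 < nu g -> displacement a g = 0%R.
Proof.
move=> Xg nu2; have [->|g1] := eqVneq g 1.
  rewrite /displacement big1 // => v _; rewrite perm1 mulVg /a /ind (negPf S1).
  by rewrite /delta eqxx subrr !mulr0 subrr.
have [y [Xy Ny fy]] := nu_ge2 Xg nu2 g1.
rewrite -(displacementJ a_inv Xg Xy) (displacement_unique_fix _ Ny fy).
by rewrite sumrB -!mulr_sumr sumrB sum_ind sum_delta sumr_const; ring.
Qed.

(** Two signs collide. In [W] the terms with [nu g] at least 2 vanish by [nu_ge2_a], those with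
    [nu g = 1] by their weight, and the others are squares, so [W] is nonnegative. The variance [V]
    is nonnegative too, while [q V = - 2 l^2 W] because [k = n l]; hence both are 0. *)
Let variance_a : (\sum_(h in stab1 X) \sum_x \sum_s
     (stab1_sum a N x (h s) - stab1_sum a N x s) ^+ 2 <= 0 /\
   forall g, g \in X -> nu g = 0 -> displacement a g = 0)%R.
Proof.
have := variance_identity a NX; rewrite -/k -/l.
set V := (\sum_(h in _) _)%R => EV.
have V0 : (0 <= V)%R.
  by do 3!(apply: sumr_ge0 => ? _); rewrite sqr_ge0.
have aJ : {in X &, forall g x, (displacement a (g ^ x) ^+ 2 = displacement a g ^+ 2)%R}.
  by move=> g x Xg Xx; rewrite (displacementJ a_inv).
have := sum_nu aJ; rewrite !second_moment // => ES.
have T0 g : g \in X -> (0 <= (1 - (nu g)%:R) * displacement a g ^+ 2)%R.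
  move=> Xg; have [/(nu_ge2_a Xg)->|nu1] := boolP (1 < nu g).
    by rewrite expr0n mulr0.
  by rewrite mulr_ge0 ?sqr_ge0 // subr_ge0 lern1 leqNgt.
set W := (\sum_(g in X) _)%R in ES.
have W0 : (0 <= W)%R by apply: sumr_ge0.
have EVW : (q%:R * V = - 2 * l%:R * l%:R * W)%R.
  by rewrite EV ES -nl_k natrM; ring.
have l0 : (0 < (l%:R : int))%R by rewrite ltr0n.
have q0 : (0 < (q%:R : int))%R by rewrite ltr0n; lia.
have W00 : W = 0%R by nia.
split; first by nia.
move=> g Xg nu0; move: W00 => /eqP; rewrite psumr_eq0 // => /allP/(_ g).
rewrite mem_index_enum Xg nu0 subr0 mul1r sqrf_eq0 => /(_ isT)/eqP; exact.
Qed.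

(** The sums of [ind] are convolutions of [ind] with the sums of [delta]. So invariance of the sums
    of [a] says that the defect [f] of [delta] is an eigenvector of the integer matrix of [ind] for
    [- #|S| / (q - 1)], which lies strictly between -1 and 0. *)
Let sum_a_delta h t : h \in stab1 X -> forall x,
  stab1_sum delta N x (h t) = stab1_sum delta N x t.
Proof.
move=> X1h x; have [leV _] := variance_a.
have a0 x' : stab1_sum a N x' (h t) = stab1_sum a N x' t.
  have sq0 (g : {perm gT}) y s : (0 <= (stab1_sum a N y (g s) - stab1_sum a N y s) ^+ 2)%R.
    exact: sqr_ge0.
  move: leV; set V := (\sum_(h in _) _)%R => leV.
  have V0 : (0 <= V)%R by do 3!(apply: sumr_ge0 => ? _).
  have : V == 0%R by rewrite eq_le leV V0.
  rewrite /V => {V leV V0}.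
  rewrite psumr_eq0 => [/allP/(_ h)|g _]; last by do 2!(apply: sumr_ge0 => ? _).
  rewrite mem_index_enum X1h => /(_ isT) /=.
  rewrite psumr_eq0 => [/allP/(_ x')|y _]; last by apply: sumr_ge0.
  rewrite mem_index_enum => /(_ isT) /=.
  rewrite psumr_eq0 // => /allP/(_ t).
  by rewrite mem_index_enum sqrf_eq0 subr_eq0 => /(_ isT)/eqP.
apply/eqP; rewrite -subr_eq0; apply/eqP.
pose f y := (stab1_sum delta N y (h t) - stab1_sum delta N y t)%R.
apply: (@integral_eigen0 _ (fun y z => ind (y * z^-1)) #|S| q.-1 f).
  by rewrite S2 andbT card_gt0.
move=> y.
have Ea s : (stab1_sum a N y s = (q%:R - 1) * stab1_sum ind N y s
     - #|S|%:R * (l%:R - stab1_sum delta N y s))%R.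
  by rewrite /stab1_sum sumrB -!mulr_sumr sumrB sumr_const.
have Eind s : (stab1_sum ind N y s = \sum_z ind (y * z^-1)%g * stab1_sum delta N z s)%R.
  under [RHS]eq_bigr do rewrite mulr_sumr.
  rewrite exchange_big /=; apply: eq_bigr => m _.
  rewrite (bigD1 (m s)^-1) //= invgK /delta mulVg eqxx mulr1 big1 ?addr0 // => z.
  by rewrite eq_mulgV1 invgK => /negPf->; rewrite mulr0.
have Ef : (\sum_z ind (y * z^-1)%g * f z
    = stab1_sum ind N y (h t) - stab1_sum ind N y t)%R.
  by rewrite !Eind -sumrB; apply: eq_bigr => z _; rewrite mulrBr.
have Eq : (q.-1%:R = q%:R - 1 :> int)%R by rewrite -subn1 natrB //; lia.
have := a0 y; rewrite !Ea Ef Eq /f => E.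
by apply/eqP; rewrite -subr_eq0; move/eqP: E; rewrite -subr_eq0 => /eqP<-; apply/eqP; ring.
Qed.

Let autocorrelation_delta :
  (k%:R * autocorrelation delta N = l%:R * autocorrelation delta X)%R.
Proof.
have := variance_identity delta NX; rewrite big1 => [/esym/eqP|h X1h].
  rewrite mulf_eq0 subr_eq0 mulf_eq0 /= => /orP[|/eqP//].
  by rewrite pnatr_eq0 -/l eqn0Ngt l_gt0.
by rewrite big1 // => x _; rewrite big1 // => s _; rewrite sum_a_delta // subrr expr0n.
Qed.

(** Without fixed points, vanishing of the displacement of [a] would give [(q - 1) d = #|S| q] for
    an integer [d], so [q - 1] would divide [#|S|], which lies strictly between 0 and [q - 1]. *)
Let nb_fix_gt0 g : g \in X -> nu g = 0 -> 0 < nb_fix g.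
Proof.
move=> Xg nu0; have [_ /(_ g Xg nu0)] := variance_a; rewrite displacement_a.
rewrite lt0n; apply: contra_eqN => /eqP->; rewrite subr0.
have S_gt0 : 0 < #|S| by rewrite card_gt0.
have q1 : (q%:R = #|gT|.-1%:R + 1 :> int)%R by rewrite natr1 prednK //; lia.
have ltSq := S2; rewrite q1; set d := displacement ind g.
set r := #|gT|.-1 in ltSq q1 *; apply/eqP => E.
have {}E : (r%:R * (d - #|S|%:R) = #|S|%:R)%R.
  by move/eqP: E; rewrite subr_eq0 => /eqP E; move: E; rewrite addrK => E; rewrite mulrBr E; ring.
have [d_le|d_gt] := lerP d #|S|%:R; first by nia.
have d_ge : (1 <= d - #|S|%:R)%R by lia.
nia.
Qed.

Lemma nb_fix_le g : nb_fix g <= q. Proof. exact: max_card. Qed.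

Lemma nb_fix_full g : nb_fix g = q -> g = 1.
Proof.
move=> fg; apply/permP => x; rewrite perm1; apply/eqP.
have : x \in [set v | g v == v]; last by rewrite inE.
have -> // : [set v | g v == v] = setT.
by apply/eqP; rewrite eqEcard subsetT cardsT -fg leqnn.
Qed.

Lemma nb_fix1 : nb_fix 1 = q.
Proof. by rewrite /nb_fix -cardsT; apply: eq_card => v; rewrite !inE perm1 eqxx. Qed.

(* With nu g the number of conjugates of P normalized by g, conjugation
   invariance makes the sums over X of 1 - nu, (1 - nu) fix and (1 - nu) fix^2
   vanish, hence also that of (1 - nu) (fix - 1) (q - fix).  All terms of the
   latter are nonnegative, which forces fix = 1 wherever nu = 0 and leaves
   only g = 1 in the sum of (1 - nu) (fix - 1): P has a single conjugate. *)
Theorem normal_of_unique_fixed_point : left_regular gT <| X.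
Proof.
pose F (g : {perm gT}) : int := ((nb_fix g)%:R)%R.
have FJ : {in X &, forall g x, F (g ^ x) = F g} by move=> g x _ _; rewrite /F nb_fixJ.
have Fd g : F g = displacement delta g by rewrite displacement_delta.
have sumF Y : (\sum_(g in Y) F g = \sum_(g in Y) displacement delta g)%R.
  by apply: eq_bigr => g _; rewrite displacement_delta.
have sum1 : (\sum_(g in X) (1 - (nu g)%:R : int) = 0)%R.
  have := @sum_nu (fun=> 1%R); rewrite !sumr_const => /(_ (fun _ _ _ _ => erefl)).
  by under eq_bigr do rewrite mulr1; move=> ->; rewrite -n_index natrM subrr.
have sum2 : (\sum_(g in X) (1 - (nu g)%:R) * F g = 0)%R.
  by rewrite sum_nu // !sumF !first_moment // -n_index natrM; ring.
have sum3 : (\sum_(g in X) (1 - (nu g)%:R) * F g ^+ 2 = 0)%R.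
  rewrite sum_nu => [|g x Xg Xx]; last by rewrite FJ.
  under eq_bigr do rewrite Fd.
  under [X in (_ - _ * X)%R]eq_bigr do rewrite Fd.
  rewrite !second_moment //.
  apply: (mulfI (_ : (l%:R : int) != 0)%R); first by rewrite pnatr_eq0 -lt0n.
  rewrite mulr0.
  transitivity (q%:R * (l%:R * autocorrelation delta X - k%:R * autocorrelation delta N))%R.
    by rewrite -nl_k natrM; ring.
  by rewrite autocorrelation_delta subrr mulr0.
have nuge2 g : g \in X -> 1 < nu g -> g != 1 -> nb_fix g = 1%N.
  by move=> Xg nu2 g1; have [y [_ _]] := nu_ge2 Xg nu2 g1; rewrite nb_fixJ.
pose G g := ((1 - (nu g)%:R) * (F g - 1) * (q%:R - F g))%R.
have sumG : (\sum_(g in X) G g = 0)%R.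
  transitivity (\sum_(g in X) ((q%:R + 1) * ((1 - (nu g)%:R) * F g)
    - (1 - (nu g)%:R) * F g ^+ 2 - q%:R * (1 - (nu g)%:R)))%R.
    by apply: eq_bigr => g _; rewrite /G; ring.
  by rewrite !sumrB -!mulr_sumr sum1 sum2 sum3; ring.
have G_ge0 g : g \in X -> (0 <= G g)%R.
  move=> Xg; rewrite /G /F; have [nu2|] := boolP (1 < nu g).
    have [->|g1] := eqVneq g 1; first by rewrite nb_fix1 subrr mulr0.
    by rewrite nuge2 // subrr mulr0 mul0r.
  rewrite -leqNgt leq_eqVlt => /orP[/eqP->|]; first by rewrite subrr !mul0r.
  rewrite ltnS leqn0 => /eqP nu0; rewrite nu0 subr0 mul1r.
  by rewrite mulr_ge0 // subr_ge0 ?ler1n ?ler_nat ?nb_fix_le ?nb_fix_gt0.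
have n_gt0 : 0 < n by rewrite card_gt0; apply/set0Pn; exists (gval P); apply: orbit_refl.
have nu1 : nu 1 = n.
  by rewrite /nu /n; apply: eq_card => Q; rewrite in_set group1 andbT.
have nu0 g : g \in X -> g != 1 -> ((1 - (nu g)%:R) * (F g - 1) = 0)%R.
  move=> Xg g1; move/eqP: sumG; rewrite psumr_eq0 // => /allP/(_ g).
  rewrite mem_index_enum Xg => /(_ isT); rewrite /G mulf_eq0 => /orP[/eqP//|].
  rewrite subr_eq0 /F eqr_nat => /eqP/esym/nb_fix_full g11.
  by rewrite g11 eqxx in g1.
have sum4 : (\sum_(g in X) (1 - (nu g)%:R) * (F g - 1) = 0)%R.
  by under eq_bigr do rewrite mulrBr mulr1; rewrite sumrB sum1 sum2 subrr.
rewrite (bigD1 1) //= big1 ?addr0 in sum4; last by move=> g /andP[]; exact: nu0.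
have n1 : n = 1%N.
  move: sum4; rewrite nu1 /F nb_fix1 => /eqP; rewrite mulf_eq0 !subr_eq0.
  rewrite eq_sym pnatr_eq1 => /orP[/eqP//|]; rewrite pnatr_eq1; have := q_gt1; lia.
have NeqX : N = X :> {set _}.
  by apply/eqP; rewrite eqEcard NX -n_index n1 mul1n leqnn.
by rewrite /normal PX -NeqX subsetIr.
Qed.

End UniqueFixedPoint.

(** * Coprime powers of the connection set *)

Section Schur.

Variables (gT : finGroupType) (S : {set gT}) (g : {perm gT}).
Hypothesis abG : forall x y : gT, x * y = y * x.
Hypothesis invS : forall x y, ((g x)^-1 * g y \in S) = (x^-1 * y \in S).

Lemma coprime_expg_inj m : coprime #|gT| m -> injective (fun x : gT => x ^+ m).
Proof.
move=> com x y /= E; rewrite -cardsT in com.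
by rewrite -(expgK com (in_setT x)) E (expgK com (in_setT y)).
Qed.

Lemma Frobenius_sum_comm (R : nzRingType) q (I : Type) (r : seq I) (M : I -> R) :
  q \in [pchar R]%R -> (forall s t, GRing.comm (M s) (M t)) ->
  ((\sum_(s <- r) M s) ^+ q = \sum_(s <- r) M s ^+ q)%R.
Proof.
move=> chR Mcomm; rewrite -(pFrobenius_autE chR).
elim: r => [|s r IHr]; first by rewrite !big_nil pFrobenius_aut0.
by rewrite !big_cons pFrobenius_autD_comm ?IHr //; apply: commr_sum.
Qed.

Section Adjacency.

Variables (n q : nat) (ix : gT -> 'I_n.+1) (xi : 'I_n.+1 -> gT).
Hypotheses (ixK : cancel ix xi) (xiK : cancel xi ix).
Hypotheses (q_pr : prime q) (coq : coprime #|gT| q).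

Definition shift_mx (s : gT) : 'M['F_q]_n.+1 :=
  (\matrix_(i, j) (xi i * s == xi j)%g%:R)%R.

Definition adjacency_mx : 'M['F_q]_n.+1 := (\sum_(s in S) shift_mx s)%R.

Lemma shift_mxM s t : (shift_mx s * shift_mx t = shift_mx (s * t)%g)%R.
Proof.
apply/matrixP => i j; rewrite !mxE (bigD1 (ix (xi i * s))) //= !mxE ixK eqxx.
rewrite mul1r mulgA big1 ?addr0 // => k neq; rewrite !mxE.
case: eqP => [E|]; last by rewrite mul0r.
by rewrite E xiK eqxx in neq.
Qed.

Lemma shift_mxX s m : 0 < m -> (shift_mx s ^+ m = shift_mx (s ^+ m)%g)%R.
Proof.
by case: m => // m _; elim: m => // m IHm; rewrite exprS IHm shift_mxM -expgS.
Qed.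

Lemma adjacency_mxE i j : (adjacency_mx i j = ((xi i)^-1 * xi j \in S)%g%:R)%R.
Proof.
rewrite summxE; under eq_bigr do rewrite mxE.
case: (boolP (_ \in S)) => [Sd|Sd].
  rewrite (bigD1 ((xi i)^-1 * xi j)) //= mulKVg eqxx big1 ?addr0 // => s.
  by case/andP=> _; rewrite (canF_eq (mulKg _)) eq_sym => /negPf->.
apply: big1 => s Ss; case: eqP => // E; case/negP: Sd.
by rewrite -E mulKg.
Qed.

Lemma adjacency_mxX_inv m x y :
  ((adjacency_mx ^+ m) (ix (g x)) (ix (g y)) = (adjacency_mx ^+ m) (ix x) (ix y))%R.
Proof.
elim: m x => [|m IHm] x.
  by rewrite !expr0 !mxE !(can_eq ixK) (inj_eq perm_inj).
rewrite !exprS !mxE.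
rewrite (reindex (fun z => ix (g (xi z)))) /=; last first.
  by exists (fun z => ix (g^-1 (xi z))) => z _; rewrite ixK ?permK ?permKV xiK.
by apply: eq_bigr => z _; rewrite !adjacency_mxE !ixK invS -[z in RHS]xiK IHm ixK.
Qed.

(* In characteristic q the q-th power of the adjacency operator of S is the
   adjacency operator of the set of q-th powers of S. *)
Lemma adjacency_mx_Frobenius x y :
  ((adjacency_mx ^+ q) (ix x) (ix y) = (x^-1 * y \in [set s ^+ q | s in S])%g%:R)%R.
Proof.
have chM : q \in [pchar 'M['F_q]_n.+1]%R.
  rewrite inE q_pr -scaler_nat; apply/eqP.
  by rewrite pchar_Fp_0 // scale0r.
rewrite /adjacency_mx -big_enum Frobenius_sum_comm //=; last first.
  by move=> s t; rewrite /GRing.comm !shift_mxM abG.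
rewrite big_enum summxE /=.
have E s : ((shift_mx s ^+ q) (ix x) (ix y) = (x * s ^+ q == y)%g%:R)%R.
  by rewrite shift_mxX ?prime_gt0 // mxE !ixK.
under eq_bigr do rewrite E.
case: (boolP (_ \in _)) => [/imsetP[s Ss Es]|Sd].
  rewrite (bigD1 s) //= -Es mulKVg eqxx big1 ?addr0 // => t.
  case/andP=> _ neq; case: eqP => // E'; case/eqP: neq.
  by apply: (coprime_expg_inj coq); rewrite -Es -E' mulKg.
apply: big1 => s Ss; case: eqP => // Es; case/negP: Sd.
by apply/imsetP; exists s; rewrite // -Es mulKg.
Qed.

End Adjacency.

Lemma schur_prime q : prime q -> coprime #|gT| q ->
  forall x y, ((g x)^-1 * g y \in [set s ^+ q | s in S]) =
              (x^-1 * y \in [set s ^+ q | s in S]).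
Proof.
move=> q_pr coq x y.
have cardT : #|gT| = #|gT|.-1.+1 by rewrite prednK // -cardsT cardG_gt0.
pose ix (x : gT) : 'I_#|gT|.-1.+1 := cast_ord cardT (enum_rank x).
pose xi (i : 'I_#|gT|.-1.+1) : gT := enum_val (cast_ord (esym cardT) i).
have ixK : cancel ix xi by move=> z; rewrite /ix /xi cast_ordK enum_rankK.
have xiK : cancel xi ix by move=> z; rewrite /ix /xi enum_valK cast_ordKV.
have := adjacency_mxX_inv q ixK xiK q x y.
rewrite !(adjacency_mx_Frobenius ixK xiK q_pr coq).
by do 2!case: (_ \in _) => //= /eqP; rewrite ?(eq_sym 0%R) oner_eq0.
Qed.

End Schur.

(** Schur's theorem on multipliers: a [g] preserving [S] preserves the set of its [k]-th powers for
    [k] prime to the group order, by [schur_prime] applied to one prime factor of [k] after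
    another. *)
Lemma schur_preserve (gT : finGroupType) (S : {set gT}) (g : {perm gT}) m :
  (forall x y : gT, x * y = y * x) ->
  (forall x y, ((g x)^-1 * g y \in S) = (x^-1 * y \in S)) ->
  coprime #|gT| m ->
  forall x y, (((g x)^-1 * g y) ^+ m \in S) = ((x^-1 * y) ^+ m \in S).
Proof.
move=> abG invS com.
pose pw k := [set s ^+ k | s in S].
have G0 : 0 < #|gT| by rewrite -cardsT cardG_gt0.
have pwinv k : 0 < k -> coprime #|gT| k ->
  forall x y, ((g x)^-1 * g y \in pw k) = (x^-1 * y \in pw k).
  elim/ltn_ind: k => k IHk k0 cok.
  have [k1|k1] := leqP k 1.
    have -> : k = 1%N by lia.
    suff -> : pw 1%N = S by [].
    by apply/setP => s; apply/imsetP/idP => [[t St ->]|Ss] //; exists s.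
  have p_pr := pdiv_prime k1; have dvp := pdiv_dvd k.
  set p := pdiv k in p_pr dvp; have Ek : k = (k %/ p * p)%N by rewrite divnK.
  have k'0 : 0 < k %/ p by rewrite divn_gt0 ?prime_gt0 // dvdn_leq.
  have cop : coprime #|gT| p by apply: coprime_dvdr cok.
  have cok' : coprime #|gT| (k %/ p) by apply: coprime_dvdr cok; rewrite {2}Ek dvdn_mulr.
  have ltk : k %/ p < k by rewrite ltn_Pdiv ?prime_gt1.
  have -> : pw k = [set s ^+ p | s in pw (k %/ p)].
    apply/setP => s; apply/imsetP/imsetP => [[t St ->]|[_ /imsetP[t St ->] ->]].
      by exists (t ^+ (k %/ p)); [apply: imset_f | rewrite -expgM -Ek].
    by exists t; rewrite // -expgM -Ek.
  by apply: schur_prime => //; apply: IHk.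
have exq (z : gT) : z ^+ #|gT| = 1 by rewrite -cardsT expg_cardG ?in_setT.
have [m0|m_gt0] := posnP m.
  have G1 : #|gT| = 1%N by move: com; rewrite m0 /coprime gcdn0 => /eqP.
  have triv (z : gT) : z = 1 by have := exq z; rewrite G1.
  by move=> x y; congr (_ \in S); rewrite [LHS]triv [RHS]triv.
(* By Euler's theorem [k'] inverts [m] modulo the group order, so that [d] is a [k']-th power of an
   element of [S] exactly when [d ^+ m] lies in [S]. *)
pose k' := (m ^ (totient #|gT|).-1)%N.
have k'0 : 0 < k' by rewrite expn_gt0 m_gt0.
have cok' : coprime #|gT| k' by rewrite coprimeXr.
have Emk : (m * k' = 1 %[mod #|gT|])%N.
  by rewrite -expnS prednK ?totient_gt0 // Euler_exp_totient // coprime_sym.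
have mk (s : gT) : s ^+ (m * k') = s.
  by rewrite -(expg_mod _ (exq s)) Emk expg_mod.
have k'E (s : gT) : (s ^+ m) ^+ k' = s /\ (s ^+ k') ^+ m = s.
  by rewrite -!expgM [(k' * m)%N]mulnC mk.
move=> x y; have := pwinv k' k'0 cok' x y.
have pwE d : (d \in pw k') = (d ^+ m \in S).
  apply/imsetP/idP => [[s Ss ->]|Sd]; first by have [_ ->] := k'E s.
  by exists (d ^+ m) => //; have [->] := k'E d.
by rewrite !pwE.
Qed.

(** * Functions with few slopes *)

(** This puts the exponents chosen in [redei] within the range of [redei_moment]. The tight cases
    are [d = 2], where [p.-1] being even forces [b = 0], and [a = 1], where [b < d] have the same
    parity. *)
Lemma quotient_remainder_lt p d a b :
  odd p -> 1 < d -> p.-1 = (a * d + b)%N -> b < d -> 0 < a -> (a + b).*2 < p.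
Proof.
move=> p_odd d2 + ltb a0; rewrite -(odd_double_half p) p_odd add1n /=.
move: (p./2) => h E; rewrite -!muln2 in E *.
have [d_le2|d_gt2] := leqP d 2.
  have Ed : d = 2%N by lia.
  by rewrite Ed in E ltb; lia.
have [a_le1|a_gt1] := leqP a 1; last by nia.
have Ea : a = 1%N by lia.
by rewrite Ea in E *; lia.
Qed.

Section PrimeField.

Local Open Scope ring_scope.

Variable p : nat.
Hypothesis p_pr : prime p.
Local Notation F := 'F_p.

Lemma natr_Fp_neq0 k : (0 < k < p)%N -> (k%:R : F) != 0.
Proof.
case/andP=> k0 kp; rewrite -(dvdn_pcharf (pchar_Fp p_pr)); apply/negP => /(dvdn_leq k0).
by rewrite leqNgt kp.
Qed.

Lemma natr_fact_neq0 k : (k < p)%N -> (k`!%:R : F) != 0.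
Proof.
elim: k => [|k IHk] kp; first by rewrite fact0 oner_eq0.
by rewrite factS natrM; apply: mulf_neq0; [apply: natr_Fp_neq0 | apply/IHk/ltnW].
Qed.

Lemma expF_card (x : F) : x ^+ p = x.
Proof. by have := expf_card x; rewrite card_Fp. Qed.

Lemma expF_pred (x : F) : x ^+ p.-1 = (x != 0)%:R.
Proof.
have p1 : (p.-1 == 0)%N = false by have := prime_gt1 p_pr; lia.
have [->|x0] := eqVneq x 0; first by rewrite expr0n p1.
by apply: (mulfI x0); rewrite -exprS prednK ?prime_gt0 // expF_card mulr1.
Qed.

Lemma card_roots_lt (K : finFieldType) (Q : {poly K}) (A : {set K}) :
  Q != 0 -> {in A, forall x, root Q x} -> (#|A| < size Q)%N.
Proof.
move=> Q0 rQ; rewrite cardE; apply: max_poly_roots (enum_uniq _) => //.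
by apply/allP => x; rewrite mem_enum; apply: rQ.
Qed.

Lemma sum_expF k : (k < p.-1)%N -> \sum_(x : F) x ^+ k = 0.
Proof.
move=> ltk; have [->|k0] := posnP k.
  under eq_bigr do rewrite expr0.
  by rewrite sumr_const card_Fp // pchar_Fp_0.
have [c /andP[c0 ck]] : exists c : F, (c != 0) && (c ^+ k != 1).
  apply/existsP; rewrite -[[exists _, _]]negbK negb_exists; apply/negP => /forallP H.
  pose Q : {poly F} := 'X^k - 1%:P.
  have sQ : size Q = k.+1 by rewrite size_XnsubC.
  have Q0 : Q != 0 by rewrite -size_poly_eq0 sQ.
  suff /(card_roots_lt Q0) : {in [set~ (0 : F)], forall x, root Q x}.
    by rewrite sQ cardsC1 card_Fp // ltnS leqNgt ltk.
  move=> x; rewrite !inE => x0; move: (H x).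
  by rewrite x0 /= negbK rootE hornerD hornerN hornerXn hornerC subr_eq0.
apply/eqP.
have E : \sum_(x : F) x ^+ k = c ^+ k * \sum_(x : F) x ^+ k.
  rewrite {1}(reindex_inj (mulfI c0)) /= mulr_sumr.
  by apply: eq_bigr => x _; rewrite exprMn.
have : (1 - c ^+ k) * \sum_(x : F) x ^+ k = 0 by rewrite mulrBl mul1r -E subrr.
by move/eqP; rewrite mulf_eq0 subr_eq0 eq_sym (negPf ck).
Qed.

Lemma sum_expF_pred : \sum_(x : F) x ^+ p.-1 = -1.
Proof.
under eq_bigr do rewrite expF_pred.
rewrite (bigD1 (0 : F)) // eqxx /= add0r (eq_bigr (fun=> 1)) => [|x ->] //.
rewrite sumr_const cardC1 card_Fp // -subn1 mulrnBr ?prime_gt0 //.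
by rewrite pchar_Fp_0 // sub0r.
Qed.

Lemma sum_horner (Q : {poly F}) : (size Q <= p)%N -> \sum_x Q.[x] = - Q`_p.-1.
Proof.
move=> sQ; under eq_bigr do rewrite (horner_coef_wide _ sQ).
rewrite exchange_big /=; under eq_bigr do rewrite -mulr_sumr.
have p0 := prime_gt0 p_pr; have ltp : (p.-1 < p)%N by rewrite prednK.
rewrite (bigD1 (Ordinal ltp)) //= sum_expF_pred mulrN1 big1 ?addr0 // => i neq.
rewrite sum_expF ?mulr0 // -ltnS prednK // ltn_neqAle andbC -ltnS.
have := ltn_ord i; move: neq; rewrite -val_eqE /=; lia.
Qed.

Lemma interpolation (f : F -> F) :
  exists2 Q : {poly F}, (size Q <= p)%N & forall x, Q.[x] = f x.
Proof.
have p0 := prime_gt0 p_pr.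
exists (\sum_y f y *: (1 - ('X - y%:P) ^+ p.-1)).
  apply: (leq_trans (size_sum _ _ _)); apply/bigmax_leqP => y _.
  apply: (leq_trans (size_scale_leq _ _)).
  apply: (leq_trans (size_polyD _ _)); rewrite size_polyN size_poly1 geq_max p0 /=.
  by rewrite size_exp_XsubC prednK.
move=> x; rewrite horner_sum (bigD1 x) //= big1 ?addr0 => [|y neq].
  by rewrite hornerZ !hornerE expF_pred subrr eqxx subr0 mulr1.
by rewrite hornerZ !hornerE expF_pred subr_eq0 eq_sym neq subrr mulr0.
Qed.

Section Redei.

Variables (f : F -> F) (B : {set F}).
Hypothesis slopes : forall i j, i != j -> (f i - f j) / (i - j) \in B.
Hypothesis smallB : (#|B|.*2 <= p.+1)%N.

(** For [m] outside [B] the map [f t - t * m] permutes the field, so [R], the sum of the [k]-th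
    powers of [f t - t X], vanishes at [m] as a power sum. Its coefficient at [X^k] is also a power
    sum, so its degree is below [k], while at least [(p - 1) / 2] roots are available. Hence
    [R = 0], and its coefficient at [X^j] is the moment times an invertible binomial. *)
Lemma redei_moment i j : (0 < i + j)%N -> ((i + j).*2 < p)%N ->
  \sum_t t ^+ j * f t ^+ i = 0.
Proof.
set k := (i + j)%N => k0 kp.
pose R := \sum_t ((f t)%:P - t *: 'X) ^+ k : {poly F}.
have coefR (j' : nat) : (j' <= k)%N ->
    R`_j' = (\sum_t t ^+ j' * f t ^+ (k - j')) * ((-1) ^+ j' *+ 'C(k, j')).
  move=> j'k; rewrite coef_sum mulr_suml; apply: eq_bigr => t _.
  rewrite exprDn coef_sum (bigD1 (Ordinal (j'k : (j' < k.+1)%N))) //= big1 ?addr0.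
    rewrite -scaleNr exprZn -polyC_exp coefMn mul_polyC coefZ coefZ coefXn eqxx.
    by rewrite mulr1 mulrnAr [(- t) ^+ _]exprNn; congr (_ *+ _); ring.
  move=> l neq; rewrite -scaleNr exprZn -polyC_exp coefMn mul_polyC coefZ coefZ coefXn.
  by rewrite -val_eqE /= eq_sym in neq; rewrite (negPf neq) !mulr0 mul0rn.
have k_lt : (k < p.-1)%N.
  by have := prime_gt1 p_pr; lia.
have sR : (size R <= k)%N.
  apply/leq_sizeP => l; rewrite leq_eqVlt => /orP[/eqP<-|kl].
    rewrite coefR // subnn; under eq_bigr do rewrite expr0 mulr1.
    by rewrite sum_expF ?mul0r.
  rewrite coef_sum big1 // => t _; apply: nth_default.
  apply: leq_trans kl; apply: (leq_trans (size_poly_exp_leq _ _)).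
  rewrite ltnS; apply: (@leq_trans (1 * k)%N); last by rewrite mul1n.
  rewrite leq_mul2r; apply/orP; right.
  rewrite -[1%N]/(2.-1) -subn1 leq_subLR.
  apply: (leq_trans (size_polyD _ _)); rewrite size_polyN geq_max.
  rewrite (leq_trans (size_polyC_leq1 _)) //=.
  by rewrite (leq_trans (size_scale_leq _ _)) // size_polyX.
have R0 : R = 0.
  apply/eqP; apply: contraTT isT => Rn0.
  suff rB : {in ~: B, forall m, root R m}.
    have := leq_trans (card_roots_lt Rn0 rB) sR.
    by have := cardsC B; rewrite card_Fp //; move: #|~: B| => c; lia.
  move=> m; rewrite inE => mB.
    have injm : injective (fun t => f t - t * m).
      move=> t t' /= E; apply/eqP/negPn/negP => neq; case/negP: mB.
      suff <- : (f t - f t') / (t - t') = m by apply: slopes.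
      apply: (mulIf (_ : t - t' != 0)); first by rewrite subr_eq0.
      by rewrite mulfVK ?subr_eq0 // mulrBr; apply/eqP; rewrite subr_eq -(subrK (t * m) (f t)) E; apply/eqP; ring.
    rewrite rootE horner_sum; under eq_bigr do rewrite !hornerE.
    by have := sum_expF k_lt; rewrite (reindex_inj injm) /= => /eqP.
have := coefR j (leq_addl _ _); rewrite R0 coef0 addnK.
move/esym/eqP; rewrite mulf_eq0 => /orP[/eqP//|].
rewrite -mulr_natr mulf_eq0 signr_eq0 /= => C0.
have : (k`!%:R : F) = 0.
  by rewrite -(bin_fact (leq_addl i j : (j <= k)%N)) natrM (eqP C0) mul0r.
by move/eqP; rewrite (negPf (natr_fact_neq0 _)) //; lia.
Qed.

(* Lovász and Schrijver: a function with at most (p + 1) / 2 slopes is affine,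
   since the moments of redei_moment see the leading coefficient of an
   interpolation polynomial of degree at least 2. *)
Lemma redei : exists c, forall t, f t = c * t + f 0.
Proof.
have [Q sQ Qf] := interpolation f.
have [sQ2|sQ2] := leqP (size Q) 2.
  exists Q`_1 => t; rewrite -!Qf !(horner_coef_wide _ sQ2) !big_ord_recl !big_ord0 /=.
  by rewrite /bump /= !expr0 !mulr1 !expr1 mulr0 !addr0 addrC.
have p1 := prime_gt1 p_pr; have p_odd : odd p.
  by have [p2|//] := even_prime p_pr; have := leq_trans sQ2 sQ; lia.
(* With this division ['X^b * Q ^+ a] has degree exactly [p.-1], the one degree at which summing
   over the field returns the leading coefficient, up to sign. *)
pose d := (size Q).-1; pose a := (p.-1 %/ d)%N; pose b := (p.-1 %% d)%N.
have d2 : (1 < d)%N by rewrite /d; lia.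
have dp : (d <= p.-1)%N by rewrite /d; lia.
have Ep : p.-1 = (a * d + b)%N by apply: divn_eq.
have ltb : (b < d)%N by rewrite ltn_mod; lia.
have a0 : (0 < a)%N by rewrite divn_gt0 //; lia.
have ab : ((a + b).*2 < p)%N.
  exact: (quotient_remainder_lt p_odd d2 Ep ltb a0).
have Q0 : Q != 0 by rewrite -size_poly_gt0; lia.
have sQa : size (Q ^+ a) = (a * d).+1.
  have sQa0 : (0 < size (Q ^+ a)%R)%N by rewrite size_poly_gt0 expf_neq0.
  by rewrite -(prednK sQa0) size_exp -/d mulnC.
have sQ' : size ('X^b * Q ^+ a) = p.
  rewrite size_mul ?expf_neq0 ?polyX_eq0 // size_polyXn sQa addnS /= addSn /=.
  by rewrite addnC -Ep prednK; lia.
have := sum_horner (eq_leq sQ').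
have -> : ('X^b * Q ^+ a)`_p.-1 = lead_coef ('X^b * Q ^+ a) by rewrite lead_coefE sQ'.
have -> : \sum_x ('X^b * Q ^+ a).[x] = \sum_t t ^+ b * f t ^+ a.
  by apply: eq_bigr => t _; rewrite hornerM hornerXn horner_exp Qf.
rewrite redei_moment //; last by lia.
move/esym/eqP; rewrite oppr_eq0 lead_coef_eq0 mulf_eq0 !expf_eq0 polyX_eq0 (negPf Q0).
by rewrite !andbF.
Qed.

End Redei.
End PrimeField.

(** * Maps of the affine plane over F_p *)

Section FieldIdentities.

Local Open Scope ring_scope.

Variable K : fieldType.
Implicit Types a b c d i j m s u v w x y z : K.

Lemma mean_quotient m s x c : x != 0 -> c != 0 ->
  (m + s * x) / (c * x) = (m / x + s) / c.
Proof. by move=> x0 c0; field; rewrite x0 c0. Qed.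

Lemma scale_slope x d z u v : x != 0 -> d != 0 ->
  x / d * (z * d / x + u - v) = z + (u - v) / d * x.
Proof. by move=> x0 d0; field; rewrite x0 d0. Qed.

Lemma scale_back x d z : x != 0 -> d != 0 -> x / d * (z * d / x) = z.
Proof. by move=> x0 d0; field; rewrite x0 d0. Qed.

Lemma scale_slope_sub x d z u v : x != 0 -> d != 0 ->
  x / d * (u - (v - z * d / x)) = z + (u - v) / d * x.
Proof. by move=> x0 d0; field; rewrite x0 d0. Qed.

Lemma line_direction a i j d : i - j != 0 ->
  (i - j)^-1 * (a + i * d - (a + j * d)) = d.
Proof. by move=> ij0; field. Qed.

Lemma line_crossing u v y z : y - z != 0 ->
  u + (v - u) / (y - z) * y = v + (v - u) / (y - z) * z.
Proof. by move=> yz0; field. Qed.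

Lemma affine_coordinates a b c d y z u v : d != 0 -> y - z != 0 ->
  u + (b - a / d * z) / (y - z) * (v - c) + a / d * c
  = (v - c) / (y - z) * b + (c - (v - c) / (y - z) * z) / d * a + u.
Proof. by move=> d0 yz0; field; rewrite yz0 d0. Qed.

End FieldIdentities.

Section Plane.

Local Open Scope ring_scope.

Variable p : nat.
Hypothesis p_pr : prime p.
Local Notation F := 'F_p.

Lemma natr_card_neq0 (A : {set F}) : A != set0 -> A != setT -> (#|A|%:R : F) != 0.
Proof.
move=> A0 AT; apply: natr_Fp_neq0 => //; rewrite card_gt0 A0 /=.
have : A \proper setT by rewrite properEneq AT subsetT.
by move/proper_card; rewrite cardsT card_Fp.
Qed.

(* S z x says that z lies in the fibre over x.  The hypothesis makes the mean
   of the fibre over c x that of the fibre over x shifted by s x; averaging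
   these means divided by x over the proper nonempty fibres determines s. *)
Lemma mean_shift (S : F -> F -> bool) :
  (exists x z z', [/\ x != 0, S z x & ~~ S z' x]) ->
  exists z0, forall c s, c != 0 ->
    (forall x z, x != 0 -> S (z + s * x) (c * x) = S z x) -> s = (c - 1) * z0.
Proof.
case=> x1 [z1 [z2 [x10 Sz1 Sz2]]].
pose D x := [set z | S z x].
pose X0 := [set x : F | [&& x != 0, D x != set0 & D x != setT]].
have X0n : (#|X0|%:R : F) != 0.
  apply: natr_card_neq0; last first.
    by apply/eqP => /setP/(_ 0); rewrite !inE eqxx.
  apply/set0Pn; exists x1; rewrite !inE x10 /=; apply/andP; split.
    by apply/set0Pn; exists z1; rewrite inE.
  by apply/eqP => /setP/(_ z2); rewrite !inE (negPf Sz2).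
pose mu x := (\sum_(z in D x) z) / #|D x|%:R.
exists ((\sum_(x in X0) mu x / x) / #|X0|%:R) => c s c0 H.
have DE x : x != 0 -> D (c * x) = [set z + s * x | z in D x].
  move=> x0; apply/setP => z; rewrite inE; apply/idP/imsetP => [Sz|[w + ->]].
    by exists (z - s * x); rewrite ?subrK // inE -(H _ _ x0) subrK.
  by rewrite inE H.
have cardD x : x != 0 -> #|D (c * x)| = #|D x|.
  by move=> x0; rewrite DE // card_imset //; apply: addIr.
have X0c x : (c * x \in X0) = (x \in X0).
  rewrite !inE mulf_eq0 (negPf c0) /=; have [//|x0] := eqVneq x 0.
  have cT (A : {set F}) : (A == setT) = (#|A| == #|F|).
    by rewrite eqEcard subsetT cardsT eqn_leq max_card.
  by rewrite -!cards_eq0 !cT cardD.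
have mu_c x : x \in X0 -> mu (c * x) = mu x + s * x.
  rewrite !inE => /and3P[x0 D0 DT].
  have Dn := natr_card_neq0 D0 DT.
  rewrite /mu cardD // DE // big_imset /=; last by move=> ? ? _ _; apply: addIr.
  rewrite big_split sumr_const /= mulrDl; congr (_ + _).
  by rewrite -(mulr_natr (s * x)) mulfK.
have E : \sum_(x in X0) mu x / x = (\sum_(x in X0) mu x / x + s * #|X0|%:R) / c.
  rewrite {1}(reindex_inj (mulfI c0)) /= mulr_natr -sumr_const -big_split mulr_suml /=.
  rewrite (eq_bigl _ _ X0c); apply: eq_bigr => x X0x; rewrite mu_c //.
  have x0 : x != 0 by move: X0x; rewrite inE => /andP[].
  exact: mean_quotient.
set Y := \sum_(x in X0) _ in E *.
have : c * Y = Y + s * #|X0|%:R by rewrite {1}E mulrCA divff // mulr1.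
move=> E'; apply: (mulIf X0n); rewrite -mulrA mulfVK // mulrBl E' mul1r.
by rewrite addrC addKr.
Qed.

(** Pass to the complement of [T] if [T] is too large. For [s] nonzero in [T], the hypothesis with
    [m] the inverse of [i - j] shows that all slopes of the function [f (s * t)] lie in [T]. *)
Lemma small_set_affine (T : F -> bool) (f : F -> F) :
  injective f ->
  (forall m i j, m != 0 -> T (m * (f i - f j)) = T (m * (i - j))) ->
  (exists y y', [/\ y != 0, y' != 0, T y & ~~ T y']) ->
  exists c, forall t, f t = c * t + f 0.
Proof.
move=> fI.
wlog small : T / (#|[set y : F | (y != 0%R) && T y]|.*2 <= p.+1)%N.
  move=> wlogT H [y [y' [y0 y'0 Ty Ty']]].
  have [small|big] := leqP (#|[set y : F | (y != 0%R) && T y]|.*2) p.+1.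
    by apply: (wlogT T) => //; exists y, y'.
  apply: (wlogT (predC T)).
  - have := cardsC [set y : F | (y != 0%R) && T y]; rewrite card_Fp // => E.
    apply: (@leq_trans #|~: [set y : F | (y != 0%R) && T y]|.*2); last by lia.
    rewrite leq_double; apply: subset_leq_card; apply/subsetP => z.
    by rewrite !inE /= negb_and => /andP[_ ->]; rewrite orbT.
  - by move=> m i j m0 /=; rewrite H.
  by exists y', y; rewrite /= Ty Ty'.
move=> H [s [_ [s0 _ Ts _]]].
have slopes i j : i != j ->
    (f (s * i) - f (s * j)) / (i - j) \in [set y : F | (y != 0) && T y].
  move=> ij; have ij0 : i - j != 0 by rewrite subr_eq0.
  rewrite inE mulf_neq0 ?invr_eq0 // ?subr_eq0 ?(inj_eq fI) ?(inj_eq (mulfI s0)) //=.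
  by rewrite mulrC H ?invr_eq0 // -mulrBr mulrCA mulVf // mulr1.
have [c Hc] := redei p_pr slopes small.
exists (c / s) => t; have := Hc (t / s); rewrite mulr0 mulrCA divff // mulr1 => ->.
by congr (_ + _); rewrite mulrCA mulrC.
Qed.

(** No chord is vertical, so the curve can be reparametrized by its first coordinate; its chord
    slopes are then few and it is a line. *)
Lemma collinear_of_directions (L : F -> F -> bool) (c1 c2 : F -> F) :
  (forall m a b, m != 0 -> L (m * a) (m * b) = L a b) ->
  (forall y, ~~ L 0 y) -> (#|[set m | L 1%R m]|.*2 <= p.+1)%N ->
  (forall i j, i != j -> L (c1 i - c1 j) (c2 i - c2 j)) ->
  exists al be, L 1 al /\ forall i, c2 i = al * c1 i + be.
Proof.
move=> Lh L0 small Lc.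
have c1I : injective c1.
  move=> i j E; apply/eqP/negPn/negP => /Lc; rewrite E subrr.
  by rewrite (negPf (L0 _)).
pose h := invF c1I.
have Ls i j : i != j -> L 1 ((c2 (h i) - c2 (h j)) / (i - j)).
  move=> ij; have ij0 : (i - j) != 0 by rewrite subr_eq0.
  rewrite -(Lh _ _ _ ij0) mulr1 mulrCA divff // mulr1.
  have := Lc (h i) (h j); rewrite !f_invF; apply.
  by rewrite (inj_eq (can_inj (f_invF c1I))).
have slopes i j : i != j -> (c2 (h i) - c2 (h j)) / (i - j) \in [set m | L 1 m].
  by move=> /Ls Lij; rewrite inE.
have [c Hc] := redei p_pr slopes small.
exists c, (c2 (h 0)); split; last first.
  by move=> i; rewrite -Hc /h invF_f.
have := Ls 1 0 (oner_neq0 _); rewrite Hc subr0 mulr1 divr1.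
by rewrite addrK.
Qed.

(** In coordinates, an automorphism commuting with the first translations is
    [(a, b) -> (a + ga b, be b)]. By [mean_shift] the slopes of [ga] are determined by those of
    [be], so few slopes of [be] make both linear. Otherwise the slopes belong to the multiplicative
    stabilizer [La] of [S] sheared by [z0], and [La] is everything. *)
Lemma shear_dichotomy (S : F -> F -> bool) (ga be : F -> F) :
  injective be -> be 0 = 0 -> ga 0 = 0 ->
  (exists x z z', [/\ x != 0, S z x & ~~ S z' x]) ->
  (forall m a b b', m != 0 -> b != b' ->
     S (m * (a + ga b - ga b')) (m * (be b - be b')) = S (m * a) (m * (b - b'))) ->
  (exists c d, forall b, be b = c * b /\ ga b = d * b) \/
  (5 <= p)%N /\ exists z0, forall z x x', x != 0 -> x' != 0 ->
     S (z + z0 * x) x = S (z + z0 * x') x'.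
Proof.
move=> beI be0 ga0 nt H; have [z0 Hz0] := mean_shift nt.
pose slope b b' := (be b - be b') / (b - b').
have slope_neq0 b b' : b != b' -> slope b b' != 0.
  by move=> bb'; rewrite mulf_neq0 ?invr_eq0 ?subr_eq0 ?(inj_eq beI).
have Hs b b' : b != b' -> forall x z, x != 0 ->
    S (z + (ga b - ga b') / (b - b') * x) (slope b b' * x) = S z x.
  move=> bb' x z x0; have bb0 : b - b' != 0 by rewrite subr_eq0.
  have m0 : x / (b - b') != 0 by rewrite mulf_neq0 ?invr_eq0.
  have := H (x / (b - b')) (z * (b - b') / x) b b' m0 bb'.
  rewrite scale_slope // scale_back // mulfVK // => <-; congr (S _ _).
  by rewrite /slope [LHS]mulrAC [RHS]mulrAC (mulrC x).
have Es b b' : b != b' -> (ga b - ga b') / (b - b') = (slope b b' - 1) * z0.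
  by move=> bb'; apply: Hz0 => [|x z x0]; [apply: slope_neq0 | apply: Hs].
have [small|big] := leqP (#|[set slope bb.1 bb.2 | bb : F * F & bb.1 != bb.2]|.*2) p.+1.
  left; have [|c Hc] := @redei _ p_pr be _ _ small.
    by move=> i j ij; apply/imsetP; exists (i, j); rewrite ?inE.
  exists c, ((c - 1) * z0) => b; rewrite Hc be0 addr0; split=> //.
  have [->|b0] := eqVneq b 0; first by rewrite ga0 mulr0.
  have := Es b 0 b0; rewrite ga0 !subr0 /slope be0 !subr0 Hc be0 addr0 mulfK //.
  by move=> <-; rewrite mulfVK.
right; set B := [set _ | _ in _] in big.
pose La := [set c : F | (c != 0) && [forall x, (x != 0) ==> [forall z,
  S (z + z0 * (c * x)) (c * x) == S (z + z0 * x) x]]].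
have LaP c : reflect (c != 0 /\ forall x z, x != 0 ->
    S (z + z0 * (c * x)) (c * x) = S (z + z0 * x) x) (c \in La).
  rewrite inE; apply: (iffP andP) => -[c0 Hc]; split=> //.
    by move=> x z x0; have /forallP/(_ x)/implyP/(_ x0)/forallP/(_ z)/eqP := Hc.
  by apply/forallP => x; apply/implyP => x0; apply/forallP => z; rewrite Hc.
have BLa : B \subset La.
  apply/subsetP => s /imsetP[[b b']]; rewrite inE /= => bb' ->.
  apply/LaP; split=> [|x z x0]; first exact: slope_neq0.
  by rewrite -(Hs b b' bb' x _ x0) Es //; congr (S _ _);
     rewrite -addrA; congr (_ + _); rewrite mulrBl mul1r mulrBl addrCA subrr addr0 mulrA [slope _ _ * _]mulrC.
have big' : (p.+1 < #|La|.*2)%N.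
  by apply: leq_trans big _; rewrite leq_double subset_leq_card.
have La0 : La \subset [set~ 0] by apply/subsetP => c /LaP[c0 _]; rewrite !inE.
have leLa : (#|La| <= p.-1)%N.
  by have := subset_leq_card La0; rewrite cardsC1 card_Fp.
split.
  (* [p + 1 < 2 #|La|] and [#|La| <= p - 1] leave only [p > 3]. *)
  have p_neq4 : p <> 4 by move=> p4; move: p_pr; rewrite p4.
  by have := prime_gt1 p_pr; lia.
exists z0.
(* Both [La] and the set of quotients [c / d] with [d] in [La] exceed half of the nonzero residues,
   so they meet, and [c] is a product of two elements of [La]. *)
have LaT c : c != 0 -> c \in La.
  move=> c0; pose cV := [set c / d | d in La].
  have cardV : #|cV| = #|La|.
    apply: card_in_imset => d d' /LaP[d0 _] /LaP[d'0 _] /(mulfI c0)/invr_inj; exact.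
  have cV0 : cV \subset [set~ 0].
    apply/subsetP => _ /imsetP[d /LaP[d0 _] ->].
    by rewrite !inE mulf_neq0 ?invr_eq0.
  have : La :&: cV != set0.
    apply: contraL big' => /eqP I0; rewrite -leqNgt.
    have : (#|La :|: cV| <= p.-1)%N.
      have : La :|: cV \subset [set~ 0] by rewrite subUset La0.
      by move/subset_leq_card; rewrite cardsC1 card_Fp.
    by rewrite cardsU I0 cards0 cardV; lia.
  case/set0Pn=> d /setIP[/LaP[d0 Hd] /imsetP[e /LaP[e0 He] E]].
  have Ec : c = d * e by rewrite E mulfVK.
  apply/LaP; split=> // x z x0; rewrite Ec -mulrA Hd ?mulf_neq0 //.
  exact: He.
move=> z x x' x0 x'0; have /LaP[_ H1] := LaT x x0; have /LaP[_ H2] := LaT x' x'0.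
by rewrite -(mulr1 x) -(mulr1 x') H1 ?oner_neq0 // H2 ?oner_neq0.
Qed.

(** With [T] the smaller of the fibre of [S] over [al] and its complement, lines of direction
    [(al, y)] with [y] in [T] go to lines whose slope is again in [T]. Two such [y] give two
    parallel classes mapped to parallel classes, hence an affine [K]. If [T] has a single element,
    its slope is preserved, which is commutation with a translation. *)
Lemma fibrewise_affine (S : F -> F -> bool) (K : F -> F -> F) :
  (forall m a a' b b', m != 0 -> a != a' ->
     S (m * (a - a')) (m * (K a b - K a' b')) = S (m * (a - a')) (m * (b - b'))) ->
  (exists al y y', [/\ al != 0, S al y & ~~ S al y']) ->
  (forall a, injective (K a)) ->
  (exists la mu nu, forall a b, K a b = la * b + mu * a + nu) \/
  exists al y, al != 0 /\ forall a b, K (a + al) (b + y) = K a b + y.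
Proof.
move=> H [al [y1 [y2 [al0 Sy1 Sy2]]]] KI.
have {S H y2 Sy1 Sy2}[T [H small [y Ty]]] : exists T : F -> bool,
  [/\ forall i j a b b', i != j ->
        T ((K (a + i * al) b - K (a + j * al) b') / (i - j)) = T ((b - b') / (i - j)),
      (#|[set y | T y]|.*2 <= p.+1)%N & exists y, T y].
  have HS i j a b b' : i != j ->
     S al ((K (a + i * al) b - K (a + j * al) b') / (i - j)) = S al ((b - b') / (i - j)).
    move=> ij; have ij0 : i - j != 0 by rewrite subr_eq0.
    have := H (i - j)^-1 (a + i * al) (a + j * al) b b'.
    rewrite invr_eq0 ij0 (inj_eq (addrI _)) (inj_eq (mulIf al0)) ij => /(_ isT isT).
    rewrite line_direction //.
    by rewrite ![(i - j)^-1 * _]mulrC.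
  have [small|big] := leqP (#|[set y | S al y]|.*2) p.+1.
    by exists (S al); split=> //; exists y1.
  exists (predC (S al)); split; last by exists y2.
    by move=> i j a b b' ij /=; rewrite HS.
  have := cardsC [set y | S al y]; rewrite card_Fp //.
  have -> : ~: [set y | S al y] = [set y | predC (S al) y].
    by apply/setP => z; rewrite !inE.
  lia.
have line a b y' : T y' -> exists2 y'', T y'' &
    forall i, K (a + i * al) (b + i * y') = K a b + i * y''.
  move=> Ty'; have sl i j : i != j ->
      T ((K (a + i * al) (b + i * y') - K (a + j * al) (b + j * y')) / (i - j)).
    move=> ij; rewrite H //; have ij0 : i - j != 0 by rewrite subr_eq0.
    by rewrite mulrC line_direction.
  have [|c Hc] := @redei _ p_pr (fun i => K (a + i * al) (b + i * y')) _ _ small.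
    by move=> i j ij; rewrite inE sl.
  exists c; last by move=> i; rewrite Hc !mul0r !addr0 addrC mulrC.
  have := sl 1 0 (oner_neq0 _); rewrite Hc !subr0 divr1 mulr1 !mul0r !addr0.
  by rewrite addrK.
have [[y' [Ty' yy']]|single] : (exists y', T y' /\ y' != y) \/ forall y', T y' -> y' = y.
- case: (boolP [exists y', T y' && (y' != y)]) => [/existsP[y' /andP[]]|].
    by left; exists y'.
  rewrite negb_exists => /forallP single; right=> y' Ty'.
  by have := single y'; rewrite Ty' negbK => /eqP.
- have parallel z : T z -> exists z', forall i b,
      K (i * al) (b + i * z) = K 0 b + i * z'.
    move=> Tz; have [z' _ Hz'] := line 0 0 z Tz; exists z' => i b.
    have [z'' _ Hz''] := line 0 b z Tz.
    have E j : K (j * al) (b + j * z) = K 0 b + j * z'' by rewrite -Hz'' add0r.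
    have E0 j : K (j * al) (j * z) = K 0 0 + j * z' by rewrite -Hz' !add0r.
    rewrite E; congr (_ + _ * _); apply/eqP/negPn/negP => neq.
    have neq0 : z'' - z' != 0 by rewrite subr_eq0.
    (* Were the slopes different, the images of the lines through [b] and through 0 would meet at
       this [j]; injectivity of [K] on that fibre then identifies the two lines. *)
    pose j := (K 0 0 - K 0 b) / (z'' - z').
    have : K (j * al) (b + j * z) = K (j * al) (j * z).
      by rewrite E E0 /j line_crossing.
    move/KI; rewrite -[RHS]add0r => /addIr b0.
    have := E 1; rewrite b0 add0r E0 => /addrI; rewrite !mul1r => Ez.
    by rewrite Ez eqxx in neq.
  have [z1 Hz1] := parallel y Ty; have [z2 Hz2] := parallel y' Ty'.
  have yy0 : y' - y != 0 by rewrite subr_eq0.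
  have A i x : K 0 (x + i * (y' - y)) = K 0 x + i * (z2 - z1).
    have := Hz1 i (x + i * (y' - y)); have := Hz2 i x.
    rewrite -addrA -mulrDr subrK.
    by move=> -> E; apply: (addIr (i * z1)); rewrite -E -addrA -mulrDr subrK.
  left; exists ((z2 - z1) / (y' - y)), ((z1 - (z2 - z1) / (y' - y) * y) / al), (K 0 0).
  move=> a b; have := Hz1 (a / al) (b - a / al * y).
  rewrite subrK mulfVK // => ->.
  have := A ((b - a / al * y) / (y' - y)) 0; rewrite add0r mulfVK // => ->.
  exact: affine_coordinates.
right; exists al, y; split=> // a b.
have [y' /single -> /(_ 1)] := line a b y Ty.
by rewrite !mul1r.
Qed.

End Plane.

(** * Groups of order p^2 *)

Lemma digraph_aut_cayleyP (gT : finGroupType) (S : {set gT}) (g : {perm gT}) :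
  reflect (forall x y, ((g x)^-1 * g y \in S) = (x^-1 * y \in S))
          (g \in digraph_aut (cayley S)).
Proof.
rewrite inE; apply: (iffP forallP) => [H x y | H x].
  by have /forallP/(_ y)/eqP := H x.
by apply/forallP => y; apply/eqP; apply: H.
Qed.

Lemma left_regular_sub_aut (gT : finGroupType) (S : {set gT}) :
  left_regular gT \subset digraph_aut (cayley S).
Proof.
apply/subsetP => _ /left_regularP[a ->]; apply/digraph_aut_cayleyP => x y.
by rewrite !translationE invMg -mulgA mulKg.
Qed.

Definition coset_regular (gT : finGroupType) (S H : {set gT}) :=
  forall a h, a \notin H -> h \in H -> (a * h \in S) = (a \in S).

Lemma aut_fix1_mem (gT : finGroupType) (S : {set gT}) (g : {perm gT}) x :
  g \in digraph_aut (cayley S) -> g 1 = 1 -> (g x \in S) = (x \in S).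
Proof. by move=> /digraph_aut_cayleyP/(_ 1 x) + g1; rewrite g1 invg1 !mul1g. Qed.

Section PrimeSquared.

Variables (p : nat) (gT : finGroupType).
Hypotheses (p_pr : prime p) (cardG : #|gT| = (p ^ 2)%N).

Lemma mulgC_p2 (x y : gT) : x * y = y * x.
Proof.
have /centsP abT : abelian [set: gT].
  by apply: (card_p2group_abelian p_pr); rewrite cardsT.
by apply: abT; apply: in_setT.
Qed.

Lemma p_group_left_regular : p.-group (left_regular_group gT).
Proof. by rewrite /pgroup card_left_regular cardG pnatX pnat_id. Qed.

(** * Group automorphisms of p-power order *)

Section FixedSubgroup.

Variable g : {perm gT}.
Hypothesis gM : forall x y, g (x * y) = g x * g y.

Lemma aut_fix1 : g 1 = 1.
Proof. by apply: (mulgI (g 1)); rewrite -gM !mulg1. Qed.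

Lemma autV x : g x^-1 = (g x)^-1.
Proof. by apply: (mulgI (g x)); rewrite -gM !mulgV aut_fix1. Qed.

Lemma autX x n : g (x ^+ n) = g x ^+ n.
Proof. by elim: n => [|n IHn]; rewrite ?aut_fix1 // !expgS gM IHn. Qed.

Lemma fixed_group_set : group_set [set x | g x == x].
Proof.
apply/group_setP; split=> [|x y]; first by rewrite inE aut_fix1.
by rewrite !inE gM => /eqP-> /eqP->.
Qed.
Definition fixed_group := group fixed_group_set.

Lemma displacement_morphM :
  {in [set: gT] &, {morph (fun x => x^-1 * g x) : x y / x * y}}.
Proof.
move=> x y _ _ /=; rewrite gM invMg -mulgA (mulgA x^-1) mulgA.
by rewrite (mulgC_p2 y^-1) -mulgA.
Qed.
Canonical displacement_morphism := Morphism displacement_morphM.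

Lemma fixed_cycle_mod (A : {set gT}) : p.-elt g -> (forall x, x \in A -> g x \in A) ->
  #|A| = #|A :&: fixed_group| %[mod p].
Proof.
move=> pg gA; have actsA : [acts <[g]>, on A | 'P].
  rewrite cycle_subG; apply/astabsP => x /=; rewrite apermE.
  have sub : [set g x | x in A] = A.
    apply/eqP; rewrite eqEcard (card_imset _ perm_inj) leqnn andbT.
    by apply/subsetP => _ /imsetP[y Ay ->]; apply: gA.
  by rewrite -{1}sub (mem_imset _ _ perm_inj).
rewrite (pgroup_fix_mod pg actsA); congr (#|pred_of_set _| %% _).
apply/setP => x; rewrite afix_cycle !in_setI [x \in fixed_group]inE; congr (_ && _).
by apply/afix1P/eqP; rewrite /= apermE.
Qed.

Hypotheses (pg : p.-elt g) (g_neq1 : g != 1).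

Lemma card_fixed : #|fixed_group| = p.
Proof.
have dvH : #|fixed_group| %| p ^ 2 by rewrite -cardG -cardsT cardSg ?subsetT.
have := fixed_cycle_mod pg (fun x _ => in_setT (g x)); rewrite setTI cardsT cardG.
rewrite -mulnn modnMl => /esym/eqP; rewrite -/(dvdn _ _) => pH.
have [m le_m cH] := dvdn_pfactor _ _ p_pr dvH.
have p1 := prime_gt1 p_pr; rewrite cH in pH *.
case: m le_m cH pH => [|[|[|m]]] //= _ cH; first by rewrite dvdn1 => /eqP; lia.
case/eqP: g_neq1; apply/permP => x; rewrite perm1; apply/eqP.
suff : x \in fixed_group by rewrite inE.
have -> // : fixed_group = setT :> {set _}.
by apply/eqP; rewrite eqEcard subsetT cH cardsT cardG leqnn.
Qed.

(** The displacement is a morphism with kernel the fixed subgroup, so its image has order [p]. This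
    image is stable under [g], and its number of fixed points is positive and divisible by [p], so
    [g] fixes all of it. *)
Lemma displacement_fixed x : x^-1 * g x \in fixed_group.
Proof.
pose I := displacement_morphism @* setT.
have kerE : 'ker displacement_morphism = fixed_group.
  by apply/setP => y; rewrite !inE /= -eq_mulVg1 eq_sym.
have cI : #|I| = p.
  rewrite card_morphim kerE setIid -divgS ?subsetT // cardsT cardG card_fixed.
  by rewrite -mulnn mulnK ?prime_gt0.
have gI y : y \in I -> g y \in I.
  case/morphimP=> z _ _ -> /=; rewrite gM autV //.
  by rewrite [_ * _](_ : _ = displacement_morphism (g z)) // mem_morphim ?in_setT.
have := fixed_cycle_mod pg gI; rewrite cI modnn => /esym/eqP; rewrite -/(dvdn _ _) => dvI.
have I0 : 0 < #|I :&: fixed_group| by apply: (cardG_gt0 (I :&: fixed_group)%G).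
have sIH : I \subset fixed_group.
  apply/setIidPl/eqP; rewrite eqEcard subsetIl cI; exact: dvdn_leq.
apply: (subsetP sIH).
by rewrite [_ * _](_ : _ = displacement_morphism x) // mem_morphim ?in_setT.
Qed.

(** For [a] outside the fixed subgroup, [c = a^-1 * g a] generates that subgroup and the powers of
    [g] send [a] to every [a * c ^+ i]; [g] preserves [S]. *)
Lemma p_element_coset_regular (S : {set gT}) :
  g \in digraph_aut (cayley S) -> coset_regular S fixed_group.
Proof.
move=> Ag a h Ha Hh; set c := a^-1 * g a.
have Hc : c \in fixed_group := displacement_fixed a.
have gc : g c = c by move: Hc; rewrite inE => /eqP.
have c1 : c != 1.
  by apply: contra Ha; rewrite -eq_mulVg1 inE eq_sym.
have cycleH : <[c]> = fixed_group.
  apply/eqP; rewrite eqEcard cycle_subG Hc card_fixed /=.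
  have : #[c] %| p by rewrite -card_fixed order_dvdG.
  by case/primeP: p_pr => _ H /H; rewrite order_eq1 (negPf c1) => /eqP <-.
move: Hh; rewrite -cycleH => /cycleP[i ->].
have gi : (g ^+ i) a = a * c ^+ i.
  elim: i => [|i IHi]; first by rewrite perm1 mulg1.
  rewrite expgSr permM IHi gM autX gc expgS mulgA; congr (_ * _).
  by rewrite /c mulKVg.
rewrite -gi aut_fix1_mem ?groupX //.
by elim: i {gi} => [|i IHi]; rewrite ?perm1 // expgSr permM IHi aut_fix1.
Qed.

End FixedSubgroup.

(** * Sylow theory of the automorphism group *)

Section Automorphisms.

Variable S : {set gT}.
Local Notation A := (digraph_aut_group (cayley S)).
Local Notation P := (left_regular_group gT).

Lemma PA : P \subset A. Proof. exact: left_regular_sub_aut. Qed.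

Lemma norm_fix1_morph (g : {perm gT}) : g \in 'N(P) -> g 1 = 1 ->
  forall x y, g (x * y) = g x * g y.
Proof. by move=> /norm_left_regularP + g1 x y => ->; rewrite g1 invg1 mulg1. Qed.

(** Normalizers grow in a Sylow subgroup strictly containing [P]. An element of the normalizer
    outside [P], multiplied by a translation so as to fix 1, is a nontrivial group automorphism of
    p-power order. *)
Lemma coset_regular_of_p3 : p ^ 3 %| #|A| ->
  exists H : {group gT}, #|H| = p /\ coset_regular S H.
Proof.
move=> p3A; have [Q sylQ sPQ] := Sylow_superset PA p_group_left_regular.
have pQ := pHall_pgroup sylQ; have sQA := pHall_sub sylQ.
have ltPQ : P \proper Q.
  rewrite properEcard sPQ (card_Hall sylQ) card_left_regular cardG p_part.
  by rewrite ltn_exp2l ?prime_gt1 // -pfactor_dvdn ?cardG_gt0.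
have := nilpotent.nilpotent_proper_norm (pgroup_nil pQ) ltPQ.
case/properP=> sPN [g0 Ng0 nPg0].
have [Qg0 Nb] := setIP Ng0.
pose g := g0 * translation (g0 1)^-1.
have Pt : translation (g0 1)^-1 \in P by apply: mem_translation.
have g1 : g 1 = 1 by rewrite permM translationE mulVg.
have Qg : g \in Q by rewrite groupM // (subsetP sPQ).
have Ng : g \in 'N(P) by rewrite groupM // (subsetP (normG P)).
have gneq1 : g != 1.
  apply: contra nPg0 => /eqP g_1.
  by rewrite -(mulgK (translation (g0 1)^-1) g0) -/g g_1 mul1g groupV.
have gM := norm_fix1_morph Ng g1.
have pg := mem_p_elt pQ Qg.
exists (fixed_group gM); split; first exact: card_fixed.
by apply: p_element_coset_regular => //; apply: (subsetP sQA).
Qed.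

Hypothesis irregular : forall H : {group gT}, #|H| = p -> ~ coset_regular S H.

Lemma sylow_left_regular : p.-Sylow(A) P.
Proof.
rewrite pHallE PA card_left_regular cardG p_part /=; apply/eqP; congr (_ ^ _)%N.
apply/eqP; rewrite eqn_leq -pfactor_dvdn ?cardG_gt0 // -{1}cardG.
rewrite -(card_left_regular gT) cardSg ?PA //= leqNgt -pfactor_dvdn ?cardG_gt0 //.
by apply/negP => /coset_regular_of_p3[H [cH /irregular]]; apply.
Qed.

Lemma p_elt_norm (x y : {perm gT}) : x \in A -> y \in A -> p.-elt y ->
  y \in 'N(P :^ x) -> y \in P :^ x.
Proof.
move=> Ax Ay py Ny; have sylPx : p.-Sylow(A) (P :^ x)%G by rewrite pHallJ ?sylow_left_regular.
have := norm_sub_max_pgroup (Hall_max sylPx) (_ : p.-group <[y]>).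
by rewrite !cycle_subG; apply.
Qed.

Lemma p_elt_norm1 (y : {perm gT}) : y \in A -> p.-elt y -> y \in 'N(P) -> y \in P.
Proof. by move=> Ay py Ny; have := p_elt_norm (group1 A) Ay py; rewrite conjsg1; apply. Qed.

(** In the group generated by [P] and [g], both [<[g]>] and the stabilizer of 1 are complements of
    [P]; Schur-Zassenhaus makes them conjugate. *)
Lemma p'_norm_fixed_point (g : {perm gT}) : g \in A -> g \in 'N(P) -> p^'.-elt g ->
  exists x, g x = x.
Proof.
move=> Ag Ng p'g; pose B := (P <*> <[g]>)%G.
have nPg : <[g]> \subset 'N(P) by rewrite cycle_subG.
have EB : B = P * <[g]> :> {set _} by rewrite /= norm_joinEr.
have coPg : coprime #|P| #|<[g]>| by apply: pnat_coprime p_group_left_regular p'g.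
have sPB : P \subset B by rewrite joing_subl.
have cB : (#|P| * #|<[g]>|)%N = #|B| by rewrite EB coprime_cardMg.
have cg : #|<[g]>| = #|stab1_group B|.
  have := card_stab1 sPB; rewrite -cB card_left_regular => /eqP.
  by rewrite eqn_pmul2l; [move/eqP | rewrite cardG expn_gt0 prime_gt0].
have sB1 : stab1_group B \subset B by apply/subsetP => h /stab1P[].
have sBN : B \subset 'N(P) by rewrite join_subG normG.
have abP : abelian P.
  by apply: (card_p2group_abelian p_pr); rewrite card_left_regular.
have sgPB1 : <[g]> \subset P * stab1_group B.
  apply: subset_trans (_ : B \subset _); first exact: joing_subr.
  apply/subsetP => b Bb; pose y := translation (b^-1 1).
  have Py : y \in P by apply: mem_translation.
  apply/imset2P; exists y^-1 (y * b); rewrite ?groupV ?mulKg //.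
  apply/stab1P; split; first by rewrite groupM // (subsetP sPB).
  by rewrite permM translationE mulg1 permKV.
have coPB1 : coprime #|P| #|stab1_group B| by rewrite -cg.
have [x Px Eg] := SchurZassenhaus_trans_sol (nilpotent.abelian_sol abP)
  (subset_trans sB1 sBN) sgPB1 coPB1 cg.
exists (x 1); have : g \in stab1_group B :^ x by rewrite -Eg cycle_id.
case/imsetP=> h /stab1P[_ h1] ->.
by rewrite conjgE !permM permK h1.
Qed.

Lemma connection_set_proper : S != set0 /\ S != [set~ 1].
Proof.
have [|u _ u_ord] := @Cauchy _ p [set: gT] p_pr; first by rewrite cardsT cardG dvdn_exp.
split; apply/eqP => ES; apply: (irregular u_ord) => a h Ha Hh; rewrite ES.
  by rewrite !inE.
rewrite !inE; have -> : a != 1 by apply: contra Ha => /eqP->.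
by apply: contra Ha => /eqP/(canRL (mulgK h)); rewrite mul1g => ->; rewrite groupV.
Qed.

Lemma cent_translationP (g : {perm gT}) u :
  reflect (forall x, g (u * x) = u * g x) (g \in 'C[translation u]).
Proof.
apply: (iffP cent1P) => [cgu x | cgu].
  by have /permP/(_ x) := cgu; rewrite /commute !permM !translationE => <-.
by apply/permP => x; rewrite !permM !translationE cgu.
Qed.

Lemma fix_cent_translation (g : {perm gT}) u :
  g \in 'N(P) -> g 1 = 1 -> g u = u -> g \in 'C[translation u].
Proof.
move=> Ng g1 gu; apply/cent_translationP => x.
by rewrite (norm_fix1_morph Ng g1) gu.
Qed.

Hypothesis S1 : 1 \notin S.
Hypothesis TI : forall u, u != 1 -> 'C_A[translation u] \subset 'N(P).

(** The conjugate is abelian, so it centralizes [translation u] and normalizes [P] by [TI]; being a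
    p-group, it lies in the normal Sylow subgroup [P] of that normalizer. *)
Lemma TI_conj (x : {perm gT}) u : x \in A -> u != 1 ->
  translation u \in P :^ x -> P :^ x = P.
Proof.
move=> Ax u1 Pxu; apply/eqP; rewrite eqEcard cardJg leqnn andbT.
have abPx : abelian (P :^ x).
  by rewrite abelianJ; apply: (card_p2group_abelian p_pr); rewrite card_left_regular.
have sPxA : P :^ x \subset A by rewrite -(conjGid Ax) conjSg PA.
have pPx : p.-group (P :^ x)%G by rewrite pgroupJ p_group_left_regular.
apply/subsetP => y Pxy; have Ay := subsetP sPxA _ Pxy.
apply: p_elt_norm1 => //; first exact: (mem_p_elt pPx).
apply: (subsetP (TI u1)); rewrite inE Ay; apply/cent1P.
exact: (centsP abPx).
Qed.

(** If [p] divided the order of [g], a power of order [p] would lie in both [P] and its conjugate,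
    against [TI_conj]. So [g] has order prime to [p]. *)
Lemma norm2_fixed_point (g x : {perm gT}) : g \in A -> x \in A -> g \in 'N(P) ->
  g \in 'N(P :^ x) -> P :^ x != P -> exists x0, g x0 = x0.
Proof.
move=> Ag Ax Ng Ngx neq; have [p'g|] := boolP (p^'.-elt g).
  exact: p'_norm_fixed_point.
rewrite /p_elt p'natE // negbK => pg; case/eqP: neq.
pose y := g ^+ (#[g] %/ p).
have oy : #[y] = p.
  by rewrite orderXdiv ?dvdn_divl_rev // ?divnA ?mulKn // ?order_gt0 // dvdn_div.
have py : p.-elt y by rewrite /p_elt oy pnat_id.
have Ay : y \in A by rewrite groupX.
have Py : y \in P by apply: p_elt_norm1; rewrite ?groupX.
have [u Eu] := left_regularP _ Py.
have Pxy : y \in P :^ x by apply: p_elt_norm; rewrite ?groupX.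
apply: (@TI_conj x u) => //; last by rewrite -Eu.
apply/eqP => u1; have := order1 {perm gT}; rewrite -translation1 -u1 -Eu oy.
by have := prime_gt1 p_pr; lia.
Qed.

(** Conjugation by a translation moves the fixed point supplied by [norm2_fixed_point] to 1, so
    uniqueness needs checking only for elements fixing 1. *)
Lemma normal_of_fixed_points :
  (forall g x : {perm gT}, g \in A -> x \in A -> g 1 = 1 -> g \in 'N(P) ->
     g \in 'N(P :^ x) -> P :^ x != P -> g != 1 -> forall u, g u = u -> u = 1) ->
  P <| A.
Proof.
move=> fix1; have [S0 ST] := connection_set_proper.
apply: (@normal_of_unique_fixed_point gT A S) => //.
- exact: mulgC_p2.
- exact: PA.
- by move=> g /digraph_aut_cayleyP.
- rewrite -(cardsC1 (1 : gT)); apply: proper_card; rewrite properEneq ST.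
  by apply/subsetP => s Ss; rewrite !inE; apply: contraNneq S1 => <-.
move=> g x Ag Ax Ng Ngx neq g1; have [x0 gx0] := norm2_fixed_point Ag Ax Ng Ngx neq.
pose t := translation x0^-1; have Pt : t \in P by apply: mem_translation.
have At : t \in A := subsetP PA _ Pt.
have Nt : t \in 'N(P) := subsetP (normG P) _ Pt.
have gt1 : (g ^ t) 1 = 1.
  by rewrite conjgE !permM translationV !translationE invgK mulg1 gx0 mulVg.
have Ngt : g ^ t \in 'N(P) by rewrite groupJ.
have Ngxt : g ^ t \in 'N(P :^ (x * t)) by rewrite conjsgM [in 'N(_)]normJ memJ_conjg.
have neqt : P :^ (x * t) != P.
  apply: contra neq => /eqP E.
  by rewrite -(inj_eq (@conjsg_inj _ t)) -conjsgM E (normP Nt).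
have H : forall u, (g ^ t) u = u -> u = 1.
  apply: (fix1 _ (x * t)) => //; first by rewrite groupJ.
    by rewrite groupM.
  by rewrite conjg_eq1.
rewrite -(nb_fixJ g t) /nb_fix; apply/eqP/cards1P; exists 1.
by apply/setP => u; rewrite !inE; apply/eqP/eqP => [/H|->].
Qed.

End Automorphisms.
End PrimeSquared.

(** * Cyclic groups *)

Section CyclicPrimeSquared.

Variables (p : nat) (gT : finGroupType) (S : {set gT}).
Hypotheses (p_pr : prime p) (cardG : #|gT| = (p ^ 2)%N).
Hypothesis cycG : cyclic [set: gT].
Hypothesis irregular : forall H : {group gT}, #|H| = p -> ~ coset_regular S H.
Local Notation A := (digraph_aut_group (cayley S)).
Local Notation P := (left_regular_group gT).

Variable a : gT.
Hypothesis oa : #[a] = p.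
Local Notation U := <[a]>.

Let mulC := mulgC_p2 p_pr cardG.

Lemma order_notin_cycle x : x \notin U -> #[x] = (p ^ 2)%N.
Proof.
move=> Ux; have : #[x] %| p ^ 2 by rewrite -cardG -cardsT order_dvdG ?in_setT.
case/(dvdn_pfactor _ _ p_pr) => -[|[|[|m]]] // _ ox.
  by case/negP: Ux; move/eqP: ox; rewrite order_eq1 => /eqP->; apply: group1.
case/negP: Ux; rewrite -cycle_subG.
have /eqP-> // : <[x]> :==: U.
by rewrite (eq_subG_cyclic cycG) ?subsetT // -!orderE oa ox expn1.
Qed.

Lemma cycle_notin_cycle x y : x \notin U -> exists n, y = x ^+ n.
Proof.
move=> Ux; apply/cycleP; suff -> : <[x]> = setT by apply: in_setT.
apply/eqP; rewrite eqEcard subsetT cardsT cardG -orderE.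
by rewrite (order_notin_cycle Ux) leqnn.
Qed.

Lemma expgp_mem x : x ^+ p \in U.
Proof.
have [Ux|Ux] := boolP (x \in U); first exact: groupX.
rewrite -cycle_subG; have /eqP-> // : <[x ^+ p]> :==: U.
rewrite (eq_subG_cyclic cycG) ?subsetT // -!orderE oa orderXdiv (order_notin_cycle Ux).
  by rewrite -mulnn mulnK ?prime_gt0.
by rewrite -mulnn dvdn_mulr.
Qed.

Lemma expg_notin_cycle x n : x \notin U -> (x ^+ n \notin U) = ~~ (p %| n).
Proof.
move=> Ux; congr (~~ _); apply/idP/idP => [|/dvdnP[k ->]]; last first.
  by rewrite mulnC expgM groupX ?expgp_mem.
case/cycleP=> i E; have : (x ^+ (n * p) == 1).
  by rewrite expgM E -expgM mulnC expgM -oa expg_order expg1n.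
by rewrite -order_dvdn (order_notin_cycle Ux) -mulnn dvdn_pmul2r ?prime_gt0.
Qed.

Lemma cycle_eq_cycle b : b \in U -> b != 1 -> <[b]> = U.
Proof.
move=> Ub b1; apply/eqP; rewrite eqEcard cycle_subG Ub -!orderE oa /=.
have : #[b] %| p by rewrite -oa order_dvdG.
by case/primeP: p_pr => _ H /H; rewrite order_eq1 (negPf b1) => /eqP <-.
Qed.

Definition power_invariant c :=
  ~~ (p %| c) /\ forall y i, y \notin U -> (y ^+ c * a ^+ i \in S) = (y * a ^+ i \in S).

Lemma power_invariantX c n : power_invariant c -> power_invariant (c ^ n).
Proof.
move=> [pc H]; elim: n => [|n [pn IHn]].
  split=> [|y i _]; last by rewrite expn0 expg1.
  by rewrite expn0 dvdn1; have := prime_gt1 p_pr; lia.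
split=> [|y i Uy]; first by rewrite expnS Euclid_dvdM // negb_or pc.
by rewrite expnS expgM IHn ?H // expg_notin_cycle.
Qed.

Lemma power_invariantM c d :
  power_invariant c -> power_invariant d -> power_invariant (c * d).
Proof.
move=> [pc Hc] [pd Hd]; split=> [|y i Uy]; first by rewrite Euclid_dvdM // negb_or pc.
by rewrite expgM Hd ?Hc // expg_notin_cycle.
Qed.

(** If [c] is 1 modulo [p] but not modulo [p ^ 2], then [y ^+ c] is [y] times a generator of [U],
    and invariance makes [S] a union of cosets off [U], against [irregular]. *)
Lemma power_invariant_mod c :
  power_invariant c -> c = 1 %[mod p] -> c = 1 %[mod p ^ 2].
Proof.
move=> [pc H] c1; have p1 := prime_gt1 p_pr.
have [k Ec] : exists k, c = (k * p).+1.
  by exists (c %/ p); rewrite {1}(divn_eq c p) c1 modn_small // addn1.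
have [/dvdnP[l El]|pk] := boolP (p %| k).
  by rewrite Ec El -mulnA mulnn -addn1 modnMDl.
case: (@irregular <[a]>%G); first by rewrite -orderE.
move=> y h Uy Uh; pose b := y ^+ (k * p).
have Ub : b \in U by rewrite /b mulnC expgM groupX ?expgp_mem.
have b1 : b != 1.
  rewrite -order_dvdn (order_notin_cycle Uy) -mulnn dvdn_pmul2r ?prime_gt0 //.
have inv i : (y * b * a ^+ i \in S) = (y * a ^+ i \in S).
  by rewrite -(H y i Uy) Ec expgS.
have invh j : (y * b ^+ j \in S) = (y \in S).
  elim: j => [|j IHj]; first by rewrite mulg1.
  rewrite expgS mulgA -IHj; have /cycleP[i ->] : b ^+ j \in U by rewrite groupX.
  exact: inv.
have : h \in <[b]> by rewrite (cycle_eq_cycle Ub b1).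
by case/cycleP=> j ->.
Qed.

(** Invariance at [a ^+ j * x] comes from [g] itself; Schur's theorem with exponent [n] carries it
    to [y = x ^+ n], and so to all elements outside [U]. *)
Lemma power_invariant_aut (g : {perm gT}) x c : g \in A -> g 1 = 1 ->
  (forall y, g (a * y) = a * g y) -> x \notin U -> g x = x ^+ c -> power_invariant c.
Proof.
move=> /digraph_aut_cayleyP Ag g1 ga Ux gx.
have gaX i y : g (a ^+ i * y) = a ^+ i * g y.
  by elim: i => [|i IHi]; rewrite ?mul1g // expgS -!mulgA ga IHi.
split=> [|y i Uy].
  rewrite -(expg_notin_cycle _ Ux) -gx; apply: contra Ux => /cycleP[i E].
  suff -> : x = a ^+ i by apply: groupX (cycle_id a).
  by apply: (@perm_inj _ g); rewrite E -{2}[a ^+ i]mulg1 gaX g1 mulg1.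
have [n En] := cycle_notin_cycle y Ux.
have pn : ~~ (p %| n) by rewrite -(expg_notin_cycle _ Ux) -En.
have [j Ej] : exists j, a ^+ i = (a ^+ n) ^+ j.
  apply/cycleP; rewrite cycle_eq_cycle ?groupX ?cycle_id //.
  by rewrite -order_dvdn oa.
have con : coprime #|gT| n by rewrite cardG coprimeXl // prime_coprime.
have := schur_preserve mulC Ag con 1 (a ^+ j * x).
rewrite g1 invg1 !mul1g gaX gx.
have E z : (a ^+ j * z) ^+ n = z ^+ n * a ^+ i.
  by rewrite expgMn ?Ej; [rewrite mulC -!expgM [(j * n)%N]mulnC | apply: mulC].
by rewrite !E -expgM mulnC expgM -En.
Qed.

(** Let [g] raise [x] to [c] and [x * a] to [c']. Then [x ^+ c * a = (x * a) ^+ c'], whose [p]-th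
    power gives [c = c'] modulo [p]. The invariant exponents [c' ^ (p - 1)] and [c * c' ^ (p - 2)]
    are 1 modulo [p], hence modulo [p ^ 2], so [c = c'] modulo [p ^ 2]. What remains is
    [a = a ^+ c'], so [c] is 1 modulo [p], and finally modulo [p ^ 2]. *)
Lemma cyclic_cent_translation (g : {perm gT}) : g \in A -> g 1 = 1 ->
  (forall y, g (a * y) = a * g y) -> g = 1.
Proof.
move=> Ag g1 ga; have p1 := prime_gt1 p_pr.
apply/permP => x; rewrite perm1.
have [/cycleP[i ->]|Ux] := boolP (x \in U).
  elim: i => [|i IHi]; first by rewrite g1.
  by rewrite expgS ga IHi.
have [c gx] := cycle_notin_cycle (g x) Ux.
pose x' := x * a; have Ux' : x' \notin U by rewrite groupMr ?cycle_id.
have [c' gx'] := cycle_notin_cycle (g x') Ux'.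
have Ic := power_invariant_aut Ag g1 ga Ux gx.
have Ic' := power_invariant_aut Ag g1 ga Ux' gx'.
have E : x ^+ c * a = x ^+ c' * a ^+ c'.
  rewrite -gx mulC -ga mulC -[x * a]/x' gx' expgMn //; exact: mulC.
have ap : a ^+ p = 1 by rewrite -oa expg_order.
have cc' : c = c' %[mod p].
  have : (x ^+ c * a) ^+ p == (x ^+ c' * a ^+ c') ^+ p by rewrite E.
  rewrite !expgMn; try exact: mulC.
  rewrite -(expgM a) mulnC expgM ap expg1n !mulg1 -!expgM eq_expg_mod_order.
  rewrite (order_notin_cycle Ux) -mulnn -!muln_modl eqn_pmul2r ?prime_gt0 //.
  by move/eqP.
have Fc' : c' ^ p.-1 = 1 %[mod p].
  by rewrite -totient_prime // Euler_exp_totient // coprime_sym prime_coprime //; case: Ic'.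
have Ep : p.-1 = p.-2.+1 by lia.
have f1 := power_invariant_mod (power_invariantX p.-1 Ic') Fc'.
have e1 : c * c' ^ p.-2 = 1 %[mod p ^ 2].
  apply: power_invariant_mod; first by apply: power_invariantM => //; apply: power_invariantX.
  by rewrite -modnMml cc' modnMml -expnS -Ep.
have cc2 : c = c' %[mod p ^ 2].
  rewrite -[c in LHS]muln1 -modnMmr -f1 modnMmr Ep expnS mulnCA -modnMmr e1 modnMmr.
  by rewrite muln1.
have Exc : x ^+ c = x ^+ c'.
  by apply/eqP; rewrite eq_expg_mod_order (order_notin_cycle Ux) cc2.
move: E; rewrite Exc => /mulgI/eqP; rewrite -{1}[a]expg1 eq_expg_mod_order oa => /eqP c'1.
have := power_invariant_mod Ic (etrans cc' (esym c'1)) => c1.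
rewrite gx -[RHS]expg1; apply/eqP.
by rewrite eq_expg_mod_order (order_notin_cycle Ux) c1.
Qed.

End CyclicPrimeSquared.

Theorem cyclic_normal_cayley p (gT : finGroupType) (S : {set gT}) :
  prime p -> #|gT| = (p ^ 2)%N -> cyclic [set: gT] -> 1 \notin S ->
  (forall H : {group gT}, #|H| = p -> ~ coset_regular S H) -> normal_cayley S.
Proof.
move=> p_pr cardG cycG S1 irr.
have mulC := mulgC_p2 p_pr cardG.
have centP (g : {perm gT}) u : u != 1 -> g \in digraph_aut (cayley S) -> g 1 = 1 ->
    g \in 'C[translation u] -> g = 1.
  move=> u1 Ag g1 /cent_translationP cgu.
  have cguX i x : g (u ^+ i * x) = u ^+ i * g x.
    by elim: i => [|i IHi]; rewrite ?mul1g // expgS -!mulgA cgu IHi.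
  have pu : p %| #[u].
    have : #[u] %| p ^ 2 by rewrite -cardG -cardsT order_dvdG ?in_setT.
    case/(dvdn_pfactor _ _ p_pr) => -[|m] _ ou; last by rewrite ou expnS dvdn_mulr.
    by move/eqP: ou; rewrite order_eq1 (negPf u1).
  have ou : #[u ^+ (#[u] %/ p)] = p.
    by rewrite orderXdiv ?dvdn_div // divnA // mulKn ?order_gt0.
  exact: (cyclic_cent_translation p_pr cardG cycG irr ou).
apply: (normal_of_fixed_points p_pr cardG irr S1).
  move=> u u1; apply/subsetP => g /setIP[Ag cgu].
  pose t := translation (g 1)^-1.
  have Pt : t \in left_regular_group gT by apply: mem_translation.
  suff E : g * t = 1.
    by rewrite (canRL (mulgK t) E) mul1g groupV (subsetP (normG _)).
  apply: (centP _ u u1).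
  - by rewrite groupM // (subsetP (left_regular_sub_aut S)).
  - by rewrite permM translationE mulVg.
  rewrite groupM //; apply/cent1P; rewrite /commute !translationM.
  by congr translation; apply: mulC.
move=> g x Ag _ g1 Ng _ _ gneq1 u gu; apply/eqP; apply: contraNT gneq1 => u1.
by apply/eqP/(centP g u u1) => //; apply: fix_cent_translation.
Qed.

(** * Elementary abelian groups *)

Section ElementaryAbelian.

Variables (p : nat) (gT : finGroupType) (S : {set gT}).
Hypotheses (p_pr : prime p) (cardG : #|gT| = (p ^ 2)%N).
Hypothesis expp : forall x : gT, x ^+ p = 1.
Local Notation A := (digraph_aut_group (cayley S)).
Local Notation P := (left_regular_group gT).
Local Notation F := 'F_p.

Let mulC := mulgC_p2 p_pr cardG.

Lemma order_exponent_p (x : gT) : x != 1 -> #[x] = p.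
Proof.
move=> x1; have : #[x] %| p by rewrite order_dvdn expp.
by case/primeP: p_pr => _ H /H; rewrite order_eq1 (negPf x1) => /eqP.
Qed.

Lemma cycle_sub_eq (x y : gT) : x != 1 -> x \in <[y]> -> <[x]> = <[y]>.
Proof.
move=> x1 xy; have y1 : y != 1 by apply: contraTneq xy => ->; rewrite cycle1 inE.
by apply/eqP; rewrite eqEcard cycle_subG xy -!orderE !order_exponent_p /=.
Qed.

Lemma notin_cycle_sym (x y : gT) : x != 1 -> y \notin <[x]> -> x \notin <[y]>.
Proof.
by move=> x1; apply: contra => /(cycle_sub_eq x1)->; apply: cycle_id.
Qed.

Lemma exists_notin_cycle (x : gT) : exists y, y \notin <[x]>.
Proof.
apply/existsP; rewrite -negb_forall; apply/negP => /forallP all_in.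
have : #|gT| <= #[x] by rewrite orderE -cardsT subset_leq_card //; apply/subsetP.
have p1 := prime_gt1 p_pr; rewrite cardG -mulnn.
have [->|x1] := eqVneq x 1; first by rewrite order1; nia.
by rewrite order_exponent_p //; nia.
Qed.

Lemma expgFD (x : gT) (a b : F) : x ^+ (a + b)%R = x ^+ a * x ^+ b.
Proof. by rewrite -expgD /= (expg_mod _ _) // Fp_cast. Qed.

Lemma expgFM (x : gT) (m a : F) : x ^+ (m * a)%R = (x ^+ a) ^+ m.
Proof. by rewrite -expgM mulnC /= (expg_mod _ _) // Fp_cast. Qed.

Lemma expgF_nat (x : gT) n : x ^+ (n%:R : F)%R = x ^+ n.
Proof. by rewrite val_Fp_nat // expg_mod. Qed.

Lemma F_coprime (m : F) : m != 0%R -> coprime #|gT| m.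
Proof.
move=> m0; rewrite cardG coprimeXl // prime_coprime // gtnNdvd ?lt0n //.
by have := ltn_ord m; rewrite {2}Fp_cast.
Qed.

Section Basis.

Variables u t : gT.
Hypotheses (t1 : t != 1) (ut : u \notin <[t]>).

Definition of_coord (c : F * F) : gT := u ^+ c.1 * t ^+ c.2.

Lemma of_coordD c d : of_coord (c + d)%R = of_coord c * of_coord d.
Proof.
rewrite /of_coord /= !expgFD -!mulgA; congr (_ * _).
by rewrite !mulgA; congr (_ * _); apply: mulC.
Qed.

Lemma of_coord0 : of_coord 0%R = 1.
Proof. by rewrite /of_coord /= !expg0 mulg1. Qed.

Lemma of_coordN c : of_coord (- c)%R = (of_coord c)^-1.
Proof. by apply: (mulgI (of_coord c)); rewrite -of_coordD subrr mulgV of_coord0. Qed.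

Lemma of_coordB c d : of_coord (c - d)%R = (of_coord d)^-1 * of_coord c.
Proof. by rewrite addrC of_coordD of_coordN. Qed.

Lemma of_coordZ (m : F) c : of_coord (m * c.1, m * c.2)%R = of_coord c ^+ m.
Proof. by rewrite /of_coord /= !expgFM expgMn //; apply: mulC. Qed.

Lemma of_coord_inj : injective of_coord.
Proof.
move=> c d /eqP; rewrite eq_mulVg1 -of_coordB => /eqP E.
apply/eqP; rewrite eq_sym -subr_eq0; move: (d - c)%R E => {c d}[a b] E.
have a0 : a = 0%R.
  apply/eqP; apply: contraNT ut => a0.
  have : u ^+ a \in <[t]>.
    by rewrite (canRL (mulgK _) E) mul1g groupV mem_cycle.
  suff Eu : u = (u ^+ a) ^+ (a^-1)%R by move=> ua; rewrite Eu groupX.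
  by rewrite -expgFM mulVf // expg1.
move: E; rewrite a0 /of_coord /= mul1g => E; apply/eqP; congr (_, _).
apply/eqP; apply: contraNT t1 => b0.
suff -> : t = (t ^+ b) ^+ (b^-1)%R by rewrite E expg1n.
by rewrite -expgFM mulVf // expg1.
Qed.

Definition to_coord (x : gT) : F * F :=
  if [pick c | of_coord c == x] is Some c then c else 0%R.

Lemma coordK : cancel to_coord of_coord.
Proof.
move=> x; rewrite /to_coord; case: pickP => [c /eqP //|no].
have le_card : #|gT| <= #|{: F * F}|.
  by rewrite cardG card_prod card_Fp // mulnn.
have /codomP[c Ec] := inj_card_onto of_coord_inj le_card x.
by have := no c; rewrite /= -Ec eqxx.
Qed.

Lemma of_coordK : cancel of_coord to_coord.
Proof. by move=> c; apply: of_coord_inj; rewrite coordK. Qed.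

Lemma coordV x y : of_coord (to_coord y - to_coord x)%R = x^-1 * y.
Proof. by rewrite of_coordB !coordK. Qed.

Definition coord_set (a b : F) : bool := of_coord (a, b) \in S.

Lemma coord_set_aut (g : {perm gT}) (m : F) x y : g \in A -> (m != 0)%R ->
  coord_set (m * ((to_coord (g y)).1 - (to_coord (g x)).1))%R
            (m * ((to_coord (g y)).2 - (to_coord (g x)).2))%R
  = coord_set (m * ((to_coord y).1 - (to_coord x).1))%R (m * ((to_coord y).2 - (to_coord x).2))%R.
Proof.
move=> /digraph_aut_cayleyP Ag m0.
have E z w : of_coord (m * ((to_coord w).1 - (to_coord z).1), m * ((to_coord w).2 - (to_coord z).2))%R
    = (z^-1 * w) ^+ m.
  by rewrite (of_coordZ m (to_coord w - to_coord z)%R) coordV.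
by rewrite /coord_set !E; apply: schur_preserve mulC Ag _ _ _; apply: F_coprime.
Qed.

Lemma coord_translation c x : to_coord (of_coord c * x) = (c + to_coord x)%R.
Proof. by apply: of_coord_inj; rewrite coordK of_coordD coordK. Qed.

Lemma mem_cycle_coord x : (x \in <[t]>) = ((to_coord x).1 == 0)%R.
Proof.
apply/cycleP/eqP => [[i ->]|x0].
  suff -> : t ^+ i = of_coord (0, i%:R)%R by rewrite of_coordK.
  by rewrite /of_coord /= mul1g expgF_nat.
by exists (to_coord x).2; rewrite -{1}(coordK x) /of_coord x0 mul1g.
Qed.

Hypothesis irregular : forall H : {group gT}, #|H| = p -> ~ coset_regular S H.

Lemma coset_split :
  exists al y y', [/\ al != 0%R, coord_set al y & ~~ coord_set al y'].
Proof.
have [//|no] := boolP [exists al : F, exists y : F, exists y' : F,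
    [&& al != 0%R, coord_set al y & ~~ coord_set al y']].
  by move=> /existsP[al /existsP[y /existsP[y' /and3P[]]]]; exists al, y, y'.
case: (@irregular <[t]>%G); first by rewrite -orderE order_exponent_p.
move=> x h; rewrite !mem_cycle_coord => x0 /eqP h0.
have E : to_coord (x * h) = ((to_coord x).1, (to_coord x).2 + (to_coord h).2)%R.
  apply: of_coord_inj; rewrite coordK -[in LHS](coordK x) -[in LHS](coordK h).
  rewrite -of_coordD; congr of_coord; move: (to_coord x) (to_coord h) h0 => [x1 x2] [h1 h2] /= ->.
  by congr (_, _); rewrite addr0.
rewrite -[x * h]coordK -[x in RHS]coordK E [to_coord x in RHS]surjective_pairing.
move: no; rewrite negb_exists => /forallP/(_ (to_coord x).1).
rewrite negb_exists => /forallP no; move: (no (to_coord x).2) (no ((to_coord x).2 + (to_coord h).2)%R).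
rewrite !negb_exists => /forallP/(_ ((to_coord x).2 + (to_coord h).2)%R) + /forallP/(_ (to_coord x).2).
rewrite x0 /= /coord_set; do 2!case: (_ \in S) => //.
Qed.

Hypothesis TI : forall u, u != 1 -> 'C_A[translation u] \subset 'N(P).

(** By [fibrewise_affine], [k] is affine or commutes with a nontrivial translation; [TI] settles the
    second case. *)
Lemma coset_preserving_norm (k : {perm gT}) : k \in A ->
  (forall x, x^-1 * k x \in <[t]>) -> k \in 'N(P).
Proof.
move=> Ak kt; pose K a b := (to_coord (k (of_coord (a, b)))).2.
have kE a b : to_coord (k (of_coord (a, b))) = (a, K a b).
  rewrite /K; set y := k _; have := kt (of_coord (a, b)); rewrite mem_cycle_coord.
  have -> : to_coord ((of_coord (a, b))^-1 * y) = (to_coord y - (a, b))%R.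
    by rewrite -of_coordN coord_translation addrC.
  by rewrite /= subr_eq0 => /eqP <-; apply: surjective_pairing.
have HK m a a' b b' : m != 0%R -> a != a' ->
    coord_set (m * (a - a'))%R (m * (K a b - K a' b'))%R =
    coord_set (m * (a - a'))%R (m * (b - b'))%R.
  move=> m0 _; have := coord_set_aut (of_coord (a', b')) (of_coord (a, b)) Ak m0.
  by rewrite !kE !of_coordK.
have KI a : injective (K a).
  move=> b b' E; have : to_coord (k (of_coord (a, b))) = to_coord (k (of_coord (a, b'))).
    by rewrite !kE E.
  by move/(can_inj coordK)/perm_inj/of_coord_inj => [].
have [[la [mu [nu Kaff]]]|[al [y [al0 Ktr]]]] := fibrewise_affine p_pr HK coset_split KI.
  apply/norm_left_regularP => x y.
  have kc z : k z = of_coord ((to_coord z).1, la * (to_coord z).2 + mu * (to_coord z).1 + nu)%R.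
    by rewrite -Kaff -kE coordK -surjective_pairing coordK.
  rewrite !kc -of_coordN -!of_coordD; congr of_coord.
  have -> : to_coord (x * y) = (to_coord x + to_coord y)%R by rewrite -[x in LHS]coordK coord_translation.
  have -> : to_coord 1 = 0%R by rewrite -of_coord0 of_coordK.
  by congr (_, _); rewrite /=; ring.
have v1 : of_coord (al, y) != 1.
  apply: contra al0 => /eqP E; have : (al, y) = 0%R by apply: of_coord_inj; rewrite E of_coord0.
  by move=> [-> _].
apply: (subsetP (TI v1)); rewrite inE Ak; apply/cent_translationP => x.
rewrite -[x]coordK -of_coordD [to_coord x]surjective_pairing; move: (to_coord x) => [a b] /=.
apply: (can_inj coordK); rewrite coord_translation !kE /=.
by rewrite (addrC al) (addrC y) Ktr; congr (_, _); apply: addrC.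
Qed.

End Basis.

End ElementaryAbelian.

(** * Automorphisms commuting with a translation *)

Section CentralizingAutomorphisms.

Variables (p : nat) (gT : finGroupType) (S : {set gT}).
Hypotheses (p_pr : prime p) (cardG : #|gT| = (p ^ 2)%N).
Hypothesis expp : forall x : gT, x ^+ p = 1.
Hypothesis irregular : forall H : {group gT}, #|H| = p -> ~ coset_regular S H.
Local Notation A := (digraph_aut_group (cayley S)).
Local Notation P := (left_regular_group gT).
Local Notation F := 'F_p.

Let mulC := mulgC_p2 p_pr cardG.

Lemma coset_split_swap (u t : gT) : t != 1 -> u \notin <[t]> ->
  exists x z z', [/\ x != 0%R, @coord_set p gT S u t z x & ~~ @coord_set p gT S u t z' x].
Proof.
move=> t1 ut; have u1 : u != 1 by apply: contraNneq ut => ->; apply: group1.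
have tu : t \notin <[u]> by apply: (notin_cycle_sym p_pr expp).
have [x [y [y' [x0 Sy Sy']]]] := coset_split p_pr cardG expp u1 tu irregular.
exists x, y, y'; split=> //.
  by move: Sy; rewrite /coord_set /of_coord /= mulC.
by move: Sy'; rewrite /coord_set /of_coord /= mulC.
Qed.

Lemma cent_translation_dichotomy (u : gT) (g : {perm gT}) : u != 1 ->
  g \in A -> g 1 = 1 -> g \in 'C[translation u] ->
  g \in 'N(P) \/ 5 <= p /\ exists2 t, t \notin <[u]> &
    forall z i j : F, i != 0%R -> j != 0%R ->
      (u ^+ z * t ^+ i \in S) = (u ^+ z * t ^+ j \in S).
Proof.
move=> u1 Ag g1 /cent_translationP gu.
have [t tu] := exists_notin_cycle p_pr cardG expp u.
have ut := notin_cycle_sym p_pr expp u1 tu.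
have t1 : t != 1 by apply: contraNneq tu => ->; apply: group1.
pose cd := @to_coord p gT u t; pose oc := @of_coord p gT u t.
have cdK : cancel cd oc := coordK p_pr cardG expp t1 ut.
have ocK : cancel oc cd := of_coordK p_pr cardG expp t1 ut.
have ocI : injective oc := can_inj ocK.
have ocD c d : oc (c + d)%R = oc c * oc d by apply: of_coordD.
have guX n y : g (u ^+ n * y) = u ^+ n * g y.
  by elim: n => [|n IHn]; rewrite ?mul1g // expgS -!mulgA gu IHn.
pose ga b := (cd (g (oc (0%R, b)))).1; pose be b := (cd (g (oc (0%R, b)))).2.
have gE a b : g (oc (a, b)) = oc (a + ga b, be b)%R.
  have -> : oc (a, b) = u ^+ a * oc (0%R, b) by rewrite /oc /of_coord /= mul1g.
  rewrite guX -[g _]cdK [cd _]surjective_pairing -/(ga b) -/(be b).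
  by rewrite -[RHS]/(u ^+ (a + ga b)%R * t ^+ be b) (expgFD p_pr expp) mulgA.
have beI : injective be.
  move=> b b' E; have : g (oc (ga b' - ga b, b)%R) = g (oc (0%R, b')).
    by rewrite !gE E subrK add0r.
  by move/perm_inj/ocI/(congr1 snd).
have oc00 : oc (0%R, 0%R) = 1 by apply: of_coord0.
have [ga0 be0] : ga 0%R = 0%R /\ be 0%R = 0%R.
  have := gE 0%R 0%R; rewrite oc00 g1 -oc00 => /ocI E.
  by move: (congr1 fst E) (congr1 snd E); rewrite /= add0r => <- <-.
have HS m a b b' : m != 0%R -> b != b' ->
    @coord_set p gT S u t (m * (a + ga b - ga b'))%R (m * (be b - be b'))%R =
    @coord_set p gT S u t (m * a)%R (m * (b - b'))%R.
  move=> m0 _; have := coord_set_aut p_pr cardG expp t1 ut (oc (0%R, b')) (oc (a, b)) Ag m0.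
  by rewrite -/cd !gE !ocK /= add0r subr0.
have [[c [d lin]]|[p5 [z0 Hz0]]] :=
    shear_dichotomy p_pr beI be0 ga0 (coset_split_swap t1 ut) HS.
  left; apply/norm_left_regularP => x y; rewrite g1 invg1 mulg1.
  have gc z : g z = oc ((cd z).1 + d * (cd z).2, c * (cd z).2)%R.
    rewrite -{1}[z]cdK [cd z]surjective_pairing gE.
    by have [-> ->] := lin (cd z).2.
  have E : cd (x * y) = (cd x + cd y)%R.
    by apply: ocI; rewrite ocD !cdK.
  rewrite !gc -ocD E; congr oc.
  by congr (_, _); rewrite /=; ring.
(* Replacing [t] by this element absorbs the shear by [z0], as [u ^+ (z + z0 * x) * t ^+ x] is
   [u ^+ z] times its [x]-th power. *)
right; split=> //; exists (u ^+ z0 * t).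
  by rewrite groupMl ?mem_cycle.
move=> z i j i0 j0; have := Hz0 z i j i0 j0; rewrite /coord_set.
suff E x : @of_coord p gT u t (z + z0 * x, x)%R = u ^+ z * (u ^+ z0 * t) ^+ x by rewrite !E.
rewrite -[LHS]/(u ^+ (z + z0 * x)%R * t ^+ x) (expgFD p_pr expp).
rewrite mulrC (expgFM p_pr expp) expgMn ?mulgA //; exact: mulC.
Qed.

End CentralizingAutomorphisms.

(** * Connection sets made of few lines *)

Section FewLines.

Variables (p : nat) (gT : finGroupType) (S : {set gT}).
Hypotheses (p_pr : prime p) (cardG : #|gT| = (p ^ 2)%N).
Hypothesis expp : forall x : gT, x ^+ p = 1.
Hypothesis irregular : forall H : {group gT}, #|H| = p -> ~ coset_regular S H.
Local Notation A := (digraph_aut_group (cayley S)).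
Local Notation P := (left_regular_group gT).
Local Notation F := 'F_p.
Hypothesis TI : forall u, u != 1 -> 'C_A[translation u] \subset 'N(P).

Let mulC := mulgC_p2 p_pr cardG.

(* A graph whose connection set is a union of few lines has only lines as
   images of its lines, so a conjugate of a translation along such a line
   preserves every line of some parallel class. *)
Lemma normal_of_lines (L : pred gT) (d t : gT) :
  ~~ L 1 -> (forall (m : F) v, (m != 0)%R -> L (v ^+ m) = L v) ->
  (forall g x y, g \in A -> L ((g x)^-1 * g y) = L (x^-1 * y)) ->
  L d -> t != 1 -> ~~ L t -> #|[set v | L v]|.*2 <= (p ^ 2).-1 -> P <| A.
Proof.
move=> L1 Lh Linv Ld t1 Lt small.
have [u ut] := exists_notin_cycle p_pr cardG expp t.
pose cd := @to_coord p gT u t; pose oc := @of_coord p gT u t.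
have cdK : cancel cd oc := coordK p_pr cardG expp t1 ut.
have ocK : cancel oc cd := of_coordK p_pr cardG expp t1 ut.
have ocI : injective oc := can_inj ocK.
have cdI : injective cd := can_inj cdK.
have ocB c e : oc (c - e)%R = (oc e)^-1 * oc c by apply: of_coordB.
have ocZ (m : F) c : oc (m * c.1, m * c.2)%R = oc c ^+ m by apply: of_coordZ.
pose Lc a b := L (oc (a, b)).
have Lch m a b : m != 0%R -> Lc (m * a)%R (m * b)%R = Lc a b.
  by move=> m0; rewrite /Lc -(Lh m (oc (a, b)) m0) -ocZ.
have Lc0 y : ~~ Lc 0%R y.
  rewrite /Lc /oc /of_coord /= mul1g; have [->|y0] := eqVneq y 0%R; first exact: L1.
  by rewrite Lh.
have d1 : d != 1 by apply: contraTneq Ld => ->.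
(* Every admissible slope contributes [p - 1] elements to [L], and [2 #|L| <= (p - 1) (p + 1)]. *)
have smallc : (#|[set m | Lc 1%R m]|.*2 <= p.+1)%N.
  pose f (cm : F * F) := oc (cm.1, cm.1 * cm.2)%R.
  have fI : {in setX [set~ (0 : F)%R] [set m | Lc 1%R m] &, injective f}.
    move=> [c m] [c' m'] /setXP[c0 _] _ /ocI E.
    have E1 : c = c' := congr1 fst E; have := congr1 snd E; rewrite /= -E1 => /mulfI ->//.
    by move: c0; rewrite !inE.
  have := subset_leq_card (_ : [set f cm | cm in setX [set~ 0%R] [set m | Lc 1%R m]] \subset [set v | L v]).
  rewrite (card_in_imset fI) cardsX cardsC1 card_Fp // => /(_ _) H.
  have {}H : p.-1 * #|[set m | Lc 1%R m]| <= #|[set v | L v]|.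
    apply: H; apply/subsetP => _ /imsetP[[c m] /setXP[c0 Lm] ->].
    rewrite !inE in c0 Lm *; rewrite -[L _]/(Lc c (c * m)%R).
    by rewrite -[X in Lc X _]mulr1 Lch.
  have := prime_gt1 p_pr; move: H small; rewrite -!muln2 -mulnn.
  move: #|[set m | _]| #|[set v | _]| => x y; nia.
have line g x : g \in A -> exists al be, Lc 1%R al /\
    forall i : F, (cd (g (x * d ^+ i))).2 = (al * (cd (g (x * d ^+ i)%g)).1 + be)%R.
  move=> Ag; apply: (collinear_of_directions p_pr Lch Lc0 smallc
    (c1 := fun i => (cd (g (x * d ^+ i))).1) (c2 := fun i => (cd (g (x * d ^+ i))).2)).
  move=> i j ij; rewrite /Lc.
  have -> : ((cd (g (x * d ^+ i)%g)).1 - (cd (g (x * d ^+ j)%g)).1,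
             (cd (g (x * d ^+ i)%g)).2 - (cd (g (x * d ^+ j)%g)).2)%R
    = (cd (g (x * d ^+ i)%g) - cd (g (x * d ^+ j)%g))%R by [].
  rewrite ocB !cdK Linv // invMg -mulgA mulKg.
  have -> : (d ^+ j)^-1 * d ^+ i = d ^+ (i - j)%R.
    by apply: (mulgI (d ^+ j)); rewrite mulKVg -(expgFD p_pr expp) addrC subrK.
  by rewrite Lh // subr_eq0.
have c1I g x al be : g \in A ->
    (forall i : F, (cd (g (x * d ^+ i))).2 = (al * (cd (g (x * d ^+ i)%g)).1 + be)%R) ->
    injective (fun i : F => (cd (g (x * d ^+ i))).1).
  move=> Ag H i j E; apply/eqP; apply: contraNT d1 => ij.
  have : g (x * d ^+ i) = g (x * d ^+ j).
    by apply: cdI; rewrite [LHS]surjective_pairing [RHS]surjective_pairing !H E.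
  move/perm_inj/mulgI => Ed; have {}Ed : d ^+ (i - j)%R = 1.
    by apply: (mulIg (d ^+ j)); rewrite -(expgFD p_pr expp) subrK mul1g Ed.
  suff -> : d = (d ^+ (i - j)%R) ^+ (i - j)^-1%R by rewrite Ed expg1n.
  by rewrite -(expgFM p_pr expp) mulVf ?expg1 // subr_eq0.
(* Image lines of different slopes would meet at first coordinate [s]. As [g] is injective, the
   original lines of direction [d] would then share a point and coincide, and so would their
   images. *)
have parallel g x x2 al be al2 be2 : g \in A ->
    (forall i : F, (cd (g (x * d ^+ i))).2 = (al * (cd (g (x * d ^+ i)%g)).1 + be)%R) ->
    (forall i : F, (cd (g (x2 * d ^+ i))).2 = (al2 * (cd (g (x2 * d ^+ i)%g)).1 + be2)%R) ->
    al = al2.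
  move=> Ag H H2; apply/eqP; apply/negPn/negP => neq.
  have neq0 : (al - al2 != 0)%R by rewrite subr_eq0.
  pose s := ((be2 - be) / (al - al2))%R.
  pose i := invF (c1I _ _ _ _ Ag H) s; pose j := invF (c1I _ _ _ _ Ag H2) s.
  have Ei : (cd (g (x * d ^+ i))).1 = s by apply: (f_invF (c1I _ _ _ _ Ag H)).
  have Ej : (cd (g (x2 * d ^+ j))).1 = s by apply: (f_invF (c1I _ _ _ _ Ag H2)).
  have : g (x * d ^+ i) = g (x2 * d ^+ j).
    apply: cdI; rewrite [LHS]surjective_pairing [RHS]surjective_pairing H H2 Ei Ej.
    congr (_, _); apply/eqP; rewrite -subr_eq0; apply/eqP.
    transitivity ((al - al2) * s - (be2 - be))%R; first by ring.
    by rewrite /s mulrCA divff // mulr1 subrr.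
  move/perm_inj => E.
  have E' (l : F) : x * d ^+ (i + l)%R = x2 * d ^+ (j + l)%R.
    by rewrite !(expgFD p_pr expp) !mulgA E.
  have := H (i + 1)%R; rewrite E' H2 -E'; set s' := (cd _).1 => Es'.
  have := H i; rewrite E H2 -E Ei => Es.
  have ss' : s' = s.
    apply: (mulfI neq0); transitivity ((al * s' + be) - (al2 * s' + be2) + be2 - be)%R.
      by ring.
    rewrite -Es'; transitivity ((al2 * s + be2) - (al * s + be) + (al - al2) * s)%R; last first.
      by rewrite Es subrr add0r.
    by ring.
  have : (i + 1 = i + 0)%R by apply: (c1I _ _ _ _ Ag H); rewrite addr0 Ei.
  by move/addrI/eqP; rewrite oner_eq0.
rewrite /normal PA; apply/subsetP => g Ag.
have [al [be [Lal Hal]]] := line g 1 Ag.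
pose e := oc (1, al)%R.
have Le : L e := Lal.
have e1 : e != 1 by apply: contraTneq Le => ->.
have [w we] := exists_notin_cycle p_pr cardG expp e.
pose k := translation d ^ g.
have Ad : translation d \in A := subsetP (PA S) _ (mem_translation d).
have Ak : k \in A by rewrite groupJ.
have kE x : k (g x) = g (x * d).
  by rewrite /k conjgE !permM permK translationE mulC.
have Nk : k \in 'N(P).
  apply: (coset_preserving_norm p_pr cardG expp e1 we irregular TI Ak) => y.
  rewrite -[y](permKV g); move: (g^-1 y) => {}y; rewrite kE.
  have [al2 [be2 [_ H2]]] := line g y Ag.
  have E2 : al2 = al by apply/esym/(parallel g 1 y al be al2 be2 Ag Hal H2).
  have := H2 1%R; have := H2 0%R; rewrite expg0 expg1 mulg1 => h0 h1.
  have -> : (g y)^-1 * g (y * d) = oc (cd (g (y * d)%g) - cd (g y))%R by rewrite ocB !cdK.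
  apply/cycleP; exists ((cd (g (y * d)%g)).1 - (cd (g y)).1)%R.
  rewrite -ocZ /=; congr oc; rewrite [LHS]surjective_pairing /= h0 h1 E2.
  by congr (_, _); ring.
have pk : p.-elt k.
  by rewrite /p_elt orderJ; apply: (mem_p_elt (p_group_left_regular p_pr cardG)); apply: mem_translation.
(* Now [k] is a nontrivial translation lying also in [P :^ g], so [TI_conj] yields [P :^ g = P]. *)
have Pk := p_elt_norm1 p_pr cardG irregular Ak pk Nk.
have [w' Ew'] := left_regularP _ Pk.
apply/normP; apply: (TI_conj p_pr cardG irregular TI Ag (u := w')).
  apply: contra d1 => /eqP w'1; move/eqP: Ew'; rewrite w'1 translation1 conjg_eq1.
  by rewrite -translation1 (inj_eq (@translation_inj gT)).
by rewrite -Ew' memJ_conjg mem_translation.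
Qed.

End FewLines.

(** * Number of points of the connection set on each line *)

Section LineCounts.

Variables (p : nat) (gT : finGroupType) (S : {set gT}).
Hypotheses (p_pr : prime p) (cardG : #|gT| = (p ^ 2)%N).
Hypothesis expp : forall x : gT, x ^+ p = 1.
Hypothesis irregular : forall H : {group gT}, #|H| = p -> ~ coset_regular S H.
Local Notation A := (digraph_aut_group (cayley S)).
Local Notation P := (left_regular_group gT).
Local Notation F := 'F_p.
Hypothesis TI : forall u, u != 1 -> 'C_A[translation u] \subset 'N(P).

Let mulC := mulgC_p2 p_pr cardG.

Definition line_count (v : gT) := #|[set m : F | (m != 0)%R && (v ^+ m \in S)]|.

Lemma line_count_aut (g : {perm gT}) x y : g \in A ->
  line_count ((g x)^-1 * g y) = line_count (x^-1 * y).
Proof.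
move=> /digraph_aut_cayleyP Ag; apply: eq_card => m; rewrite !inE.
have [//|m0] := eqVneq m 0%R.
by rewrite (schur_preserve mulC Ag) // F_coprime.
Qed.

Lemma line_countX (m : F) v : m != 0%R -> line_count (v ^+ m) = line_count v.
Proof.
move=> m0; rewrite /line_count -[LHS](card_imset _ (mulfI m0)); apply: eq_card => n.
rewrite inE; apply/imsetP/andP => [[k]|[n0 Sn]].
  by rewrite inE => /andP[k0 Sk] ->; rewrite mulf_neq0 // mulrC (expgFM p_pr expp).
exists (n / m)%R; last by rewrite mulrCA divff ?mulr1.
by rewrite inE mulf_neq0 ?invr_eq0 // -(expgFM p_pr expp) mulfVK.
Qed.

Lemma expgF_neq1 (m : F) (v : gT) : v != 1 -> m != 0%R -> v ^+ m != 1.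
Proof.
move=> v1 m0; apply: contra v1 => /eqP E.
have -> : v = (v ^+ m) ^+ (m^-1)%R by rewrite -(expgFM p_pr expp) mulVf ?expg1.
by rewrite E expg1n.
Qed.

(** By Schur's theorem the line count is preserved by automorphisms. The elements with the count of
    [d] and the remaining nonidentity elements are both unions of punctured lines, and one of the
    two sets is small enough for [normal_of_lines]. *)
Lemma normal_of_line_count d w :
  d != 1 -> w != 1 -> line_count d != line_count w -> P <| A.
Proof.
move=> d1 w1 dw.
pose L1 v := (v != 1) && (line_count v == line_count d).
pose L2 v := (v != 1) && (line_count v != line_count d).
have Lh (m : F) v : m != 0%R ->
    (v ^+ m != 1 = (v != 1)) /\ line_count (v ^+ m) = line_count v.
  move=> m0; split; last exact: line_countX.
  have [->|v1] := eqVneq v 1; first by rewrite expg1n eqxx.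
  exact: expgF_neq1.
have Linv (g : {perm gT}) x y : g \in A ->
    ((g x)^-1 * g y != 1 = (x^-1 * y != 1)) /\
    line_count ((g x)^-1 * g y) = line_count (x^-1 * y).
  move=> Ag; split; last exact: line_count_aut.
  by rewrite -!eq_mulVg1 (inj_eq perm_inj).
have cardL : (#|[set v | L1 v]| + #|[set v | L2 v]| = (p ^ 2).-1)%N.
  rewrite -cardG -(cardsC1 (1 : gT)) -cardsUI.
  have -> : [set v | L1 v] :&: [set v | L2 v] = set0.
    by apply/setP => v; rewrite !inE /L1 /L2; case: (_ == line_count d); rewrite ?andbF.
  rewrite cards0 addn0; apply: eq_card => v; rewrite !inE /L1 /L2.
  by case: (_ == line_count d); rewrite ?andbT ?andbF ?orbF.
have [small|big] := leqP (#|[set v | L1 v]|.*2) (p ^ 2).-1.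
  apply: (normal_of_lines p_pr cardG expp irregular TI (L := L1) (d := d) (t := w)) => //.
  - by rewrite /L1 eqxx.
  - by move=> m v m0; rewrite /L1; have [-> ->] := Lh m v m0.
  - by move=> g x y Ag; rewrite /L1; have [-> ->] := Linv g x y Ag.
  - by rewrite /L1 d1 eqxx.
  by rewrite /L1 w1 eq_sym.
apply: (normal_of_lines p_pr cardG expp irregular TI (L := L2) (d := w) (t := d)) => //.
- by rewrite /L2 eqxx.
- by move=> m v m0; rewrite /L2; have [-> ->] := Lh m v m0.
- by move=> g x y Ag; rewrite /L2; have [-> ->] := Linv g x y Ag.
- by rewrite /L2 w1 eq_sym.
- by rewrite /L2 d1 eqxx.
by move: big cardL; rewrite -!muln2; move: #|[set v | L1 v]| #|[set v | L2 v]| => a b; lia.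
Qed.

(** A group automorphism with eigenvalue 1 is diagonalizable unless it is a transvection; a
    transvection has order [p], so it would lie in [P] while fixing 1. *)
Lemma fixed_points_basis (k : {perm gT}) u : k \in A -> k 1 = 1 -> k \in 'N(P) ->
  k != 1 -> u != 1 -> k u = u ->
  exists t c, [/\ t != 1, u \notin <[t]>, (c : F) != 1%R & k t = t ^+ c].
Proof.
move=> Ak k1 Nk kn1 u1 ku; have kM := norm_fix1_morph Nk k1.
have kX := autX kM.
have [w wu] := exists_notin_cycle p_pr cardG expp u.
have w1 : w != 1 by apply: contraNneq wu => ->; apply: group1.
have uw : u \notin <[w]> by apply: (notin_cycle_sym p_pr expp).
pose cd := @to_coord p gT u w; pose oc := @of_coord p gT u w.
have cdK : cancel cd oc := coordK p_pr cardG expp w1 uw.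
have [i [j Ekw]] : exists i j : F, k w = u ^+ i * w ^+ j.
  by exists (cd (k w)).1, (cd (k w)).2; rewrite -{1}[k w]cdK.
have kn n : (k ^+ n) u = u by elim: n => [|n IHn]; rewrite ?perm1 // expgSr permM IHn.
have j1 : j != 1%R.
  apply/eqP => j1; move: Ekw; rewrite j1 expg1 => Ekw; case/eqP: kn1.
  have kw n : (k ^+ n) w = u ^+ (i * n) * w.
    elim: n => [|n IHn]; first by rewrite muln0 perm1 mul1g.
    by rewrite expgSr permM IHn kM kX ku Ekw mulgA -expgD mulnS addnC.
  have kp : k ^+ p = 1.
    apply/permP => x; rewrite perm1 -{2}[x]cdK -{1}[x]cdK /oc /of_coord.
    have kpM : forall y z, (k ^+ p) (y * z) = (k ^+ p) y * (k ^+ p) z.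
      elim: (p) => [|n IHn] y z; first by rewrite !perm1.
      by rewrite expgSr !permM IHn kM.
    by rewrite kpM !(autX kpM) kn kw mulnC expgM expp expg1n mul1g.
  have pk : p.-elt k.
    have dvk : #[k] %| p ^ 1 by rewrite expn1 order_dvdn kp.
    have [m _ om] := dvdn_pfactor _ 1 p_pr dvk.
    by rewrite /p_elt om pnatX pnat_id.
  have [a Ea] := left_regularP _ (p_elt_norm1 p_pr cardG irregular Ak pk Nk).
  by move: k1; rewrite Ea translationE mulg1 => ->; rewrite translation1.
have j10 : (j - 1 != 0)%R by rewrite subr_eq0.
(* [u ^+ s * w] is an eigenvector for [j] exactly when [s + i = j * s]. *)
pose s := (i / (j - 1))%R; exists (u ^+ s * w), j.
have tu : u ^+ s * w \notin <[u]> by rewrite groupMl ?mem_cycle.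
have t1 : u ^+ s * w != 1 by apply: contraNneq tu => ->; apply: group1.
split=> //; first exact: (notin_cycle_sym p_pr expp).
rewrite kM kX ku Ekw expgMn; last exact: mulC.
rewrite mulgA -(expgFD p_pr expp) -(expgFM p_pr expp); congr (u ^+ _ * _).
have Es : ((j - 1) * s = i)%R by rewrite /s mulrC mulfVK.
by congr (nat_of_ord _); rewrite -Es; ring.
Qed.

Hypothesis S1 : 1 \notin S.
Hypothesis uniform : forall d w, d != 1 -> w != 1 -> line_count d = line_count w.

Lemma uniform_line_proper u : u != 1 -> exists y y' : F,
  [/\ y != 0%R, y' != 0%R, u ^+ y \in S & u ^+ y' \notin S].
Proof.
move=> u1; have [S0 ST] := connection_set_proper p_pr cardG irregular.
have [y y0 Sy] : exists2 y : F, y != 0%R & u ^+ y \in S.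
  have [s Ss] := set0Pn _ S0; have s1 : s != 1 by apply: contraNneq S1 => <-.
  have : 0 < line_count u.
    rewrite (uniform u1 s1) card_gt0; apply/set0Pn; exists 1%R.
    by rewrite inE oner_neq0 expg1.
  by rewrite card_gt0 => /set0Pn[y]; rewrite inE => /andP[]; exists y.
have [w w1 Sw] : exists2 w, w != 1 & w \notin S.
  have [//|no] := boolP [exists w, (w != 1) && (w \notin S)].
    by move=> /existsP[w /andP[]]; exists w.
  case/eqP: ST; apply/setP => w; rewrite !inE.
  have := existsPn no w; rewrite negb_and !negbK.
  by case: eqVneq => [->|_ /=] //; rewrite (negPf S1).
have [//|no] := boolP [exists y' : F, (y' != 0%R) && (u ^+ y' \notin S)].
  by move=> /existsP[y' /andP[]]; exists y, y'.
have : line_count w < line_count u.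
  apply: proper_card; apply/properP; split.
    apply/subsetP => m; rewrite !inE => /andP[m0 _]; rewrite m0 /=.
    by have := existsPn no m; rewrite negb_and m0 negbK.
  exists 1%R; last by rewrite inE oner_neq0 expg1.
  rewrite inE oner_neq0 /=.
  by have := existsPn no 1%R; rewrite negb_and oner_neq0 negbK.
by rewrite (uniform u1 w1) ltnn.
Qed.

Lemma line_map_affine u (y : {perm gT}) (s : F -> F) : u != 1 -> y \in A ->
  (forall i : F, y (u ^+ i) = u ^+ s i) ->
  exists c, forall i, s i = (c * i + s 0)%R.
Proof.
move=> u1 Ay ys; have expI : injective (fun i : F => u ^+ i).
  move=> i j /= E; apply/eqP; rewrite -subr_eq0; apply: contraTT isT => ij.
  have := expgF_neq1 u1 ij; suff -> : u ^+ (i - j)%R = 1 by rewrite eqxx.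
  by apply: (mulIg (u ^+ j)); rewrite -(expgFD p_pr expp) subrK mul1g E.
have sI : injective s.
  by move=> i j E; apply: expI; apply: (@perm_inj _ y); rewrite !ys E.
have [v [v' [v0 v'0 Sv Sv']]] := uniform_line_proper u1.
apply: (small_set_affine p_pr (T := fun i => u ^+ i \in S) sI); last first.
  by exists v, v'.
move=> m i j m0; have := schur_preserve mulC (elimT (digraph_aut_cayleyP _ _) Ay)
  (F_coprime p_pr cardG m0) (u ^+ j) (u ^+ i).
have E (a b : F) : (u ^+ b)^-1 * u ^+ a = u ^+ (a - b)%R.
  by apply: (mulgI (u ^+ b)); rewrite mulKVg -(expgFD p_pr expp) addrC subrK.
by rewrite !ys !E -!(expgFM p_pr expp).
Qed.

(** Comparing a moved point with the fixed points of [<[u]>] subjects any such automorphism to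
    [mean_shift], with one constant [z0] for all. The diagonal [k] with [c] different from 1 shows
    [z0 = 0], so [g] preserves the cosets of [<[t]>]. *)
Lemma fix_line_norm u t (c : F) (k g : {perm gT}) : t != 1 -> u \notin <[t]> ->
  k \in A -> k 1 = 1 -> k \in 'N(P) -> k u = u -> k t = t ^+ c -> c != 1%R ->
  g \in A -> (forall i : F, g (u ^+ i) = u ^+ i) -> g \in 'N(P).
Proof.
move=> t1 ut Ak k1 Nk ku kt c1 Ag gu.
pose cd := @to_coord p gT u t; pose oc := @of_coord p gT u t.
have cdK : cancel cd oc := coordK p_pr cardG expp t1 ut.
have ocK : cancel oc cd := of_coordK p_pr cardG expp t1 ut.
have ocI : injective oc := can_inj ocK.
have ocu (i : F) : u ^+ i = oc (i, 0%R) by rewrite /oc /of_coord /= mulg1.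
have [z0 Hz0] := mean_shift p_pr (coset_split_swap p_pr cardG expp irregular t1 ut).
have key (h : {perm gT}) a b a' b' : h \in A -> (forall i : F, h (u ^+ i) = u ^+ i) ->
    h (oc (a, b)) = oc (a', b') -> b != 0%R -> b' != 0%R ->
    ((a' - a) / b = (b' / b - 1) * z0)%R.
  move=> Ah hu hab b0 b'0; apply: Hz0 => [|x z x0]; first by rewrite mulf_neq0 ?invr_eq0.
  have m0 : (x / b != 0)%R by rewrite mulf_neq0 ?invr_eq0.
  have := coord_set_aut p_pr cardG expp t1 ut (oc (a - z * b / x, 0)%R) (oc (a, b)) Ah m0.
  rewrite -/cd hab -!ocu hu ocu !ocK /= !subr0 => E.
  move: E; rewrite !scale_slope_sub // subrr !mul0r addr0 mulfVK // => <-.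
  congr (coord_set _ _ _ _ _).
  by rewrite mulrAC [RHS]mulrAC (mulrC x).
have kM := norm_fix1_morph Nk k1; have kX := autX kM.
have kuX (i : F) : k (u ^+ i) = u ^+ i by rewrite kX ku.
have c0 : c != 0%R.
  apply: contraNneq t1 => c0; apply/eqP/(@perm_inj _ k).
  by rewrite kt c0 expg0 k1.
have z00 : z0 = 0%R.
  have kt1 : k (oc (0%R, 1%R)) = oc (0%R, c) by rewrite /oc /of_coord /= !mul1g expg1.
  have := key k _ _ _ _ Ak kuX kt1 (oner_neq0 _) c0.
  rewrite subrr mul0r divr1 => /esym/eqP; rewrite mulf_eq0 subr_eq0 (negPf c1).
  by move=> /eqP.
apply: (coset_preserving_norm p_pr cardG expp t1 ut irregular TI Ag) => x.
rewrite (mem_cycle_coord p_pr cardG expp t1 ut) -[x]cdK -[g _]cdK.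
rewrite -(of_coordB p_pr cardG expp) -/oc -/cd ocK /= cdK subr_eq0.
case Ex: (cd x) => [a b]; case Eg: (cd (g x)) => [a' b'] /=.
have gab : g (oc (a, b)) = oc (a', b') by rewrite -Ex -Eg !cdK.
have [b0|b0] := eqVneq b 0%R.
  by move: gab; rewrite b0 -ocu gu ocu => /ocI/(congr1 fst) /= ->.
have b'0 : b' != 0%R.
  apply: contraNneq b0 => b'0; move: gab; rewrite b'0 -ocu -gu => /perm_inj.
  by rewrite ocu => /ocI/(congr1 snd) /= ->.
have /eqP := key g _ _ _ _ Ag gu gab b0 b'0; rewrite z00 mulr0 mulf_eq0 invr_eq0 (negPf b0) orbF.
by rewrite subr_eq0.
Qed.

(* A translation of P :^ x commuting with k acts on the line <[u]> fixed by k as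
   an affine map, hence as a translation; correcting it by an element of P gives
   an automorphism fixing this line pointwise, which normalizes P. *)
Lemma uniform_fixed_points (k x : {perm gT}) : k \in A -> x \in A -> k 1 = 1 ->
  k \in 'N(P) -> k \in 'N(P :^ x) -> P :^ x != P -> k != 1 ->
  forall u, k u = u -> u = 1.
Proof.
move=> Ak Ax k1 Nk Nkx neq kn1 u ku; apply/eqP; apply: contraNT neq => u1.
have [t [c [t1 ut c1 kt]]] := fixed_points_basis Ak k1 Nk kn1 u1 ku.
have kM := norm_fix1_morph Nk k1; have kX := autX kM.
(* The conjugate of [k] by [x^-1] is affine and fixes [z] and [x^-1 u = v * z], so it commutes with
   [translation v]. Thus [k] commutes with [y], which sends 1 to [u]. *)
pose z := x^-1 1; pose v := x^-1 u * z^-1.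
have v1 : v != 1.
  by rewrite -eq_mulgV1 /z (inj_eq perm_inj).
pose y := translation v ^ x.
have Py : y \in P :^ x by rewrite memJ_conjg mem_translation.
have Ay : y \in A by rewrite groupJ // (subsetP (PA S)) ?mem_translation.
have Nk' : k ^ x^-1 \in 'N(P) by rewrite -mem_conjg -normJ.
have k'z : (k ^ x^-1) z = z by rewrite conjgE !permM invgK permKV k1.
have k'vz : (k ^ x^-1) (v * z) = v * z.
  by rewrite /v mulgKV conjgE !permM invgK permKV ku.
have k'v w : (k ^ x^-1) (v * w) = v * (k ^ x^-1) w.
  have /norm_left_regularP aff := Nk'; rewrite aff; congr (_ * _).
  by apply: (mulIg z); have := k'vz; rewrite aff k'z.
have yk w : k (y w) = y (k w).
  rewrite /y !conjgE !permM !translationE.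
  apply: (@perm_inj _ x^-1); rewrite permK.
  have := k'v (x^-1 w); rewrite !conjgE !permM !invgK.
  by rewrite permKV.
pose cd := @to_coord p gT u t; pose oc := @of_coord p gT u t.
have cdK : cancel cd oc := coordK p_pr cardG expp t1 ut.
have ocK : cancel oc cd := of_coordK p_pr cardG expp t1 ut.
have ocI : injective oc := can_inj ocK.
have ocu (i : F) : u ^+ i = oc (i, 0%R) by rewrite /oc /of_coord /= mulg1.
have fixk w : k w = w -> w = u ^+ (cd w).1.
  move=> kw; rewrite ocu -{1}[w]cdK; congr oc; rewrite [LHS]surjective_pairing.
  congr (_, _); move: kw; rewrite -[w]cdK; case: (cd w) => a b /=.
  have -> : k (oc (a, b)) = oc (a, c * b)%R.
    rewrite -[LHS]/(k (u ^+ a * t ^+ b)) -[RHS]/(u ^+ a * t ^+ (c * b)%R).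
    by rewrite kM !kX ku kt [(c * b)%R]mulrC (expgFM p_pr expp).
  move/ocI/(congr1 snd) => /= E; rewrite ocK /=.
  have : ((c - 1) * b = 0)%R by rewrite mulrBl mul1r E subrr.
  by move/eqP; rewrite mulf_eq0 subr_eq0 (negPf c1) => /eqP.
pose s (i : F) := (cd (y (u ^+ i))).1.
have ys (i : F) : y (u ^+ i) = u ^+ s i by apply: fixk; rewrite yk kX ku.
have [c' Hs] := line_map_affine u1 Ay ys.
(* An affine map of the line with slope other than 1 has a fixed point, whereas [y] is conjugate to
   a translation without fixed points. *)
have c'1 : c' = 1%R.
  apply/eqP; apply: contraNT v1 => c'1.
  pose i0 := (s 0 / (1 - c'))%R.
  have c'0 : (1 - c' != 0)%R by rewrite subr_eq0 eq_sym.
  have yi0 : y (u ^+ i0) = u ^+ i0.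
    have E0 : ((1 - c') * i0 = s 0)%R by rewrite /i0 mulrC mulfVK.
    by rewrite ys Hs -E0; congr (u ^+ nat_of_ord _); ring.
  move: yi0; rewrite /y conjgE !permM translationE => /(canRL (permK x)).
  by rewrite -{2}[x^-1 _]mul1g => /mulIg ->.
pose g := y * translation (u ^+ s 0%R)^-1.
have Ag : g \in A by rewrite groupM // (subsetP (PA S)) ?mem_translation.
have gu (i : F) : g (u ^+ i) = u ^+ i.
  rewrite permM translationE ys [s i]Hs c'1 mul1r (expgFD p_pr expp).
  by rewrite (mulC (u ^+ i)) mulKg.
have Ng := fix_line_norm t1 ut Ak k1 Nk ku kt c1 Ag gu.
have Ny : y \in 'N(P).
  rewrite -(mulgK (translation (u ^+ s 0%R)^-1) y) groupM // groupV.
  by rewrite (subsetP (normG P)) ?mem_translation.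
have py : p.-elt y.
  by rewrite /p_elt orderJ; apply: (mem_p_elt (p_group_left_regular p_pr cardG)); apply: mem_translation.
have [w Ew] := left_regularP _ (p_elt_norm1 p_pr cardG irregular Ay py Ny).
apply/eqP; apply: (TI_conj p_pr cardG irregular TI Ax (u := w)); last by rewrite -Ew.
apply: contra v1 => /eqP w1; move/eqP: Ew; rewrite w1 translation1 conjg_eq1.
by rewrite -translation1 (inj_eq (@translation_inj gT)).
Qed.

End LineCounts.

Theorem elementary_TI_normal p (gT : finGroupType) (S : {set gT}) :
  prime p -> #|gT| = (p ^ 2)%N -> (forall x : gT, x ^+ p = 1) -> 1 \notin S ->
  (forall H : {group gT}, #|H| = p -> ~ coset_regular S H) ->
  (forall u, u != 1 ->
     'C_(digraph_aut (cayley S))[translation u] \subset 'N(left_regular gT)) ->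
  normal_cayley S.
Proof.
move=> p_pr cardG expp S1 irr TI.
have [/existsP[d /existsP[w /and3P[d1 w1 dw]]]|no] := boolP
    [exists d : gT, exists w : gT, [&& d != 1, w != 1 & line_count p S d != line_count p S w]].
  exact: (normal_of_line_count p_pr cardG expp irr TI d1 w1 dw).
have uniform d w : d != 1 -> w != 1 -> line_count p S d = line_count p S w.
  move=> d1 w1; apply/eqP/negPn/negP => dw; case/negP: no.
  by apply/existsP; exists d; apply/existsP; exists w; rewrite d1 w1.
apply: (normal_of_fixed_points p_pr cardG irr S1 TI) => k x Ak Ax k1 Nk Nkx neq kn1.
exact: (uniform_fixed_points p_pr cardG expp irr TI S1 uniform Ak Ax k1 Nk Nkx neq kn1).
Qed.

Lemma stab1_norm (gT : finGroupType) (Y : {group {perm gT}}) (g : {perm gT}) :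
  left_regular gT \subset Y -> g \in Y -> exists2 h, h \in Y & h 1 = 1 /\
    exists a, g = h * translation a.
Proof.
move=> /subsetP PY Yg; exists (g * translation (g 1)^-1).
  by rewrite groupM // PY // mem_translation.
split; first by rewrite permM translationE mulVg.
exists (g 1); apply/permP => x; rewrite !permM !translationE mulKVg //.
Qed.

Theorem nonnormal_structure p (gT : finGroupType) (S : {set gT}) :
  prime p -> #|gT| = (p ^ 2)%N -> 1 \notin S -> ~~ normal_cayley S ->
  (exists H : {group gT}, #|H| = p /\ coset_regular S H) \/
  [/\ 5 <= p, (forall x : gT, x ^+ p = 1),
      (forall H : {group gT}, #|H| = p -> ~ coset_regular S H) &
      exists u t : gT, [/\ u != 1, t \notin <[u]> &
        forall z i j : 'F_p, i != 0%R -> j != 0%R ->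
          (u ^+ z * t ^+ i \in S) = (u ^+ z * t ^+ j \in S)]].
Proof.
move=> p_pr cardG S1 nn.
pose creg (H : {group gT}) :=
  (#|H| == p) && [forall a, forall h, (a \notin H) && (h \in H) ==> ((a * h \in S) == (a \in S))].
have [/existsP[H /andP[/eqP cH /forallP Hreg]]|/existsPn noH] := boolP [exists H, creg H].
  left; exists H; split=> // a h Ha Hh; apply/eqP.
  by have /forallP/(_ h) := Hreg a; rewrite Ha Hh.
right; have irr (H : {group gT}) : #|H| = p -> ~ coset_regular S H.
  move=> cH Hreg; have := noH H; rewrite /creg cH eqxx /= => /negP[].
  apply/forallP => a; apply/forallP => h; apply/implyP => /andP[Ha Hh].
  by rewrite Hreg.
have expp (x : gT) : x ^+ p = 1.
  apply/eqP; apply: contraNT nn => xp.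
  apply: (cyclic_normal_cayley p_pr cardG _ S1 irr).
  have : #[x] %| p ^ 2 by rewrite -cardG -cardsT order_dvdG ?in_setT.
  case/(dvdn_pfactor _ _ p_pr) => m m2 ox.
  have m_eq2 : m = 2.
    apply/eqP; rewrite eqn_leq m2 ltnNge; apply: contra xp => m1.
    by rewrite -order_dvdn ox -{2}(expn1 p) dvdn_exp2l.
  apply/cyclicP; exists x; apply/eqP; rewrite eq_sym eqEcard subsetT cardsT cardG -orderE ox m_eq2.
  by rewrite leqnn.
pose ti (u : gT) := (u != 1) ==>
  ('C_(digraph_aut (cayley S))[translation u] \subset 'N(left_regular gT)).
have [/forallP TI|] := boolP [forall u, ti u].
  case/negP: nn; apply: (elementary_TI_normal p_pr cardG expp S1 irr) => u u1.
  by have := TI u; rewrite /ti u1.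
rewrite negb_forall => /existsP[u]; rewrite negb_imply => /andP[u1 /subsetPn[g Cg Ng]].
have PC : left_regular gT \subset 'C_(digraph_aut_group (cayley S))[translation u]%G.
  apply/subsetP => _ /left_regularP[a ->]; rewrite inE.
  rewrite (subsetP (left_regular_sub_aut S)) ?mem_translation //=.
  apply/cent1P; rewrite /commute !translationM; congr translation.
  exact: mulgC_p2 p_pr cardG _ _.
(* The group is abelian, so translations lie in the centralizer and the witness can be corrected to
   fix 1 without leaving it. *)
have [h /setIP[Ah Ch] [h1 [a Eg]]] := stab1_norm PC Cg.
have [Nh|[p5 [t tu Ht]]] := cent_translation_dichotomy p_pr cardG expp irr u1 Ah h1 Ch.
  by case/negP: Ng; rewrite Eg groupM // (subsetP (normG (left_regular_group gT))) ?mem_translation.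
by split=> //; exists u, t.
Qed.

(** * Nonnormality of the listed digraphs *)

(** For an affine [g] fixing [x0], the elements [a] with [g (a * y) = a * g y] form a subgroup whose
    translate by [x0] contains all fixed points. A subgroup of more than half the order is
    everything, and then [g = 1]. *)
Lemma nonnormal_of_many_fixed_points (gT : finGroupType) (S : {set gT}) (g : {perm gT}) :
  g \in digraph_aut (cayley S) -> g != 1 -> #|gT| < (nb_fix g).*2 -> ~~ normal_cayley S.
Proof.
move=> Ag g1 big; apply: contra g1 => /andP[_ /subsetP/(_ g Ag)/norm_left_regularP aff].
have [x0 gx0] : exists x0, g x0 = x0.
  have : 0 < nb_fix g by case: (nb_fix g) big.
  by rewrite card_gt0 => /set0Pn[x0]; rewrite inE => /eqP; exists x0.
pose B := [set a | [forall y, g (a * y) == a * g y]].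
have BP a : reflect (forall y, g (a * y) = a * g y) (a \in B).
  by rewrite inE; apply: (iffP forallP) => H y; apply/eqP.
have gB : group_set B.
  apply/group_setP; split=> [|a b /BP Ha /BP Hb]; apply/BP => y; first by rewrite !mul1g.
  by rewrite -!mulgA Ha Hb.
have fixB : [set v | g v == v] \subset [set a * x0 | a in B].
  apply/subsetP => v; rewrite inE => /eqP gv; apply/imsetP; exists (v * x0^-1).
    apply/BP => y; rewrite aff; congr (_ * _); apply: (mulIg x0).
    by rewrite -{2}gx0 -aff mulgKV.
  by rewrite mulgKV.
have cB : nb_fix g <= #|group gB|.
  by rewrite (leq_trans (subset_leq_card fixB)) // card_imset //; apply: mulIg.
have BT : B = setT.
  apply/eqP; have := Lagrange (subsetT (group gB)); rewrite cardsT => E.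
  rewrite eqEcard subsetT cardsT /= -E; have : #|[set: gT] : group gB| < 2.
    rewrite ltnNge; apply/negP => i2; move: big cB i2; rewrite -E -muln2.
    move: #|group gB| #|[set: gT] : group gB| (nb_fix g) => b i n; nia.
  by case: #|_ : _| => [|[|]] //; rewrite ?muln1 ?muln0.
apply/eqP/permP => v; rewrite perm1 -[v](mulgKV x0).
by have /BP -> : v * x0^-1 \in B; rewrite ?BT ?in_setT // gx0.
Qed.

Lemma digraph_iso_sym (T1 T2 : finType) (e1 : rel T1) (e2 : rel T2) :
  digraph_iso e1 e2 -> digraph_iso e2 e1.
Proof.
case=> f [f' fK f'K] fe; exists f'; first by exists f.
by move=> x y; rewrite -fe !f'K.
Qed.

Lemma nonnormal_of_iso (gT : finGroupType) (S : {set gT}) (T : finType) (e : rel T)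
    (phi : T -> T) :
  digraph_iso (cayley S) e -> injective phi ->
  (forall x y, e (phi x) (phi y) = e x y) -> (exists x, phi x != x) ->
  #|T| < #|[set x | phi x == x]|.*2 -> ~~ normal_cayley S.
Proof.
case=> f [f' fK f'K] fe phiI phie [x0 phix0] big.
have gI : injective (fun x => f' (phi (f x))).
  by move=> x y /(can_inj f'K)/phiI/(can_inj fK).
have cT : #|gT| = #|T| by apply: bij_eq_card; exists f'.
have cfix : nb_fix (perm gI) = #|[set x | phi x == x]|.
  rewrite /nb_fix -(card_imset _ (can_inj f'K)); apply: eq_card => x.
  rewrite inE permE; apply/eqP/imsetP => [E|[y]].
    by exists (f x); rewrite ?fK // inE -{2}[f x]f'K -(inj_eq (can_inj f'K)) f'K E fK.
  by rewrite inE => /eqP E ->; rewrite f'K E.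
apply: (@nonnormal_of_many_fixed_points _ _ (perm gI)); last by rewrite cfix cT.
  apply/digraph_aut_cayleyP => x y; rewrite !permE -!/(cayley S _ _) -!fe !f'K.
  exact: phie.
apply: contra phix0 => /eqP/permP/(_ (f' x0)).
by rewrite permE perm1 f'K => /(can_inj f'K)->.
Qed.

Lemma tperm_fixed_card (T : finType) (a b : T) : a != b ->
  #|[set x | tperm a b x == x]| = #|T|.-2.
Proof.
move=> ab; have -> : [set x | tperm a b x == x] = ~: [set a; b].
  apply/setP => x; rewrite !inE; case: tpermP => [->|->|/eqP xa /eqP xb].
  - by rewrite eq_sym (negPf ab) eqxx.
  - by rewrite (negPf ab) eqxx orbT.
  by rewrite eqxx (negPf xa) (negPf xb).
by have := cardsC [set a; b]; rewrite cards2 ab; lia.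
Qed.

Lemma complete_nonnormal (gT : finGroupType) (S : {set gT}) (T : finType) :
  4 < #|T| -> digraph_iso (cayley S) (@complete_digraph T) -> ~~ normal_cayley S.
Proof.
move=> T4 iso; have /card_gt1P[a [b [_ _ ab]]] : 1 < #|T| by lia.
apply: (nonnormal_of_iso iso (@perm_inj _ (tperm a b))).
- by move=> x y; rewrite /complete_digraph (inj_eq perm_inj).
- by exists a; rewrite tpermL eq_sym.
by rewrite tperm_fixed_card //; lia.
Qed.

Lemma card_prime_Zp p : prime p -> #|'Z_p| = p.
Proof. by move=> p_pr; rewrite card_ord Zp_cast // prime_gt1. Qed.

(** Rotating the single fibre over [x0] moves only one fibre out of at least three. *)
Lemma wreath_nonnormal p (gT : finGroupType) (S : {set gT}) (T1 : finType) (S2 : {set 'Z_p})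
    (e1 : rel T1) (x0 : T1) :
  prime p -> 2 < #|T1| -> digraph_iso (cayley S) (wreath e1 (cayley S2)) ->
  ~~ normal_cayley S.
Proof.
move=> p_pr p3 iso.
pose phi (v : T1 * 'Z_p) := (v.1, if v.1 == x0 then v.2 + 1 else v.2)%R.
have one0 : (1%R : 'Z_p) != 0%R by rewrite oner_neq0.
apply: (nonnormal_of_iso (phi := phi) iso).
- move=> [a b] [a' b']; rewrite /phi /= => E.
  have Ea : a = a' := congr1 fst E; have := congr1 snd E; rewrite /= -Ea.
  by case: ifP => _ => [/addIr|] ->.
- move=> [a b] [a' b']; rewrite /wreath /phi /=; have [->|//] := eqVneq a a'.
  case: ifP => // _; congr (_ || _); rewrite /cayley; congr (_ \in S2).
  by rewrite -[LHS]/(- (b + 1) + (b' + 1))%R -[RHS]/(- b + b')%R; ring.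
- exists (x0, 0)%R; rewrite /phi /= eqxx; apply: contra one0 => /eqP/(congr1 snd) /=.
  by rewrite add0r => ->.
have -> : [set v | phi v == v] = setX [set~ x0] setT.
  apply/setP => -[a b]; rewrite !inE /phi /= andbT -pair_eqE /= eqxx /=.
  by case: ifP => _; rewrite ?eqxx // -subr_eq0 addrC addKr (negPf one0).
by rewrite cardsX cardsC1 cardsT card_prod card_prime_Zp // -muln2; have := prime_gt0 p_pr; nia.
Qed.

(** One transposition applied to the second coordinate in all columns at once fixes [p - 2] points
    per column, more than half as soon as [p > 4]. *)
Lemma column_nonnormal p (gT : finGroupType) (S : {set gT}) (T1 : finType)
    (e : rel (T1 * 'Z_p)) : prime p -> 4 < p -> 0 < #|T1| ->
  (forall a a' (s : {perm 'Z_p}) b b', e (a, s b) (a', s b') = e (a, b) (a', b')) ->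
  digraph_iso (cayley S) e -> ~~ normal_cayley S.
Proof.
move=> p_pr p5 T0 He iso; have one0 : (0%R : 'Z_p) != 1%R by rewrite eq_sym oner_neq0.
pose s := tperm (0%R : 'Z_p) 1%R; pose phi (v : T1 * 'Z_p) := (v.1, s v.2).
apply: (nonnormal_of_iso (phi := phi) iso).
- move=> [a b] [a' b'] E; have Ea : a = a' := congr1 fst E.
  by have /perm_inj Eb : s b = s b' := congr1 snd E; rewrite Ea Eb.
- by move=> [a b] [a' b']; apply: He.
- have /card_gt0P[a _] := T0; exists (a, 0)%R.
  apply: contra one0 => /eqP/(congr1 snd) /=; rewrite tpermL => E.
  by rewrite eq_sym; apply/eqP.
have -> : [set v | phi v == v] = setX setT [set b | s b == b].
  by apply/setP => -[a b]; rewrite !inE /phi /= -pair_eqE /= eqxx.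
by rewrite cardsX cardsT tperm_fixed_card // card_prod card_prime_Zp // -muln2; nia.
Qed.

Lemma cayley_column_invariant p (S' : {set 'Z_p * 'Z_p}) :
  (forall a b b', b != 0%R -> b' != 0%R -> ((a, b) \in S') = ((a, b') \in S')) ->
  forall a a' (s : {perm 'Z_p}) b b',
    cayley S' (a, s b) (a', s b') = cayley S' (a, b) (a', b').
Proof.
move=> H a a' s b b'; rewrite /cayley.
rewrite -[_^-1 * _ in LHS]/((- a + a')%R, (- s b + s b')%R).
rewrite -[_^-1 * _ in RHS]/((- a + a')%R, (- b + b')%R).
have [->|neq] := eqVneq b b'; first by rewrite !addNr.
by apply: H; rewrite addrC subr_eq0 ?(inj_eq perm_inj) eq_sym.
Qed.

Lemma axes_column p (a b b' : 'Z_p) : b != 0%R -> b' != 0%R ->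
  ((a, b) \in axes p) = ((a, b') \in axes p).
Proof.
have E (c : 'Z_p) : c != 0%R -> ((a, c) \in axes p) = (a == 0)%R.
  move=> c0; rewrite !inE -pair_eqE /= negb_and c0 orbT /=.
  apply/orP/eqP => [[/imsetP[i _ [_ E]]|/imsetP[j _ [-> //]]]|->].
    by rewrite E eqxx in c0.
  by right; apply: imset_f.
by move=> b0 b'0; rewrite !E.
Qed.

(** The four patterns are precisely the subsets of a coset that do not separate the points other
    than [(a, 0)]; this is the form in which type (4) is used. *)
Lemma four_types_column p (S' : {set 'Z_p * 'Z_p}) :
  let H := vertical_axis p in
  H :&: S' = set0 \/ H :&: S' = H :\ (0%R, 0%R) ->
  (forall a : 'Z_p, let a0 : 'Z_p * 'Z_p := (a, 0%R) in let aH := a0 *: H in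
     aH <> H -> [\/ aH :&: S' = aH, aH :&: S' = set0, aH :&: S' = [set a0] |
                 aH :&: S' = aH :\ a0]) ->
  forall a b b', b != 0%R -> b' != 0%R -> ((a, b) \in S') = ((a, b') \in S').
Proof.
move=> H HS aHS a; suff [c Hc] : exists c, forall b, b != 0%R -> ((a, b) \in S') = c.
  by move=> b b' b0 b'0; rewrite !Hc.
have memaH (b : 'Z_p) : (a, b) \in ((a, 0%R) : 'Z_p * 'Z_p) *: H.
  rewrite mem_lcoset -[_ * _]/((- a + a)%R, (- 0 + b)%R) addNr oppr0 add0r.
  exact: imset_f.
have IS (X : {set 'Z_p * 'Z_p}) b : (a, b) \in X -> ((a, b) \in S') = ((a, b) \in X :&: S').
  by move=> Xb; rewrite inE Xb.
have b0E (b : 'Z_p) : ((a, b) == (a, 0%R)) = (b == 0%R) by rewrite -pair_eqE /= eqxx.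
have [a0|a0] := eqVneq a 0%R.
  have HbH (b : 'Z_p) : (a, b) \in H by rewrite a0; apply: imset_f.
  case: HS => E.
    by exists false => b b0; rewrite (IS H) // E inE.
  exists true => b b0; rewrite (IS H) // E !inE HbH andbT.
  by rewrite -pair_eqE /= negb_and b0 orbT.
have neq : ((a, 0%R) : 'Z_p * 'Z_p) *: H <> H.
  move=> E; have := memaH 0%R; rewrite E => /imsetP[i _ [E' _]].
  by rewrite E' eqxx in a0.
case: (aHS a neq) => E; [exists true|exists false|exists false|exists true] => b b0;
  rewrite (IS _ _ (memaH b)) E.
- exact: memaH.
- by rewrite inE.
- by rewrite inE b0E (negPf b0).
by rewrite !inE b0E b0 memaH.
Qed.

(** * From the connection set to the list *)

Lemma expgZpD p (gT : finGroupType) (x : gT) (a b : 'Z_p) : 1 < p -> x ^+ p = 1 ->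
  x ^+ (a + b)%R = x ^+ a * x ^+ b.
Proof. by move=> p1 xp; rewrite -expgD /= (expg_mod _ _) // Zp_cast. Qed.

Lemma Zp_dvdn_eq0 p (c : 'Z_p) : 1 < p -> p %| c -> c = 0%R.
Proof.
move=> p1 /dvdnP[k Ek]; apply/val_inj => /=.
have := ltn_ord c; rewrite {2}Zp_cast // Ek -{2}(mul1n p) ltn_pmul2r; last by lia.
by rewrite ltnS leqn0 => /eqP->.
Qed.

(** Write vertices as [x ^+ a * y ^+ b] with [x] outside [H] and [y] generating [H]. Powers of [x]
    add up only modulo [H] when [x ^+ p] is not 1, but off [H] the set [S] does not see [H], so
    cyclic and elementary groups are treated alike. *)
Lemma wreath_of_coset_regular p (gT : finGroupType) (S : {set gT}) (H : {group gT}) :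
  prime p -> #|gT| = (p ^ 2)%N -> #|H| = p -> coset_regular S H -> 1 \notin S ->
  exists S1 S2 : {set 'Z_p}, [/\ 1 \notin S1, 1 \notin S2 &
    digraph_iso (cayley S) (wreath (cayley S1) (cayley S2))].
Proof.
move=> p_pr cardG cH Hreg S1; have p1 := prime_gt1 p_pr.
have mulC := mulgC_p2 p_pr cardG.
have nsH : H <| [set: gT].
  by rewrite -sub_abelian_normal ?subsetT //; apply/centsP => x _ y _; apply: mulC.
have Nx (x : gT) : x \in 'N(H) by apply: (subsetP (normal_norm nsH)); apply: in_setT.
have cQ : #|[set: gT] / H| = p.
  by rewrite card_quotient ?normal_norm // -divgS ?subsetT // cH cardsT cardG -mulnn mulnK // prime_gt0.
have [x Hx] : exists x, x \notin H.
  apply/existsP; rewrite -negb_forall; apply/negP => /forallP all_in.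
  have : #|gT| <= #|H| by rewrite -cardsT subset_leq_card //; apply/subsetP.
  by rewrite cH cardG -mulnn; nia.
have oxb : #[coset H x] = p.
  have : #[coset H x] %| p by rewrite -cQ order_dvdG // mem_quotient ?in_setT.
  case/primeP: p_pr => _ Hp /Hp; rewrite order_eq1 => /orP[/eqP xb|/eqP//].
  by rewrite (coset_idr (Nx x) xb) in Hx.
have xH n : (x ^+ n \in H) = (p %| n).
  rewrite -oxb order_dvdn -morphX ?Nx //; apply/idP/eqP => [/coset_id//|].
  by move/(coset_idr (Nx _)).
have xpH : x ^+ p \in H by rewrite xH.
have [y oy] : exists y, #[y] = p /\ <[y]> = H.
  have /cyclicP[y Hy] : cyclic H by rewrite prime_cyclic ?cH.
  by exists y; rewrite orderE -Hy cH.
case: oy => oy cy; have yp : y ^+ p = 1 by rewrite -oy expg_order.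
have Hy : y \in H by rewrite -cy cycle_id.
pose psi (c : 'Z_p * 'Z_p) := x ^+ c.1 * y ^+ c.2.
have xD (a b : 'Z_p) : exists2 h, h \in H & x ^+ a * x ^+ b = x ^+ (a + b)%R * h.
  exists ((x ^+ p) ^+ ((a + b) %/ p)); first by rewrite groupX.
  have Em : nat_of_ord (a + b)%R = (a + b)%N %% p by congr (_ %% _)%N; apply: Zp_cast.
  by rewrite -expgD -expgM Em {1}(divn_eq (a + b) p) addnC expgD mulnC.
have diffE (a b a' b' : 'Z_p) : exists2 h, h \in H &
    (psi (a, b))^-1 * psi (a', b') = x ^+ (a' - a)%R * h /\
    (a' = a -> h = y ^+ (b' - b)%R).
  have [h Hh Eh] := xD (a' - a)%R a.
  exists (h^-1 * y ^+ (b' - b)%R); first by rewrite groupM ?groupV ?groupX.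
  have E1 : x ^+ a' = x ^+ (a' - a)%R * x ^+ a * h^-1.
    by rewrite Eh subrK mulgK.
  have E2 : y ^+ b' = y ^+ (b' - b)%R * y ^+ b by rewrite -expgZpD // subrK.
  split; last first.
    move=> Ea; suff -> : h = 1 by rewrite invg1 mul1g.
    by move: Eh; rewrite Ea subrr expg0 mul1g add0r -{1}[x ^+ a]mulg1 => /mulgI.
  have CA A B C : A * (B * C) = B * (A * C) :> gT by rewrite !mulgA (mulC A).
  apply: (mulgI (psi (a, b))); rewrite mulKVg /psi /= E1 E2 -!mulgA.
  by rewrite CA (mulC (y ^+ _)) (CA h^-1) (CA (x ^+ (a' - a)%R) (y ^+ b)).
have psiI : injective psi.
  move=> [a b] [a' b'] E; have [h Hh [Eh hE]] := diffE a b a' b'.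
  move: Eh; rewrite -E mulVg => /esym E1.
  have a0 : a' = a.
    apply/eqP; rewrite -subr_eq0; have : x ^+ (a' - a)%R \in H.
      by rewrite (canRL (mulgK _) E1) mul1g groupV.
    by rewrite xH => /(Zp_dvdn_eq0 p1)->.
  move: E1; rewrite (hE a0) a0 subrr expg0 mul1g => /eqP; rewrite -order_dvdn oy => /(Zp_dvdn_eq0 p1) => /eqP.
  by rewrite subr_eq0 => /eqP->.
pose S1' := [set i : 'Z_p | (i != 0%R) && (x ^+ i \in S)].
pose S2' := [set j : 'Z_p | y ^+ j \in S].
exists S1', S2'; split; [by rewrite inE eqxx | by rewrite inE expg0|].
apply: digraph_iso_sym; exists psi.
  by apply: inj_card_bij psiI _; rewrite cardG card_prod card_prime_Zp // mulnn.
move=> [a b] [a' b']; rewrite /wreath /=; have [h Hh [Eh hE]] := diffE a b a' b'.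
rewrite -[LHS]/((psi (a, b))^-1 * psi (a', b') \in S) Eh /cayley.
rewrite -[a^-1 * a']/(- a + a')%R -[b^-1 * b']/(- b + b')%R !inE.
have [Ea|Ea] := eqVneq a a'.
  by rewrite (hE (esym Ea)) Ea subrr addNr eqxx expg0 mul1g addrC.
rewrite (addrC (- a)%R) subr_eq0 eq_sym Ea orbF /=; apply: Hreg => //.
rewrite xH; apply/negP => pa; have /eqP := @Zp_dvdn_eq0 p (a' - a)%R p1 pa.
by rewrite subr_eq0 eq_sym (negPf Ea).
Qed.

(** A cyclic representation would give an automorphism [r] of p-power order with [r ^+ p] different
    from 1, whereas by Sylow [r] is conjugate into [P], which has exponent [p]. *)
Lemma not_cayley_cyclic p (gT : finGroupType) (S : {set gT}) :
  prime p -> #|gT| = (p ^ 2)%N -> (forall x : gT, x ^+ p = 1) ->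
  (forall H : {group gT}, #|H| = p -> ~ coset_regular S H) ->
  ~ cayley_digraph_of 'Z_(p ^ 2) (cayley S).
Proof.
move=> p_pr cardG expp irr [S0 _ [f [f' fK f'K] fe]].
have p1 := prime_gt1 p_pr; have pp1 : 1 < p ^ 2 by rewrite -mulnn; nia.
have rI : injective (fun x => f' (1 + f x)%R).
  by move=> x y /(can_inj f'K)/addrI/(can_inj fK).
pose r := perm rI.
have rX n x : (r ^+ n) x = f' (n%:R + f x)%R.
  elim: n => [|n IHn]; first by rewrite perm1 add0r fK.
  by rewrite expgSr permM IHn permE f'K addrA -natr1 (addrC 1%R).
have Ar : r \in digraph_aut_group (cayley S).
  apply/digraph_aut_cayleyP => x y; rewrite -!/(cayley S _ _) -!fe !permE !f'K.
  rewrite /cayley -[_^-1 * _ in LHS]/(- (1 + f x) + (1 + f y))%R.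
  by rewrite -[_^-1 * _ in RHS]/(- f x + f y)%R; congr (_ \in S0); ring.
have rpp : r ^+ (p ^ 2) = 1.
  by apply/permP => x; rewrite rX perm1 pchar_Zp // add0r fK.
have pr : p.-group <[r]>.
  have [m _ om] := dvdn_pfactor _ 2 p_pr (etrans (order_dvdn r (p ^ 2)) (introT eqP rpp)).
  by rewrite /pgroup -orderE om pnatX pnat_id.
have sr : <[r]> \subset digraph_aut_group (cayley S) by rewrite cycle_subG.
have [Q sylQ rQ] := Sylow_superset sr pr.
have [x _ EQ] := Sylow_trans (sylow_left_regular p_pr cardG irr) sylQ.
have : r \in left_regular_group gT :^ x by rewrite -EQ -cycle_subG.
case/imsetP=> _ /left_regularP[a ->] Er.
have rp : r ^+ p = 1 by rewrite Er -conjXg translationX expp translation1 conj1g.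
have : (p%:R = 0 :> 'Z_(p ^ 2))%R.
  have := rX p (f' 0%R); rewrite rp perm1 f'K addr0 => /(can_inj f'K)/esym; exact.
move/(congr1 (@nat_of_ord _)); rewrite val_Zp_nat //= modn_small; first by lia.
by rewrite -mulnn; nia.
Qed.

(** ['F_p] unfolds to ['Z_(pdiv p)]. The variable [q] lets coordinates in ['F_p] serve as elements
    of ['Z_q], with [q] instantiated by [p] afterwards. *)
Lemma four_types_of_basis p (gT : finGroupType) (S : {set gT}) (u t : gT) q :
  prime p -> #|gT| = (p ^ 2)%N -> (forall x : gT, x ^+ p = 1) -> 1 \notin S ->
  t != 1 -> u \notin <[t]> ->
  (forall z i j : 'F_p, i != 0%R -> j != 0%R ->
     (u ^+ z * t ^+ i \in S) = (u ^+ z * t ^+ j \in S)) -> q = pdiv p ->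
  exists S' : {set 'Z_q * 'Z_q},
    let H := vertical_axis q in
    [/\ 1 \notin S', digraph_iso (cayley S) (cayley S'),
        H :&: S' = set0 \/ H :&: S' = H :\ (0%R, 0%R) &
        forall a : 'Z_q, let a0 : 'Z_q * 'Z_q := (a, 0%R) in let aH := a0 *: H in
          aH <> H ->
          [\/ aH :&: S' = aH, aH :&: S' = set0, aH :&: S' = [set a0] |
              aH :&: S' = aH :\ a0]].
Proof.
move=> p_pr cardG expp S1 t1 ut HS ->.
pose oc := @of_coord p gT u t; pose cd := @to_coord p gT u t.
have cdK : cancel cd oc := coordK p_pr cardG expp t1 ut.
have ocK : cancel oc cd := of_coordK p_pr cardG expp t1 ut.
pose S' : {set 'Z_(pdiv p) * 'Z_(pdiv p)} := [set c | oc c \in S].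
have HS' a b b' : b != 0%R -> b' != 0%R -> ((a, b) \in S') = ((a, b') \in S').
  by move=> b0 b'0; rewrite !inE; apply: HS.
have oc0 : oc (0%R, 0%R) = 1 by apply: of_coord0.
have S'0 : (0%R, 0%R) \notin S' by rewrite inE oc0.
have one0 : (1%R : 'F_p) != 0%R by rewrite oner_neq0.
exists S'; split => //.
- apply: digraph_iso_sym; exists oc; first by exists cd.
  move=> c d; rewrite /cayley inE -[_^-1 * d]/(- c + d)%R addrC.
  by rewrite /oc (of_coordB p_pr cardG expp).
- have VE (c : 'F_p * 'F_p) : (c \in vertical_axis (pdiv p)) = (c.1 == 0%R).
    apply/imsetP/eqP => [[i _ ->] //|c0]; exists c.2 => //.
    by rewrite -c0; apply: surjective_pairing.
  have [S1'|S1'] := boolP ((0%R, 1%R) \in S'); [right|left]; apply/setP => -[a b].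
    rewrite !in_setI in_setD1 VE -pair_eqE /=; have [->|a0] := eqVneq a 0%R; last by rewrite andbF.
    rewrite andbT /=; have [->|b0] := eqVneq b 0%R; first by rewrite (negPf S'0).
    by rewrite (HS' _ b 1%R).
  rewrite in_setI in_set0 VE /=; have [->|a0] := eqVneq a 0%R => //=.
  have [->|b0] := eqVneq b 0%R; first by rewrite (negPf S'0).
  by rewrite (HS' _ b 1%R) // (negPf S1').
move=> a a0 aH _.
have aHE c : (c \in aH) = (c.1 == a).
  rewrite mem_lcoset; apply/imsetP/eqP => [[i _ E]|Ec].
    have := congr1 fst E; rewrite -[(a0^-1 * c).1]/(- a + c.1)%R addrC => /eqP.
    by rewrite subr_eq0 => /eqP.
  exists c.2 => //; rewrite [LHS]surjective_pairing -[(a0^-1 * c).1]/(- a + c.1)%R.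
  by rewrite -[(a0^-1 * c).2]/(- 0 + c.2)%R Ec addNr oppr0 add0r.
have a0E b : ((a, b) == a0) = (b == 0%R) by rewrite -pair_eqE /= eqxx.
have inaH x (X : bool) : (x \in aH) && X -> x = (a, x.2).
  by rewrite aHE => /andP[/eqP <- _]; apply: surjective_pairing.
have [Sa0|Sa0] := boolP (a0 \in S'); have [Sa1|Sa1] := boolP ((a, 1%R) \in S').
- apply: Or41; apply/setP => -[c b]; rewrite in_setI aHE /=.
  have [->|] //= := eqVneq c a; have [->//|b0] := eqVneq b 0%R.
  by rewrite (HS' _ b 1%R).
- apply: Or43; apply/setP => -[c b]; rewrite in_setI aHE in_set1 /=.
  have [->|ca] //= := eqVneq c a; last by rewrite -pair_eqE /= (negPf ca).
  rewrite a0E; have [->//|b0] := eqVneq b 0%R.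
  by rewrite (HS' _ b 1%R) // (negPf Sa1).
- apply: Or44; apply/setP => -[c b]; rewrite in_setI in_setD1 aHE /=.
  have [->|ca] /= := eqVneq c a; last by rewrite andbF.
  rewrite a0E andbT; have [->|b0] := eqVneq b 0%R; first exact: negPf.
  by rewrite (HS' _ b 1%R).
apply: Or42; apply/setP => -[c b]; rewrite in_setI aHE in_set0 /=.
have [->|] //= := eqVneq c a; have [->|b0] := eqVneq b 0%R; first exact: negPf.
by rewrite (HS' _ b 1%R) // (negPf Sa1).
Qed.

(** * Groups of order 4 and complete digraphs *)

Lemma card4_eq (T : finType) (a b c y z : T) : #|T| = 4 -> uniq [:: a; b; c] ->
  y \notin [:: a; b; c] -> z \notin [:: a; b; c] -> y = z.
Proof.
move=> c4 abc ya za; apply/eqP; apply: contraT => yz.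
have : uniq [:: y; z; a; b; c] by rewrite cons_uniq in_cons negb_or yz ya cons_uniq za abc.
by move/card_uniqP => /= E; have := max_card (mem [:: y; z; a; b; c]); rewrite E c4.
Qed.

(** In exponent 2 the product of two distinct involutions is the third, so every permutation fixing
    1 is an automorphism of the group and none violates normality. In the cyclic case a violating
    [g] identifies the memberships of all nonidentity elements. *)
Lemma order4_nonnormal (gT : finGroupType) (S : {set gT}) :
  #|gT| = 4 -> 1 \notin S -> ~~ normal_cayley S ->
  [set: gT] \isog [set: 'Z_4] /\ (S = set0 \/ S = [set~ 1]).
Proof.
move=> c4 S1 nn.
have p2 : prime 2 by [].
have mulC := @mulgC_p2 2 gT p2 c4.
have [g Ag [g1 Ng]] : exists2 g, g \in digraph_aut (cayley S) &
    g 1 = 1 /\ g \notin 'N(left_regular gT).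
  have /subsetPn[g0 Ag0 Ng0] : ~~ (digraph_aut (cayley S) \subset 'N(left_regular gT)).
    by apply: contra nn => H; rewrite /normal_cayley /normal left_regular_sub_aut.
  have [g Ag [g1 [a Eg]]] := @stab1_norm _ (digraph_aut_group (cayley S)) _ (left_regular_sub_aut S) Ag0.
  exists g => //; split=> //; apply: contra Ng0 => Ng.
  by rewrite Eg groupM // (subsetP (normG (left_regular_group gT))) ?mem_translation.
have gI := @perm_inj _ g.
have gM : ~ (forall x y, g (x * y) = g x * g y).
  by move=> gM; case/negP: Ng; apply/norm_left_regularP => x y; rewrite gM g1 invg1 mulg1.
have [/existsP[x ox]|/existsPn no4] := boolP [exists x : gT, #[x] == 4]; last first.
  case: gM => x y; have sq (z : gT) : z * z = 1.
    have : #[z] %| (2 ^ 2)%N by rewrite -[(2 ^ 2)%N]c4 -cardsT order_dvdG ?in_setT.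
    case/(dvdn_pfactor _ _ p2) => -[|[|[|m]]] // _ oz; last by case/eqP: (no4 z).
      by move/eqP: oz; rewrite order_eq1 => /eqP->; rewrite mulg1.
    by apply/eqP; rewrite -expg2 -order_dvdn oz.
  have [->|x1] := eqVneq x 1; first by rewrite g1 !mul1g.
  have [->|y1] := eqVneq y 1; first by rewrite g1 !mulg1.
  have [->|xy] := eqVneq x y; first by rewrite !sq g1.
  have nin (a b : gT) : a != 1 -> b != 1 -> a != b -> a * b \notin [:: 1; a; b].
    move=> a1 b1 ab; rewrite !inE !negb_or; apply/and3P; split.
    - by apply: contra ab => /eqP E; rewrite -[a]mulg1 -(sq b) mulgA E mul1g.
    - by apply: contra b1 => /eqP E; apply/eqP/(mulgI a); rewrite mulg1.
    by apply: contra a1 => /eqP E; apply/eqP/(mulIg b); rewrite mul1g.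
  have gn1 a : a != 1 -> g a != 1 by rewrite -{2}g1 (inj_eq gI).
  apply: (@card4_eq _ 1 (g x) (g y)) => //.
  - by rewrite /= !inE !negb_or (eq_sym 1) gn1 // (eq_sym 1) gn1 // (inj_eq gI) xy.
  - have := nin x y x1 y1 xy; rewrite !inE -{2}g1 !(inj_eq gI) //.
  - by apply: nin; rewrite ?gn1 ?(inj_eq gI).
have cyc : [set: gT] = <[x]>.
  by apply/eqP; rewrite eq_sym eqEcard subsetT cardsT c4 -orderE (eqP ox).
have oxE := eqP ox; have x4 : x ^+ 4 = 1 by rewrite -oxE expg_order.
have memx y : exists2 i, i < 4 & y = x ^+ i.
  have : y \in <[x]> by rewrite -cyc in_setT.
  by case/cyclePmin => i; rewrite oxE; exists i.
have xI i j : i < 4 -> j < 4 -> i != j -> x ^+ i != x ^+ j.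
  by move=> i4 j4; rewrite eq_expg_mod_order oxE !modn_small.
split.
  rewrite isog_cyclic_card /=; last by apply/cyclicP; exists x.
  rewrite !cardsT c4 card_ord eqxx andbT.
  by apply/cyclicP; exists (Zp1 : 'Z_4); apply: Zp_cycle.
have gS y z : ((g y)^-1 * g z \in S) = (y^-1 * z \in S) by have /digraph_aut_cayleyP -> := Ag.
have gS1 y : (g y \in S) = (y \in S) by have := gS 1 y; rewrite g1 !invg1 !mul1g.
suff [s2 s3] : (x ^+ 2 \in S) = (x \in S) /\ (x ^+ 3 \in S) = (x \in S).
  have [xS|xS] := boolP (x \in S); [right|left]; apply/setP => y;
    have [[|[|[|[|]]]] // _ ->] := memx y; rewrite ?inE ?expg0 ?expg1 ?s2 ?s3 ?(negPf S1) ?eqxx ?(negPf xS) //.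
  - by rewrite xS; have := @xI 1%N 0 isT isT isT; rewrite expg1 => ->.
  - by rewrite xS; have := @xI 2 0 isT isT isT => ->.
  - by rewrite xS; have := @xI 3 0 isT isT isT => ->.
have no_power k : g x = x ^+ k -> g (x ^+ 2) = x ^+ (2 * k) -> g (x ^+ 3) = x ^+ (3 * k) -> False.
  move=> E1 E2 E3; apply: gM; have gk y : g y = y ^+ k.
    have [[|[|[|[|]]]] // _ ->] := memx y; rewrite ?expg0 ?g1 ?expg1n //.
    - by rewrite E2 expgM.
    - by rewrite E3 expgM.
  by move=> y z; rewrite !gk expgMn //; apply: mulC.
have [i i4 Ei] := memx (g x); have [j j4 Ej] := memx (g (x ^+ 2)); have [k k4 Ek] := memx (g (x ^+ 3)).
have neq a b c d : a < 4 -> b < 4 -> a != b -> g (x ^+ a) = x ^+ c -> g (x ^+ b) = x ^+ d -> c != d.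
  move=> a4 b4 ab Ec Ed; apply: contra (xI _ _ a4 b4 ab) => /eqP cd.
  by rewrite -(inj_eq gI) Ec Ed cd.
have E0 : g (x ^+ 0) = x ^+ 0 := g1; rewrite -{1}[x]expg1 in Ei.
move: i4 j4 k4 Ei Ej Ek (neq 0%N 1%N _ _ isT isT isT E0 Ei) (neq 0%N 2 _ _ isT isT isT E0 Ej)
  (neq 0%N 3 _ _ isT isT isT E0 Ek) (neq 1%N 2 _ _ isT isT isT Ei Ej)
  (neq 1%N 3 _ _ isT isT isT Ei Ek) (neq 2 3 _ _ isT isT isT Ej Ek).
have e3 : x^-1 = x ^+ 3 by apply/eqP; rewrite eq_invg_mul -expgS x4.
have d1 : x^-1 * x ^+ 2 = x by rewrite expgS mulKg expg1.
have d2 : x^-1 * x ^+ 3 = x ^+ 2 by rewrite expgS mulKg.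
have d3 : x ^- 2 * x = x ^+ 3 by rewrite -e3 expgSr expg1 invMg mulgKV.
(* Six permutations of the powers of [x] survive. Four force [S] to be constant off 1; the identity
   and the inversion are power maps, excluded by [no_power]. *)
case: i => [|[|[|[|]]]] //; case: j => [|[|[|[|]]]] //; case: k => [|[|[|[|]]]] // _ _ _ Ei Ej Ek _ _ _ _ _ _;
  rewrite expg1 in Ei; have := gS x (x ^+ 2); have := gS1 x; have := gS1 (x ^+ 2);
  have := gS1 (x ^+ 3); rewrite Ei Ej Ek ?expg1 ?d1 ?d2 ?d3;
  try by case: (x \in S); case: (x ^+ 2 \in S); case: (x ^+ 3 \in S).
  by case: (no_power 1%N).
exfalso; apply: (no_power 3 Ei); first by rewrite Ej (expgD x 4 2) x4 mul1g.
by rewrite Ek (expgD x 8 1) (expgM x 4 2) x4 expg1n mul1g.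
Qed.

(** The transposition of 1 and a generator [x] fixes [x ^+ 3], while affinity at [x] and [x ^+ 2]
    would send it to [x]. *)
Lemma complete4_nonnormal (gT : finGroupType) (S : {set gT}) (T : finType) :
  [set: gT] \isog [set: 'Z_4] -> digraph_iso (cayley S) (@complete_digraph T) ->
  ~~ normal_cayley S.
Proof.
move=> iso4 [f [f' fK f'K] fe].
have [x ox] : exists x : gT, #[x] = 4.
  have /cyclicP[x Ex] : cyclic [set: gT].
    by rewrite (isog_cyclic iso4); apply/cyclicP; exists (Zp1 : 'Z_4); apply: Zp_cycle.
  by exists x; rewrite orderE -Ex (card_isog iso4) cardsT card_ord.
have x1 : x != 1 by rewrite -order_eq1 ox.
have xx1 : x ^+ 2 != 1 by rewrite -order_dvdn ox.
have cE y z : (y^-1 * z \in S) = (y != z).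
  by rewrite -/(cayley S y z) -fe /complete_digraph (inj_eq (can_inj fK)).
apply/negP => /andP[_ /subsetP/(_ (tperm 1 x))].
have -> : tperm 1 x \in digraph_aut (cayley S).
  by apply/digraph_aut_cayleyP => y z; rewrite !cE (inj_eq perm_inj).
move=> /(_ isT)/norm_left_regularP/(_ x (x ^+ 2)); rewrite tpermL tpermR mul1g.
have xx_x : x ^+ 2 != x by apply: contra x1; rewrite expgS expg1 -{3}[x]mulg1 (inj_eq (mulgI x)).
have xxx_x : x * x ^+ 2 != x by apply: contra xx1; rewrite -{3}[x]mulg1 (inj_eq (mulgI x)).
have xxx1 : x * x ^+ 2 != 1 by rewrite -expgS -order_dvdn ox.
rewrite !tpermD // 1?eq_sym //.
move=> E; case/eqP: xxx_x; rewrite E (expgS x 1) mulKg expg1 //.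
Qed.

Lemma complete_iso (gT : finGroupType) n : #|gT| = n ->
  digraph_iso (cayley [set~ (1 : gT)]) (@complete_digraph 'I_n).
Proof.
move=> c; exists (fun x => cast_ord c (enum_rank x)).
  exists (fun i => enum_val (cast_ord (esym c) i)) => x.
    by rewrite cast_ordK enum_rankK.
  by rewrite enum_valK cast_ordKV.
move=> x y; rewrite /complete_digraph (inj_eq (@cast_ord_inj _ _ c)) (inj_eq enum_rank_inj).
by rewrite /cayley !inE -eq_mulVg1 eq_sym.
Qed.

Theorem corollary3 (p : nat) (gT : finGroupType) (S : {set gT}) :
  prime p ->
  #|gT| = (p ^ 2)%N ->
  1 \notin S ->
  (* The edgeless digraph on Z_4 (p = 2) is excluded: it is nonnormal but is
     not in the list. *)
  ~ [/\ p = 2, [set: gT] \isog [set: 'Z_4] & S = set0] ->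
  ~~ normal_cayley S <->
  [\/ (3 <= p \/ (p = 2 /\ [set: gT] \isog [set: 'Z_4])) /\
        digraph_iso (cayley S) (@complete_digraph 'I_(p ^ 2)),
      3 <= p /\
        exists S1 S2 : {set 'Z_p},
          [/\ 1 \notin S1, 1 \notin S2 &
              digraph_iso (cayley S) (wreath (cayley S1) (cayley S2))],
      [/\ 5 <= p,
          cayley_digraph_of ('Z_p * 'Z_p)%type (cayley S),
          ~ cayley_digraph_of 'Z_(p ^ 2) (cayley S) &
          digraph_iso (cayley S) (cayley (axes p)) \/
          digraph_iso (cayley S) (digraph_compl (cayley (axes p)))] |
      [/\ 5 <= p,
          ~ cayley_digraph_of 'Z_(p ^ 2) (cayley S) &
          exists S' : {set 'Z_p * 'Z_p},
            let H := vertical_axis p in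
            [/\ 1 \notin S',
                digraph_iso (cayley S) (cayley S'),
                H :&: S' = set0 \/ H :&: S' = H :\ (0%R, 0%R) &
                forall a : 'Z_p,
                  let a0 : 'Z_p * 'Z_p := (a, 0%R) in
                  let aH := a0 *: H in
                  aH <> H ->
                  [\/ aH :&: S' = aH,
                      aH :&: S' = set0,
                      aH :&: S' = [set a0] |
                      aH :&: S' = aH :\ a0]]]].
Proof.
move=> p_pr cardG S1 notE; have p1 := prime_gt1 p_pr.
split=> [nn|]; last first.
  have column (e : rel ('Z_p * 'Z_p)) : 5 <= p ->
    (forall a a' (s : {perm 'Z_p}) b b', e (a, s b) (a', s b') = e (a, b) (a', b')) ->
    digraph_iso (cayley S) e -> ~~ normal_cayley S.
    by move=> p5; apply: column_nonnormal; rewrite ?card_prime_Zp // prime_gt0.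
  have axes_inv a a' (s : {perm 'Z_p}) b b' :
      cayley (axes p) (a, s b) (a', s b') = cayley (axes p) (a, b) (a', b').
    by apply: cayley_column_invariant => *; apply: axes_column.
  case=> [[[p3|[_ iso4]] iso]|[p3 [S3 [S2 [_ _ iso]]]]|[p5 _ _ [] iso]|[p5 _ [S' [_ iso HS aHS]]]].
  - by apply: complete_nonnormal iso; rewrite card_ord -mulnn; nia.
  - exact: complete4_nonnormal iso4 iso.
  - by apply: (wreath_nonnormal 0%R p_pr _ iso); rewrite card_prime_Zp.
  - exact: column iso.
  - apply: column iso => // a a' s b b'.
    by rewrite /digraph_compl axes_inv -!pair_eqE /= (inj_eq perm_inj).
  by apply: column iso => //; apply: cayley_column_invariant; apply: four_types_column.
have [p2|p3] : p = 2 \/ 3 <= p by lia.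
  have cG4 : #|gT| = 4 by rewrite cardG p2.
  have [iso4 [S0|ST]] := order4_nonnormal cG4 S1 nn; first by case: notE.
  by apply: Or41; split; [right | rewrite ST; apply: complete_iso].
(* For [p >= 3] every digraph lands in (2) or (4): the complete digraph is a wreath product of
   complete ones, and the digraphs of (3) have the coset patterns of (4). *)
have [[H [cH Hreg]]|[p5 expp irr [u [t [u1 tu HS]]]]] := nonnormal_structure p_pr cardG S1 nn.
  by apply: Or42; split=> //; apply: wreath_of_coset_regular p_pr cardG cH Hreg S1.
apply: Or44; split=> //; first exact: not_cayley_cyclic.
apply: four_types_of_basis S1 _ _ HS _ => //.
- by apply: contraNneq tu => ->; apply: group1.
- exact: (notin_cycle_sym p_pr expp u1 tu).
by rewrite pdiv_id.
Qed.
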